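(* Let $(\vartheta_0,D)$ be one of the pairs $(0.924,6)$, $(0.739,8)$, $(0.643,12)$, $(0.584,16)$, $(0.544,20)$, $(0.516,26)$, and suppose some $\vartheta>\vartheta_0$ satisfies both conditions (A) and (B) below. Then there exist absolute constants $C$, $c>0$, an odd integer $b\le C$ and an even integer $d$ with $0<|d|\le D$ such that $P^-(p+d)>p^c$ and $\Omega(p+d)=b$ for infinitely many primes $p$.
   Context: $P^-(n)$ is the smallest prime factor of $n$; $\Omega(n)$ is the number of prime factors of $n$ counted with multiplicity and $\lambda(n)=(-1)^{\Omega(n)}$. Condition (A): for every $\varepsilon>0$, $A>0$, $\sum_{q\le N^{\vartheta-\varepsilon}}\max_{a:(a,q)=1}\bigl|\sum_{p\le N,\,p\equiv a\ (\mathrm{mod}\ q)}\log p-\frac{N}{\varphi(q)}\bigr|\ll_{\varepsilon,A}\frac{N}{(\log N)^A}$ ($p$ over primes). Condition (B): for every $\varepsilon>0$, $A>0$, $\sum_{q\le N^{\vartheta-\varepsilon}}\max_{y\le N}\max_a\bigl|\sum_{n\le y,\,n\equiv a\ (\mathrm{mod}\ q)}\lambda(n)\bigr|\ll_{\varepsilon,A}\frac{N}{(\log N)^A}$. *)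

(* Defs.v *)
From Stdlib Require Import Reals.
From mathcomp Require Import all_boot all_order all_algebra.
From mathcomp Require Import Rstruct.

Set Implicit Arguments.
Unset Strict Implicit.
Unset Printing Implicit Defensive.

Definition bigOmega (n : nat) : nat := \sum_(p <- primes n) logn p n.

Definition liouville (n : nat) : R := pow (Ropp (INR 1)) (bigOmega n).

(* P^-(n): smallest prime factor of n (mathcomp's pdiv, for n > 1). *)
Definition least_prime_factor (n : nat) : nat := pdiv n.

Open Scope R_scope.

Definition Rleb (x y : R) : bool := if Rle_dec x y then true else false.

Definition prime_AP_error (N q a : nat) : R :=
  (\sum_(p < N.+1 | prime p && (p %% q == a %% q)%N) ln (INR p))%R
  - INR N / INR (totient q).

Definition liouville_AP_sum (y q a : nat) : R :=
  (\sum_(1 <= n < y.+1 | (n %% q == a %% q)%N) liouville n)%R.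

Definition condA (theta : R) : Prop :=
  forall eps A : R, 0 < eps -> 0 < A ->
  exists K : R, forall N : nat, (2 <= N)%N ->
    (\sum_(1 <= q < N.+1 | Rleb (INR q) (Rpower (INR N) (theta - eps)))
        \big[Rmax/0]_(a < q | coprime a q) Rabs (prime_AP_error N q a))%R
    <= K * (INR N / Rpower (ln (INR N)) A).

Definition condB (theta : R) : Prop :=
  forall eps A : R, 0 < eps -> 0 < A ->
  exists K : R, forall N : nat, (2 <= N)%N ->
    (\sum_(1 <= q < N.+1 | Rleb (INR q) (Rpower (INR N) (theta - eps)))
        \big[Rmax/0]_(y < N.+1) \big[Rmax/0]_(a < q)
           Rabs (liouville_AP_sum y q a))%R
    <= K * (INR N / Rpower (ln (INR N)) A).

Close Scope R_scope.

(* Main.v *)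
(* Let n run over a residue class mod W = primorial D0 on which every n + h, for h
   in an admissible k-tuple H, is prime to W.  If n + h prime always forced
   liouville (n + h') = 1 for the other h', then
     sum_h liouville (n + h) >= - k + (2 k - 2) #{h : n + h prime}.
   Average this against Selberg weights (squares of divisor sums with smooth
   coefficients): condition (B) makes the left side negligible and condition (A)
   evaluates the count of primes, so the average contradicts
   upper_const < (k - 1) theta0 lower_const / m, which is checked in exact integer
   arithmetic on a grid of m points.  Discarding the n for which some n + h has a
   prime factor below a small power of N costs little, so the n + h' found have a
   bounded number of prime factors, and a pigeonhole fixes h, h' and that number. *)
Require Import Defs.
From Stdlib Require Import Reals ZArith Classical.
From mathcomp Require Import all_boot all_order all_algebra.
From mathcomp Require Import Rstruct.
From mathcomp Require Import ring lra zify.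
(* [Rstruct] also defines an [Rleb]. *)
Import Defs.
Import Order.TTheory GRing.Theory Num.Theory.
Set Implicit Arguments.
Unset Strict Implicit.
Unset Printing Implicit Defensive.
Local Open Scope ring_scope.

(** * Multiplicative functions on finite sets, the model for squarefree integers *)

Section SetProducts.
Variables (F : fieldType) (T : finType).
Implicit Types (f g : T -> F) (A B D S : {set T}).

(** No asymptotic formula and no integral occurs; every estimate is a one-sided inequality. A
    squarefree integer is a finite set of primes in [(D0, N]], a multiplicative function is a
    product [pr], and [len] is the logarithm of the integer in units of [L], the logarithm of the
    sieve level. A multiplicative function is then a measure on the line, and its distribution
    function is compared with step functions on the grid [i / m] by partial summation and repeated
    convolution. So binomial coefficients stand where the usual analysis has powers over factorials,
    and both sieve constants are finite sums. The same quadratic form is evaluated for three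
    densities: [k / p] gives the total weight, [(k - 1) / (p - 1)] the primes, and the density with
    one prime [p] forced to divide gives the cost of a small factor. The last gains the square of
    [ln p / L], which is why numbers with small prime factors carry little weight. Losses at primes
    above [D0] tend to [1] as [D0] grows, so [D0] is fixed large before [N] is chosen. The bounds of
    Chebyshev and Mertens type that are needed come from condition (A) itself. *)

Definition pr f S : F := \prod_(p in S) f p.

Lemma pr0 f : pr f set0 = 1. Proof. by rewrite /pr big_set0. Qed.

Lemma eq_pr f g S : (forall p, p \in S -> f p = g p) -> pr f S = pr g S.
Proof. by move=> fg; apply: eq_bigr. Qed.

Lemma prM f g S : pr (fun p => f p * g p) S = pr f S * pr g S.
Proof. exact: big_split. Qed.

Lemma prV f S : pr (fun p => (f p)^-1) S = (pr f S)^-1.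
Proof. by rewrite /pr prodfV. Qed.

Lemma pr_exp f n S : pr (fun p => f p ^+ n) S = pr f S ^+ n.
Proof. by rewrite /pr prodrXl. Qed.

Lemma pr_const (c : F) S : pr (fun=> c) S = c ^+ #|S|.
Proof. by rewrite /pr prodr_const. Qed.

Lemma prU f A B : [disjoint A & B] -> pr f (A :|: B) = pr f A * pr f B.
Proof. by move=> AB; rewrite /pr -bigU //=; apply: eq_bigl => x; rewrite !inE. Qed.

Lemma pr_set1 f p : pr f [set p] = f p.
Proof. by rewrite /pr big_set1. Qed.

Lemma prID f A B : pr f A = pr f (A :&: B) * pr f (A :\: B).
Proof. exact: big_setID. Qed.

Lemma pr_neq0 f S : (forall p, f p != 0) -> pr f S != 0.
Proof. by move=> f0; apply/prodf_neq0. Qed.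

Lemma prUI f A B : (forall p, f p != 0) ->
  pr f (A :|: B) = pr f A * pr f B * pr (fun p => (f p)^-1) (A :&: B).
Proof.
move=> f0; rewrite prV [in RHS](prID f B A) setIC.
have -> : A :|: B = A :|: (B :\: A) by apply/setP=> x; rewrite !inE; case: (x \in A).
rewrite prU; last by rewrite disjoints_subset; apply/subsetP => x xA; rewrite !inE xA.
by rewrite mulrA -!mulrA [pr f (B :\: A) * _]mulrC [pr f (A :&: B) * _]mulrA divff ?pr_neq0 // mul1r.
Qed.

Lemma sum_subsets_pr f g S :
  \sum_(A : {set T} | A \subset S) pr f A * pr g (S :\: A) =
  pr (fun p => f p + g p) S.
Proof.
(* Outside [S] the factors are extended by [0] and [1], so that distributivity over the whole type
   applies and kills every [A] not inside [S]. *)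
pose f' p := if p \in S then f p else 0; pose g' p := if p \in S then g p else 1.
transitivity (\prod_p (f' p + g' p)); last first.
  rewrite /pr (bigID (mem S)) /= [X in _ * X]big1 ?mulr1.
    by apply: eq_bigr => p pS; rewrite /f' /g' pS.
  by move=> p /negbTE pS; rewrite /f' /g' pS add0r.
rewrite bigA_distr [RHS](bigID (fun A => A \subset S)) /= [X in _ + X]big1 ?addr0.
  apply: eq_bigr => A AS; rewrite [RHS](bigID (mem A)) /=; congr (_ * _).
    by apply: eq_bigr => p pA; rewrite pA /f' (subsetP AS).
  rewrite /pr [RHS](bigID (mem S)) /= [X in _ * X]big1 ?mulr1.
    apply: eq_big => p; first by rewrite !inE.
    by rewrite !inE => /andP[/negbTE -> pS]; rewrite /g' pS.
  by move=> p /andP[/negbTE -> /negbTE pS]; rewrite /g' pS.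
move=> A /subsetPn[p pA pS]; rewrite (bigD1 p) //= pA /f' (negbTE pS) mul0r.
by [].
Qed.

Lemma sum_subsets_pr1 f S :
  \sum_(A : {set T} | A \subset S) pr f A = pr (fun p => 1 + f p) S.
Proof.
rewrite (eq_pr (g := fun p => f p + 1)) => [|p _]; last by rewrite addrC.
rewrite -(sum_subsets_pr f (fun=> 1)); apply: eq_bigr => A _.
by rewrite pr_const expr1n mulr1.
Qed.

Lemma sum_supersets A (E : {set T} -> F) :
  \sum_(S : {set T} | A \subset S) E S =
  \sum_(B : {set T} | [disjoint A & B]) E (A :|: B).
Proof.
rewrite (reindex_onto (fun B => A :|: B) (fun S => S :\: A)) /=.
  apply: eq_bigl => B; rewrite subsetUl /= setDUl setDv set0U.
  by rewrite disjoint_sym; apply/eqP/setDidPl.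
by move=> S AS; apply/setP=> x; rewrite !inE; case: (boolP (x \in A)) => // /(subsetP AS) ->.
Qed.

Lemma sum_between f A S : A \subset S ->
  \sum_(D : {set T} | (A \subset D) && (D \subset S)) pr f D =
  pr f A * pr (fun p => 1 + f p) (S :\: A).
Proof.
move=> AS; rewrite -sum_subsets_pr1 mulr_sumr big_mkcondr /= sum_supersets.
rewrite [RHS]big_mkcond [LHS]big_mkcond; apply: eq_bigr => B _.
rewrite subUset AS subsetD /= [in RHS]andbC [in RHS]disjoint_sym.
by case: ifP => //= AB; case: ifP => //= BS; rewrite prU.
Qed.

End SetProducts.

(** * Selberg's diagonalisation of the quadratic form *)

Section Diagonalisation.
Variables (F : fieldType) (T : finType) (g0 h : T -> F) (y : {set T} -> F).
Hypothesis g0_neq0 : forall p, g0 p != 0.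

(** Selberg's coefficients in terms of the diagonal variables [y]; the sign is the Moebius function
    of the integer encoded by [D]. *)
Definition sieve_coef (D : {set T}) : F :=
  (-1) ^+ #|D| / pr g0 D * \sum_(S : {set T} | D \subset S) pr h S * y S.

(** A union of sets is a least common multiple, so this is the main term of the average of a squared
    divisor sum. *)
Definition quad_form (g : T -> F) : F :=
  \sum_(D : {set T}) \sum_(E : {set T})
    sieve_coef D * sieve_coef E * pr g (D :|: E).

(** Exchanging the sums leaves, for each [S] containing [A], a sum of products of [- g / g0] over
    the sets between [A] and [S], which factors over [A] and [S :\: A]. A prime at which [g = g0]
    cannot occur in [B]. *)
Lemma sieve_coef_transform (g : T -> F) (A : {set T}) :
  \sum_(D : {set T} | A \subset D) sieve_coef D * pr g D =
  (-1) ^+ #|A| * pr (fun p => g p / g0 p * h p) A *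
  \sum_(B : {set T} | [disjoint A & B])
    pr (fun p => h p * (1 - g p / g0 p)) B * y (A :|: B).
Proof.
pose f p := - (g p / g0 p).
have prf D : pr f D = (-1) ^+ #|D| * pr g D / pr g0 D.
  rewrite -prV -pr_const -!prM; apply: eq_pr => p _; by rewrite /f; ring.
transitivity (\sum_(S : {set T} | A \subset S) pr h S * y S *
    \sum_(D : {set T} | (A \subset D) && (D \subset S)) pr f D).
  under eq_bigr => D AD do rewrite /sieve_coef mulrAC mulr_sumr.
  rewrite (exchange_big_dep (fun S : {set T} => A \subset S)) /=; last first.
    by move=> D S AD DS; exact: subset_trans DS.
  apply: eq_bigr => S AS; rewrite mulr_sumr; apply: eq_bigr => D _.
  by rewrite prf; ring.
under eq_bigr => S AS do rewrite sum_between //.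
rewrite sum_supersets mulr_sumr; apply: eq_bigr => B AB.
rewrite prU // setDUl setDv set0U.
have /setDidPl -> : [disjoint B & A] by rewrite disjoint_sym.
by rewrite !prM prf prV /f; ring.
Qed.

(* Selberg's diagonalisation, for a density [g] that may differ from the density [g0]
   used to define the weights. *)
Lemma quad_form_diag (g : T -> F) : (forall p, g p != 0) ->
  quad_form g =
  \sum_(A : {set T}) pr (fun p => ((g p)^-1 - 1) * (g p / g0 p * h p) ^+ 2) A *
    (\sum_(B : {set T} | [disjoint A & B])
      pr (fun p => h p * (1 - g p / g0 p)) B * y (A :|: B)) ^+ 2.
Proof.
move=> gn0; rewrite /quad_form.
transitivity (\sum_(A : {set T}) pr (fun p => (g p)^-1 - 1) A *
    (\sum_(D : {set T} | A \subset D) sieve_coef D * pr g D) ^+ 2); last first.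
  apply: eq_bigr => A _; rewrite sieve_coef_transform !exprMn.
  rewrite -exprM mulnC exprM sqrrN !expr1n mul1r mulrA; congr (_ * _).
  by rewrite -pr_exp -prM.
(* Replacing [pr g (D :|: E)] by [pr g D * pr g E] leaves a factor [(g p)^-1] at the common primes;
   written as [1 + ((g p)^-1 - 1)] it expands over subsets [A] of [D :&: E], which decouples [D]
   from [E]. *)
transitivity (\sum_(D : {set T}) \sum_(E : {set T}) \sum_(A : {set T} | A \subset D :&: E)
   pr (fun p => (g p)^-1 - 1) A * ((sieve_coef D * pr g D) * (sieve_coef E * pr g E))).
  apply: eq_bigr => D _; apply: eq_bigr => E _; rewrite -mulr_suml.
  rewrite sum_subsets_pr1 prUI //.
  have -> : pr (fun p => 1 + ((g p)^-1 - 1)) (D :&: E) = pr (fun p => (g p)^-1) (D :&: E).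
    by apply: eq_pr => p _; rewrite addrC subrK.
  by ring.
under eq_bigr => D _ do rewrite (exchange_big_dep xpredT) //=.
rewrite exchange_big /=; apply: eq_bigr => A _.
rewrite expr2 mulr_suml mulr_sumr [RHS]big_mkcond /=; apply: eq_bigr => D _.
case: ifP => [AD|AD]; last first.
  by rewrite big1 // => E; rewrite subsetI AD.
rewrite mulr_sumr mulr_sumr; apply: eq_bigl => E; by rewrite subsetI AD.
Qed.

End Diagonalisation.

Lemma le_of_eq (F : realFieldType) (x y : F) : x = y -> x <= y.
Proof. by move=> ->. Qed.

(** * Partial summation against a decreasing function *)

Section Abel.
Variables (F : realFieldType) (I : finType) (c x : I -> F) (t : nat -> F).
Variables (phi : F -> F) (b : nat -> F).
Hypothesis c_ge0 : forall i, 0 <= c i.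
Hypothesis t_mono : forall i, t i <= t i.+1.
Hypothesis phi_mono : forall r s, r <= s -> phi s <= phi r.

Let G n := \sum_(i | x i <= t n) c i.
Let B n := \sum_(j < n.+1) b j.

(** The masses [b] sit at grid points with cumulative sums below those of [c], so more of [c] lies
    at small arguments, where [phi] is large. *)
Lemma abel_lower n : (forall s, 0 <= phi s) -> (forall i, (i <= n)%N -> B i <= G i) ->
  \sum_(j < n.+1) b j * phi (t j) <= \sum_i c i * phi (x i).
Proof.
move=> phi0 BG.
(* After subtracting the last value of [phi] the final term vanishes, and each induction step adds a
   cumulative mass times one decrement of [phi]. *)
have key : \sum_(j < n.+1) b j * (phi (t j) - phi (t n)) <=
           \sum_(i | x i <= t n) c i * (phi (x i) - phi (t n)).
  elim: n BG => [|n IH] BG.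
    rewrite big_ord_recl big_ord0 /= subrr mulr0 addr0; apply: sumr_ge0 => i xi.
    by rewrite mulr_ge0 // subr_ge0 phi_mono.
  have {}IH := IH (fun i Hi => BG i (leqW Hi)).
  have H1 : \sum_(j < n.+2) b j * (phi (t j) - phi (t n.+1)) =
      \sum_(j < n.+1) b j * (phi (t j) - phi (t n)) + B n * (phi (t n) - phi (t n.+1)).
    rewrite big_ord_recr /= subrr mulr0 addr0 /B mulr_suml -big_split /=.
    by apply: eq_bigr => j _; ring.
  have H2 : \sum_(i | x i <= t n) c i * (phi (x i) - phi (t n)) + G n * (phi (t n) - phi (t n.+1))
      <= \sum_(i | x i <= t n.+1) c i * (phi (x i) - phi (t n.+1)).
    rewrite /G mulr_suml -big_split /= [leRHS](bigID (fun i => x i <= t n)) /=.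
    rewrite -[leLHS]addr0; apply: lerD.
      rewrite (eq_bigl (fun i => (x i <= t n.+1) && (x i <= t n))) => [|i].
        by apply: ler_sum => i _; apply: le_of_eq; ring.
      by case: (leP (x i) (t n)) => h; rewrite ?andbF // (le_trans h).
    by apply: sumr_ge0 => i /andP[xi _]; rewrite mulr_ge0 // subr_ge0 phi_mono.
  rewrite H1; apply: le_trans H2; apply: lerD => //.
  by rewrite ler_wpM2r ?subr_ge0 ?phi_mono // BG.
have H3 : \sum_(j < n.+1) b j * phi (t j) =
    \sum_(j < n.+1) b j * (phi (t j) - phi (t n)) + B n * phi (t n).
  by rewrite /B mulr_suml -big_split /=; apply: eq_bigr => j _; ring.
have H4 : \sum_(i | x i <= t n) c i * phi (x i) =
    \sum_(i | x i <= t n) c i * (phi (x i) - phi (t n)) + G n * phi (t n).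
  by rewrite /G mulr_suml -big_split /=; apply: eq_bigr => j _; ring.
apply: (@le_trans _ _ (\sum_(i | x i <= t n) c i * phi (x i))).
  by rewrite H3 H4 lerD // ler_wpM2r // BG.
rewrite [leRHS](bigID (fun i => x i <= t n)) /= lerDl sumr_ge0 // => i _.
by rewrite mulr_ge0.
Qed.

(** Every mass is moved to the left end of its cell, hence [t j.-1]; at [j = 0] this is [t 0], which
    lies below all points. *)
Lemma abel_upper n : (forall i, t 0%N <= x i) -> (forall s, 0 <= phi s) ->
  (forall i, (i <= n)%N -> G i <= B i) ->
  \sum_(i | x i <= t n) c i * phi (x i) <= \sum_(j < n.+1) b j * phi (t j.-1).
Proof.
move=> x0 phi0 GB; pose psi j := phi (t j.-1).
have psi_mono j : psi j.+1 <= psi j.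
  by rewrite /psi /=; case: j => [|j] //=; apply: phi_mono.
have key : \sum_(i | x i <= t n) c i * (phi (x i) - psi n) <=
    \sum_(j < n.+1) b j * (psi j - psi n).
  elim: n GB => [|n IH] GB.
    rewrite big_ord_recl big_ord0 /= subrr mulr0 addr0; apply: sumr_le0 => i xi.
    by rewrite mulr_ge0_le0 // subr_le0 phi_mono.
  have {}IH := IH (fun i Hi => GB i (leqW Hi)).
  have H1 : \sum_(j < n.+2) b j * (psi j - psi n.+1) =
      \sum_(j < n.+1) b j * (psi j - psi n) + B n * (psi n - psi n.+1).
    rewrite big_ord_recr /= subrr mulr0 addr0 /B mulr_suml -big_split /=.
    by apply: eq_bigr => j _; ring.
  have H2 : \sum_(i | x i <= t n.+1) c i * (phi (x i) - psi n.+1) <=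
      \sum_(i | x i <= t n) c i * (phi (x i) - psi n) + G n * (psi n - psi n.+1).
    rewrite /G mulr_suml -big_split /= [leLHS](bigID (fun i => x i <= t n)) /=.
    rewrite -[leRHS]addr0; apply: lerD.
      rewrite (eq_bigl (fun i => (x i <= t n))) => [|i].
        by apply: ler_sum => i _; apply: le_of_eq; ring.
      by case: (leP (x i) (t n)) => h; rewrite ?andbF // (le_trans h).
    apply: sumr_le0 => i /andP[_]; rewrite -ltNge => xi.
    by rewrite mulr_ge0_le0 // subr_le0 phi_mono // ltW.
  rewrite H1; apply: le_trans H2 _; apply: lerD => //.
  by rewrite ler_wpM2r ?subr_ge0 ?psi_mono // GB.
have H3 : \sum_(j < n.+1) b j * psi j =
    \sum_(j < n.+1) b j * (psi j - psi n) + B n * psi n.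
  by rewrite /B mulr_suml -big_split /=; apply: eq_bigr => j _; ring.
have H4 : \sum_(i | x i <= t n) c i * phi (x i) =
    \sum_(i | x i <= t n) c i * (phi (x i) - psi n) + G n * psi n.
  by rewrite /G mulr_suml -big_split /=; apply: eq_bigr => j _; ring.
by rewrite H4 H3 lerD // ler_wpM2r ?GB // /psi.
Qed.

End Abel.

(** * Multiplicative measures on the logarithmic scale and their convolutions *)

Section LogMeasure.
Variables (F : realFieldType) (T : finType) (ell : T -> F).
Hypothesis ell_ge0 : forall p, 0 <= ell p.

Definition len (S : {set T}) : F := \sum_(p in S) ell p.

Definition cumul (u : T -> F) (t : F) : F := \sum_(S : {set T} | len S <= t) pr u S.

Lemma len0 : len set0 = 0. Proof. by rewrite /len big_set0. Qed.

Lemma len_ge0 S : 0 <= len S. Proof. exact: sumr_ge0. Qed.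

Lemma lenU (A B : {set T}) : [disjoint A & B] -> len (A :|: B) = len A + len B.
Proof. by move=> AB; rewrite /len -bigU //=; apply: eq_bigl => x; rewrite !inE. Qed.

Lemma len_sub (A B : {set T}) : A \subset B -> len A <= len B.
Proof.
move=> AB; rewrite /len [leRHS](big_setID A) /= (setIidPr AB) lerDl.
exact: sumr_ge0.
Qed.

Lemma pr_ge0 (u : T -> F) S : (forall p, 0 <= u p) -> 0 <= pr u S.
Proof. by move=> u0; apply: prodr_ge0. Qed.

Lemma ler_pr (u v : T -> F) S : (forall p, 0 <= u p <= v p) -> pr u S <= pr v S.
Proof. by move=> uv; apply: ler_prod. Qed.

Lemma sum_split (A : {set T}) (E : {set T} -> F) :
  \sum_(B : {set T}) E B =
  \sum_(C : {set T} | C \subset A) \sum_(B : {set T} | [disjoint A & B]) E (C :|: B).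
Proof.
rewrite (partition_big (fun B => B :&: A) (fun C => C \subset A)) /=; last first.
  by move=> B _; exact: subsetIr.
apply: eq_bigr => C CA.
rewrite (reindex_onto (fun B => C :|: B) (fun B => B :\: A)) /=; last first.
  by move=> B /eqP <-; rewrite setID.
apply: eq_bigl => B; apply/andP/idP.
  by case=> _ /eqP <-; rewrite disjoint_sym disjoints_subset setDE subsetIr.
move=> AB; have BA : B :&: A = set0 by apply/eqP; rewrite setI_eq0 disjoint_sym.
rewrite setIUl BA setU0 (setIidPl CA) eqxx; split=> //.
rewrite setDUl; move: CA; rewrite -setD_eq0 => /eqP ->; rewrite set0U.
by apply/eqP/setDidPl; rewrite disjoint_sym.
Qed.

(** Every set is [C :|: B] with [C] inside [A] and [B] disjoint from [A]. Dropping [C] can only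
    increase [phi], and the sets [C] contribute the product of [1 + u] over [A]. For
    [u = 1 / (p - 1)] this is an inequality of van Lint-Richert type. *)
Lemma sum_disjoint_lower (u : T -> F) (phi : F -> F) (A : {set T}) :
  (forall p, 0 <= u p) -> (forall r s, r <= s -> phi s <= phi r) ->
  (forall s, 0 <= phi s) ->
  pr (fun p => (1 + u p)^-1) A * \sum_(B : {set T}) pr u B * phi (len B) <=
  \sum_(B : {set T} | [disjoint A & B]) pr u B * phi (len B).
Proof.
move=> u0 phi_mono phi0.
have pA : 0 < pr (fun p => 1 + u p) A by apply: prodr_gt0 => p _; rewrite ltr_wpDr.
rewrite prV mulrC ler_pdivrMr // mulrC -sum_subsets_pr1 (sum_split A) mulr_suml.
apply: ler_sum => C CA; rewrite mulr_sumr; apply: ler_sum => B AB.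
have CB : [disjoint C & B] by exact: disjointWl CA AB.
rewrite prU // mulrA ler_wpM2l ?mulr_ge0 ?pr_ge0 // phi_mono //.
by rewrite len_sub // subsetUr.
Qed.

(** Expanding the product assigns each prime of [S] to [u] or to [v], so a sum of densities becomes
    a convolution over disjoint pairs. *)
Lemma sum_pr_add (u v : T -> F) (phi : F -> F) :
  \sum_(S : {set T}) pr (fun p => v p + u p) S * phi (len S) =
  \sum_(S2 : {set T}) pr v S2 *
    \sum_(S1 : {set T} | [disjoint S2 & S1]) pr u S1 * phi (len S2 + len S1).
Proof.
under eq_bigr => S _ do rewrite -sum_subsets_pr mulr_suml.
rewrite (exchange_big_dep xpredT) //=; apply: eq_bigr => A _.
rewrite sum_supersets mulr_sumr; apply: eq_bigr => B AB.
rewrite lenU // setDUl setDv set0U mulrA; congr (_ * pr _ _ * _).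
by apply/setDidPl; rewrite disjoint_sym.
Qed.

Lemma sum_pr_add_upper (u v : T -> F) (phi : F -> F) :
  (forall p, 0 <= u p) -> (forall p, 0 <= v p) -> (forall s, 0 <= phi s) ->
  \sum_(S : {set T}) pr (fun p => v p + u p) S * phi (len S) <=
  \sum_(S1 : {set T}) pr u S1 * \sum_(S2 : {set T}) pr v S2 * phi (len S2 + len S1).
Proof.
move=> u0 v0 phi0; rewrite sum_pr_add.
under [leRHS]eq_bigr => S _ do rewrite mulr_sumr.
rewrite exchange_big /=; apply: ler_sum => S2 _; rewrite mulr_sumr big_mkcond /=.
apply: ler_sum => S1 _; case: ifP => _; first by apply: le_of_eq; ring.
by rewrite !mulr_ge0 ?pr_ge0.
Qed.

(** For a lower bound the disjointness cannot be dropped; it is paid for by the factor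
    [(1 + u p)^-1] at the primes of [S2]. *)
Lemma sum_pr_add_lower (u v : T -> F) (phi : F -> F) :
  (forall p, 0 <= u p) -> (forall p, 0 <= v p) -> (forall s, 0 <= phi s) ->
  (forall r s, r <= s -> phi s <= phi r) ->
  \sum_(S1 : {set T}) pr u S1 *
    \sum_(S2 : {set T}) pr (fun p => v p / (1 + u p)) S2 * phi (len S2 + len S1) <=
  \sum_(S : {set T}) pr (fun p => v p + u p) S * phi (len S).
Proof.
move=> u0 v0 phi0 phim; rewrite sum_pr_add.
under eq_bigr => S _ do rewrite mulr_sumr.
rewrite exchange_big /=; apply: ler_sum => S2 _.
apply: (@le_trans _ _ (pr v S2 * (pr (fun p => (1 + u p)^-1) S2 *
   \sum_(B : {set T}) pr u B * phi (len S2 + len B)))).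
  rewrite !mulr_sumr; apply: ler_sum => S1 _; rewrite prM; apply: le_of_eq; ring.
rewrite ler_wpM2l ?pr_ge0 //.
apply: (@sum_disjoint_lower u (fun s => phi (len S2 + s))) => // r s rs.
by rewrite phim // lerD2l.
Qed.

Let ind (t s : F) : F := (s <= t)%R%:R.

Lemma ind_ge0 t s : 0 <= ind t s. Proof. exact: ler0n. Qed.

Lemma ind_mono t r s : r <= s -> ind t s <= ind t r.
Proof.
move=> rs; rewrite /ind; case: (leP s t) => st; last exact: ler0n.
by rewrite (le_trans rs st).
Qed.

Lemma cumulE u t : cumul u t = \sum_(S : {set T}) pr u S * ind t (len S).
Proof.
rewrite /cumul big_mkcond; apply: eq_bigr => S _; rewrite /ind.
by case: (leP (len S) t); rewrite ?mulr1 ?mulr0.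
Qed.

Lemma cumul_shift u t s : \sum_(S : {set T}) pr u S * ind t (len S + s) = cumul u (t - s).
Proof. by rewrite cumulE; apply: eq_bigr => S _; rewrite /ind lerBrDr. Qed.

Lemma cumul_ge0 u t : (forall p, 0 <= u p) -> 0 <= cumul u t.
Proof. by move=> u0; apply: sumr_ge0 => S _; apply: pr_ge0. Qed.

Lemma cumul_mono u s t : (forall p, 0 <= u p) -> s <= t -> cumul u s <= cumul u t.
Proof.
move=> u0 st; rewrite !cumulE; apply: ler_sum => S _; rewrite ler_wpM2l ?pr_ge0 //.
by rewrite /ind; case: (leP (len S) s) => h; rewrite ?(le_trans h st) ?ler0n.
Qed.

Lemma cumul_le u v t : (forall p, 0 <= u p <= v p) -> cumul u t <= cumul v t.
Proof. by move=> uv; apply: ler_sum => S _; apply: ler_pr. Qed.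

Lemma cumul_lt0 u t : t < 0 -> cumul u t = 0.
Proof.
move=> t0; rewrite /cumul big1 // => S h; have := len_ge0 S.
by rewrite leNgt (le_lt_trans h).
Qed.

Lemma sum_bin_le K d n : (\sum_(j < n) 'C(j + d, K) <= 'C(n + d, K.+1))%N.
Proof.
elim: n => [|n IH]; rewrite ?big_ord0 // big_ord_recr /= addSn binS addnC.
by rewrite addnC leq_add2r.
Qed.

Section Cumulative.
Variables (m : nat) (c : F).
Hypothesis m_gt0 : (0 < m)%N.
Hypothesis c_ge0 : 0 <= c.
Let t (i : nat) : F := i%:R / m%:R.

Let t_mono i : t i <= t i.+1.
Proof. by rewrite /t ler_wpM2r ?invr_ge0 ?ler0n // ler_nat. Qed.

Let t_sub i j : (i <= j)%N -> t j - t i = t (j - i).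
Proof. by move=> ij; rewrite /t -mulrBl natrB. Qed.

(** Induction on [K] by convolution with [u]. The bound stands for [(c j) ^ K / K!]; each round
    shifts it by two units, one from moving masses to left ends and one from the inclusive end of
    the hockey-stick sum, hence [K.*2]. *)
Lemma cumul_upper (u : T -> F) : (forall p, 0 <= u p) ->
  (forall i, (i <= m)%N -> cumul u (t i) <= c * (i.+1)%:R) ->
  forall K j, (j <= m)%N ->
  cumul (fun p => K%:R * u p) (t j) <= c ^+ K * 'C(j + K.*2, K)%:R.
Proof.
move=> u0 Hu; elim=> [|K IH] j jm.
  rewrite expr0 bin0 mulr1 /cumul (bigD1 set0) /=; last by rewrite len0 divr_ge0.
  rewrite pr0 big1 ?addr0 // => S /andP[_ /set0Pn[p pS]].
  by rewrite /pr (bigD1 p) //= !mul0r.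
pose v p := K%:R * u p; have v0 p : 0 <= v p by rewrite mulr_ge0.
rewrite (_ : cumul _ _ = \sum_(S : {set T}) pr (fun p => v p + u p) S * ind (t j) (len S)); last first.
  rewrite cumulE; apply: eq_bigr => S _; congr (_ * _); apply: eq_pr => p _.
  by rewrite /v -natr1; ring.
apply: le_trans (sum_pr_add_upper u0 v0 (ind_ge0 (t j))) _.
under eq_bigr => S _ do rewrite cumul_shift.
pose phi s := cumul v (t j - s).
have phi_mono r s : r <= s -> phi s <= phi r by move=> rs; rewrite cumul_mono // lerD2l lerN2.
have phi0 s : 0 <= phi s by rewrite cumul_ge0.
rewrite (_ : \sum_S _ = \sum_(S : {set T} | len S <= t j) pr u S * phi (len S)); last first.
  rewrite [RHS]big_mkcond; apply: eq_bigr => S _; case: (leP (len S) (t j)) => // h.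
  by rewrite cumul_lt0 ?mulr0 // subr_lt0.
have Hab := @abel_upper F {set T} (pr u) len t phi (fun=> c) (fun S => pr_ge0 S u0) t_mono phi_mono j _ phi0 _.
apply: le_trans (Hab _ _) _.
- by move=> S; rewrite /t mul0r len_ge0.
- move=> i ij; rewrite sumr_const card_ord -mulr_natr; apply: Hu.
  exact: leq_trans jm.
have Hphi (i : nat) : (i <= j)%N -> phi (t i) <= c ^+ K * 'C(j - i + K.*2, K)%:R.
  by move=> ij; rewrite /phi t_sub // IH // (leq_trans (leq_subr _ _)).
apply: (@le_trans _ _ (\sum_(i < j.+1) c * (c ^+ K * 'C(j.+1 - i + K.*2, K)%:R))).
  apply: ler_sum => i _; rewrite ler_wpM2l //.
  have ij : (i.-1 <= j)%N by rewrite (leq_trans (leq_pred _)) // -ltnS.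
  apply: le_trans (Hphi _ ij) _; rewrite ler_wpM2l ?exprn_ge0 // ler_nat.
  apply: leq_bin2l; rewrite leq_add2r; case: i ij => -[|i] /= _ _.
    by rewrite subn0 leqW.
  by rewrite subSS.
rewrite -mulr_sumr -mulr_sumr mulrA -exprS ler_wpM2l ?exprn_ge0 // -natr_sum ler_nat.
rewrite (reindex_inj rev_ord_inj) /=.
apply: leq_trans (_ : \sum_(i < j.+1) 'C(i + K.*2.+1, K) <= _)%N; last first.
  by apply: leq_trans (sum_bin_le _ _ _) _; rewrite doubleS !addnS addSn.
by apply: leq_sum => i _; apply: leq_bin2l; have := ltn_ord i; lia.
Qed.

(** The densities are chosen to survive convolution: with [u = 1 / (x - (K + 2))] and [v = K u], the
    sum [v + u] is the next density and [v / (1 + u)] is the current one, so the loss from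
    disjointness is absorbed exactly. *)
Lemma cumul_lower (x : T -> F) :
  (forall i, (i <= m)%N -> c * i%:R <= cumul (fun p => (x p - 1)^-1) (t i)) ->
  forall K, (forall p, (K.+1)%:R < x p) -> forall j, (j <= m)%N ->
  c ^+ K * 'C(j, K)%:R <= cumul (fun p => K%:R / (x p - (K.+1)%:R)) (t j).
Proof.
move=> Hx; elim=> [|K IH] xK j jm.
  rewrite expr0 bin0 mulr1 /cumul (bigD1 set0) /=; last by rewrite len0 divr_ge0.
  by rewrite pr0 lerDl; apply: sumr_ge0 => S _; apply: pr_ge0 => p; rewrite mul0r.
have xK' p : (K.+1)%:R < x p by apply: le_lt_trans (xK p); rewrite ler_nat.
have {}IH := IH xK'.
pose u p := (x p - (K.+2)%:R)^-1; pose v p := K%:R * u p.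
have xp p : 0 < x p - (K.+2)%:R by rewrite subr_gt0.
have u0 p : 0 <= u p by rewrite invr_ge0 ltW.
have v0 p : 0 <= v p by rewrite mulr_ge0.
pose w p := v p / (1 + u p).
have wE p : w p = K%:R / (x p - (K.+1)%:R).
  rewrite /w /v /u -[K.+2%:R]natr1; have := xp p; rewrite -natr1.
  move: (K.+1%:R : F) (x p) => a b ab; field; apply/andP; split; lra.
have w0 p : 0 <= w p by rewrite wE divr_ge0 // subr_ge0 ltW.
rewrite (_ : cumul _ _ = \sum_(S : {set T}) pr (fun p => v p + u p) S * ind (t j) (len S)); last first.
  rewrite cumulE; apply: eq_bigr => S _; congr (_ * _); apply: eq_pr => p _.
  by rewrite /v /u -[K.+1%:R]natr1; ring.
apply: le_trans (sum_pr_add_lower u0 v0 (ind_ge0 (t j)) (@ind_mono (t j))).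
under eq_bigr => S _ do rewrite cumul_shift.
pose phi s := cumul w (t j - s).
have phi_mono r s : r <= s -> phi s <= phi r by move=> rs; rewrite cumul_mono // lerD2l lerN2.
have phi0 s : 0 <= phi s by rewrite cumul_ge0.
(* No mass is placed at the origin, because the available lower bound [c * i] is zero at [i = 0]. *)
have Hab := @abel_lower F {set T} (pr u) len t phi (fun i => if i is 0 then 0 else c)
  (fun S => pr_ge0 S u0) t_mono phi_mono j phi0 _.
apply: le_trans (Hab _); last first.
  move=> i ij; rewrite big_ord_recl /= add0r sumr_const card_ord -mulr_natr.
  apply: le_trans (Hx i (leq_trans ij jm)) _; apply: cumul_le => p.
  have x1 : 0 < x p - 1 by rewrite subr_gt0; apply: le_lt_trans (xK p); rewrite (ler_nat F 1).
  rewrite invr_ge0 ltW //= lef_pV2 ?posrE // lerD2l lerN2.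
  by rewrite (ler_nat F 1).
rewrite big_ord_recl /= mul0r add0r.
apply: (@le_trans _ _ (\sum_(i < j) c * (c ^+ K * 'C(j - i.+1, K)%:R))); last first.
  apply: ler_sum => i _; rewrite ler_wpM2l // /phi t_sub //.
  rewrite (_ : cumul w _ = cumul (fun p => K%:R / (x p - (K.+1)%:R)) (t (j - i.+1))).
    by apply: IH; rewrite (leq_trans (leq_subr _ _)).
  by apply: eq_bigr => S _; apply: eq_pr.
rewrite -mulr_sumr -mulr_sumr mulrA -exprS ler_wpM2l ?exprn_ge0 // -natr_sum ler_nat.
rewrite (reindex_inj rev_ord_inj) /=.
have -> : \sum_(i < j) 'C(j - (j - i.+1).+1, K) = \sum_(i < j) 'C(i, K).
  by apply: eq_bigr => i _; congr 'C(_, _); have := ltn_ord i; lia.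
elim: (j) => [|n IHn]; first by rewrite big_ord0.
by rewrite big_ord_recr /= binS leq_add2r.
Qed.

End Cumulative.
End LogMeasure.

(** * Main terms of the sieve for the three densities *)

Section DensityIdentities.
Variables (F : realFieldType) (a b : F).
Hypotheses (a0 : 0 < a).

(** In these identities [b] is the prime and [a] is [k], or [k - 1] in the two about primes; they
    evaluate the factors of [quad_form_diag] and [coef_bound] at a single prime. *)
Lemma weight_identity : a < b -> ((a / b)^-1 - 1) * (a / (b - a)) ^+ 2 = a / (b - a).
Proof. by move=> ab; have b0 := lt_trans a0 ab; field; rewrite !gt_eqF ?subr_gt0. Qed.

Lemma weight_at_identity : a < b -> a / (b - a) * (1 - 1 / (a / b)) = - 1.
Proof. by move=> ab; have b0 := lt_trans a0 ab; field; rewrite !gt_eqF ?subr_gt0. Qed.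

Lemma weight_inv_identity : a < b -> (a / b)^-1 * (a / (b - a)) = 1 + a / (b - a).
Proof. by move=> ab; have b0 := lt_trans a0 ab; field; rewrite !gt_eqF ?subr_gt0. Qed.

Lemma weight_prime_identity : a + 1 < b ->
  ((a / (b - 1))^-1 - 1) * (a / (b - 1) / ((a + 1) / b) * ((a + 1) / (b - (a + 1)))) ^+ 2 =
  a / (b - (a + 1)) * (b / (b - 1)) ^+ 2.
Proof. by move=> ab; have := a0; move=> a0'; field; rewrite !gt_eqF //; lra. Qed.

Lemma weight_prime_inner_identity : a + 1 < b ->
  (a + 1) / (b - (a + 1)) * (1 - a / (b - 1) / ((a + 1) / b)) = (b - 1)^-1.
Proof. by move=> ab; have := a0; move=> a0'; field; rewrite !gt_eqF //; lra. Qed.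

End DensityIdentities.

Section SieveMainTerms.
Variables (F : realFieldType) (T : finType) (x ell : T -> F) (K m : nat) (P : F -> F) (Lip : F).
Local Notation k := (K.+2).
Hypothesis ell_ge0 : forall p, 0 <= ell p.
Hypothesis x_gt : forall p, k%:R < x p.
Hypothesis m_gt0 : (0 < m)%N.
Hypothesis P_ge0 : forall s, 0 <= P s.
Hypothesis P_mono : forall r s, r <= s -> P s <= P r.
Hypothesis P_vanish : forall s, 1 <= s -> P s = 0.
Hypothesis P_lip : forall r s, r <= s -> P r - P s <= Lip * (s - r).

Let t (i : nat) : F := i%:R / m%:R.

(** Of the [x p] residues, [k] make some shift divisible. If one shift has to be prime, [k - 1] of
    the [x p - 1] admissible residues remain, which is [dens_prime]. In [dens_at] divisibility at
    [p0] is imposed, so the density there is [1]. *)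
Definition dens (p : T) : F := k%:R / x p.
Definition wgt (p : T) : F := k%:R / (x p - k%:R).
Definition coef : {set T} -> F := sieve_coef dens wgt (fun S => P (len ell S)).
Definition dens_prime (p : T) : F := (K.+1)%:R / (x p - 1).
Definition dens_at (p0 p : T) : F := if p == p0 then 1 else dens p.

Let xk p : 0 < x p - k%:R. Proof. by rewrite subr_gt0. Qed.
Let x1 p : 0 < x p - 1.
Proof. by rewrite subr_gt0; apply: le_lt_trans (x_gt p); rewrite (ler_nat F 1). Qed.
Let x0 p : 0 < x p. Proof. by apply: le_lt_trans (x_gt p); rewrite ler0n. Qed.
Let k0 : 0 < k%:R :> F. Proof. by rewrite ltr0n. Qed.
Let dens0 p : dens p != 0. Proof. by rewrite /dens gt_eqF // divr_gt0. Qed.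
Let wgt0 p : 0 <= wgt p. Proof. by rewrite /wgt divr_ge0 // ltW. Qed.
Let len0' S : 0 <= len ell S. Proof. exact: len_ge0. Qed.

Lemma cumul_wgt_upper (c : F) : 0 <= c ->
  (forall i, (i <= m)%N -> cumul ell (fun p => (x p - k%:R)^-1) (t i) <= c * (i.+1)%:R) ->
  forall j, (j <= m)%N -> cumul ell wgt (t j) <= c ^+ k * 'C(j + k.*2, k)%:R.
Proof.
move=> c0 Hc j jm.
exact: (@cumul_upper F T ell ell_ge0 m c m_gt0 c0 (fun p => (x p - k%:R)^-1)
  (fun p => ltW (eq_ind_r (fun b => is_true b) (xk p) (invr_gt0 _))) Hc k j jm).
Qed.

(** The density is the one that defines the weights, so every non-empty [B] has a zero factor and
    the inner sum is one value of [P]. *)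
Lemma quad_form_dens :
  quad_form dens wgt (fun S => P (len ell S)) dens =
  \sum_(A : {set T}) pr wgt A * P (len ell A) ^+ 2.
Proof.
rewrite quad_form_diag //; apply: eq_bigr => A _; congr (_ * _ ^+ 2).
  apply: eq_pr => p _; rewrite divff // mul1r.
  exact: weight_identity.
rewrite (bigD1 set0) /=; last by rewrite -setI_eq0 setI0.
rewrite pr0 mul1r setU0 big1 ?addr0 // => B /andP[_ /set0Pn[p pB]].
by rewrite /pr (bigD1 p) //= divff // subrr mulr0 !mul0r.
Qed.

(** Up to scaling, an upper sum for the integral over [[0, 1]] of [t ^ (k - 1) / (k - 1)!] times
    [P t ^ 2]. The coefficients are the successive increments of ['C(j + k.*2, k)], starting with
    its value at [j = 0]. *)
Definition upper_const : F :=
  \sum_(j < m.+1) (if (j : nat) is i.+1 then 'C(i + k.*2, K.+1) else 'C(k.*2, k))%:R * P (t j.-1) ^+ 2.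

Lemma quad_form_dens_upper (c : F) : 0 <= c ->
  (forall i, (i <= m)%N -> cumul ell (fun p => (x p - k%:R)^-1) (t i) <= c * (i.+1)%:R) ->
  quad_form dens wgt (fun S => P (len ell S)) dens <= c ^+ k * upper_const.
Proof.
move=> c0 Hc; rewrite quad_form_dens.
have t_mono i : t i <= t i.+1 by rewrite /t ler_wpM2r ?invr_ge0 ?ler0n // ler_nat.
have tm : t m = 1 by rewrite /t divff // pnatr_eq0 -lt0n.
rewrite (bigID (fun S => len ell S <= t m)) /= [X in _ + X]big1 ?addr0; last first.
  by move=> S; rewrite -ltNge tm => h; rewrite P_vanish ?expr0n ?mulr0 // ltW.
pose b (j : nat) := c ^+ k * (if j is i.+1 then 'C(i + k.*2, K.+1) else 'C(k.*2, k))%:R.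
have := @abel_upper F {set T} (pr wgt) (len ell) t (fun s => P s ^+ 2) b _ t_mono _ m _ _ _.
move=> H; apply: le_trans (H _ _ _ _ _) _.
- by move=> S; exact: pr_ge0.
- by move=> r s rs; rewrite ler_sqr ?nnegrE // P_mono.
- by move=> S; rewrite /t mul0r.
- by move=> s; exact: sqr_ge0.
- move=> i im; apply: le_trans (cumul_wgt_upper c0 Hc im) _.
  rewrite /b -mulr_sumr ler_wpM2l ?exprn_ge0 // -natr_sum ler_nat.
  elim: i {im} => [|i IH]; first by rewrite big_ord_recl big_ord0 addn0.
  by rewrite big_ord_recr /= addSn binS leq_add2r.
by rewrite /upper_const mulr_sumr; apply: ler_sum => j _; rewrite /b mulrA.
Qed.

(** At the primes of [B] the factor is now [1 / (p - 1)], so the inner sum is one-dimensional and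
    behaves like the integral of [P] beyond [len ell A]. *)
Lemma quad_form_prime :
  quad_form dens wgt (fun S => P (len ell S)) dens_prime =
  \sum_(A : {set T}) pr (fun p => (K.+1)%:R / (x p - k%:R) * (x p / (x p - 1)) ^+ 2) A *
    (\sum_(B : {set T} | [disjoint A & B])
       pr (fun p => (x p - 1)^-1) B * P (len ell A + len ell B)) ^+ 2.
Proof.
have kE : k%:R = (K.+1)%:R + 1 :> F by rewrite natr1.
have K0 : 0 < (K.+1)%:R :> F by rewrite ltr0n.
rewrite quad_form_diag //; last by move=> p; rewrite /dens_prime gt_eqF // divr_gt0.
apply: eq_bigr => A _; congr (_ * _ ^+ 2).
  apply: eq_pr => p _; rewrite /dens_prime /dens /wgt kE.
  by apply: weight_prime_identity => //; rewrite -kE.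
apply: eq_bigr => B AB; rewrite lenU //; congr (_ * _).
apply: eq_pr => p _; rewrite /dens_prime /dens /wgt kE.
by apply: weight_prime_inner_identity => //; rewrite -kE.
Qed.

(** Up to scaling, a lower sum for the integral over [[0, 1]] of [t ^ (k - 2) / (k - 2)!] times the
    square of the integral of [P] from [t] to [1]; terms with argument beyond [1] vanish with
    [P]. *)
Definition lower_const : F :=
  \sum_(j < m.+1) (if (j : nat) is i.+1 then 'C(i, K) else 0)%N%:R *
    (\sum_(i < m) P (t j + t i.+1)) ^+ 2.

Lemma quad_form_prime_lower (c : F) : 0 <= c ->
  (forall i, (i <= m)%N -> c * i%:R <= cumul ell (fun p => (x p - 1)^-1) (t i)) ->
  c ^+ k.+1 * lower_const <= quad_form dens wgt (fun S => P (len ell S)) dens_prime.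
Proof.
move=> c0 Hc; rewrite quad_form_prime.
have t_mono i : t i <= t i.+1 by rewrite /t ler_wpM2r ?invr_ge0 ?ler0n // ler_nat.
pose u p := (x p - 1)^-1; have u0 p : 0 <= u p by rewrite invr_ge0 ltW.
pose hs p := (K.+1)%:R / (x p - k%:R).
have hs0 p : 0 <= hs p by rewrite divr_ge0 // ltW.
pose psi s := c * \sum_(i < m) P (s + t i.+1).
have psi0 s : 0 <= psi s by rewrite mulr_ge0 // sumr_ge0.
have psim r s : r <= s -> psi s <= psi r.
  by move=> rs; rewrite ler_wpM2l //; apply: ler_sum => i _; rewrite P_mono // lerD2r.
have inner A : pr (fun p => (x p - 1) / x p) A * psi (len ell A) <=
    \sum_(B : {set T} | [disjoint A & B]) pr u B * P (len ell A + len ell B).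
  have Pm r s : r <= s -> P (len ell A + s) <= P (len ell A + r).
    by move=> rs; rewrite P_mono // lerD2l.
  apply: le_trans (@sum_disjoint_lower F T ell ell_ge0 u (fun s => P (len ell A + s)) A u0 Pm _); last by move=> s.
  rewrite (_ : pr _ A = pr (fun p => (1 + u p)^-1) A); last first.
    apply: eq_pr => p _; rewrite /u; have := x1 p; have := x0 p => a1 a2.
    by field; rewrite !gt_eqF //; lra.
  rewrite ler_wpM2l ?pr_ge0 // => [p|]; first by rewrite invr_ge0 addr_ge0.
  have := @abel_lower F {set T} (pr u) (len ell) t (fun s => P (len ell A + s))
     (fun i => if i is 0 then 0 else c) (fun S => pr_ge0 S u0) t_mono Pm m (fun s => P_ge0 _) _.
  move=> H; apply: le_trans (H _); last first.
    move=> i im; rewrite big_ord_recl /= add0r sumr_const card_ord -mulr_natr.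
    exact: Hc.
  by rewrite big_ord_recl /= mul0r add0r /psi mulr_sumr.
apply: (@le_trans _ _ (\sum_(A : {set T}) pr hs A * psi (len ell A) ^+ 2)); last first.
  apply: ler_sum => A _.
  (* Keeping [B] disjoint from [A] costs [(x p - 1) / x p] at each prime of [A]; its square cancels
     the excess factor of the diagonal weight. *)
  have -> : pr (fun p => (K.+1)%:R / (x p - k%:R) * (x p / (x p - 1)) ^+ 2) A =
      pr hs A * pr (fun p => x p / (x p - 1)) A ^+ 2 by rewrite -pr_exp -prM.
  rewrite -mulrA ler_wpM2l ?pr_ge0 //.
  have pxA : 0 < pr (fun p => x p / (x p - 1)) A by apply: prodr_gt0 => p _; rewrite divr_gt0.
  rewrite -exprMn ler_sqr ?nnegrE //; last first.
    rewrite mulr_ge0 ?(ltW pxA) // sumr_ge0 // => B _; rewrite mulr_ge0 ?pr_ge0 //.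
  apply: le_trans (ler_wpM2l (ltW pxA) (inner A)); rewrite mulrA -prM.
  rewrite (@eq_pr _ _ _ (fun=> 1)) ?pr_const ?expr1n ?mul1r // => p _.
  by have := x1 p; have := x0 p => a1 a2; field; rewrite !gt_eqF.
have HK := @cumul_lower F T ell ell_ge0 m c m_gt0 c0 x Hc K.+1 x_gt.
pose b (j : nat) := c ^+ K.+1 * (if j is i.+1 then 'C(i, K) else 0)%N%:R.
have := @abel_lower F {set T} (pr hs) (len ell) t (fun s => psi s ^+ 2) b
  (fun S => pr_ge0 S hs0) t_mono _ m _ _.
move=> H; apply: le_trans (H _ _ _).
- rewrite /lower_const mulr_sumr; apply: ler_sum => j _; rewrite /b /psi exprMn.
  by apply: le_of_eq; rewrite 2!exprS; ring.
- by move=> r s rs; rewrite ler_sqr ?nnegrE // psim.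
- by move=> s; exact: sqr_ge0.
move=> i im; apply: le_trans (HK i im); rewrite /b -mulr_sumr ler_wpM2l ?exprn_ge0 //.
rewrite -natr_sum ler_nat.
elim: i {im} => [|i IH]; first by rewrite big_ord_recl big_ord0.
by rewrite big_ord_recr /= binS leq_add2r.
Qed.

(** At [p0] the density is [1], so [(g p)^-1 - 1] removes every [A] containing [p0]. At other primes
    it is [dens], so only [B = set0] and [B = [set p0]] survive, with opposite signs, and the square
    of a difference of [P] at distance [ell p0] remains. *)
Lemma quad_form_at p0 :
  quad_form dens wgt (fun S => P (len ell S)) (dens_at p0) <=
  (Lip * ell p0) ^+ 2 * cumul ell wgt 1.
Proof.
rewrite quad_form_diag //; last first.
  by move=> p; rewrite /dens_at; case: (p == p0); rewrite ?oner_neq0 ?dens0.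
rewrite /cumul mulr_sumr [leRHS]big_mkcond; apply: ler_sum => A _.
have [p0A|p0A] := boolP (p0 \in A).
  rewrite /pr (bigD1 p0) //= {1}/dens_at eqxx invr1 subrr !mul0r.
  by case: ifP => // _; rewrite mulr_ge0 ?sqr_ge0 // pr_ge0.
rewrite (@eq_pr _ _ _ wgt); last first.
  move=> p pA; rewrite /dens_at; case: eqP pA p0A => [->->//|_ _ _].
  by rewrite divff // mul1r; exact: weight_identity.
have dA1 : [disjoint A & [set p0]] by rewrite disjoint_sym disjoints1.
rewrite (bigD1 set0) /=; last by rewrite -setI_eq0 setI0.
rewrite (bigD1 [set p0]) /=; last first.
  by rewrite dA1; apply/set0Pn; exists p0; rewrite inE.
rewrite [X in _ + (_ + X)]big1 ?addr0; last first.
  move=> B /andP[/andP[AB B0] Bp].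
  have [p pB pp] : exists2 p, p \in B & p != p0.
    apply/exists_inP; apply: contraR Bp; rewrite negb_exists_in => /forall_inP H.
    rewrite eqEsubset; apply/andP; split.
      by apply/subsetP => p /H; rewrite negbK inE.
    case/set0Pn: B0 => p pB; rewrite sub1set.
    by have := H _ pB; rewrite negbK => /eqP <-.
  rewrite /pr (bigD1 p) //= /dens_at (negbTE pp) divff // subrr mulr0 !mul0r.
  by [].
have lp : len ell [set p0] = ell p0 by rewrite /len big_set1.
rewrite pr0 mul1r setU0 pr_set1 /dens_at eqxx lenU // lp.
rewrite (_ : wgt p0 * _ = -1); last first.
  exact: weight_at_identity.
case: ifP => [_|/negbT]; last first.
  rewrite -ltNge => h.
  rewrite (P_vanish (ltW h)) (@P_vanish (len ell A + ell p0)); last first.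
    by rewrite (le_trans (ltW h)) // lerDl.
  by rewrite mulr0 addr0 expr0n mulr0.
rewrite mulrC ler_wpM2r ?pr_ge0 // mulN1r.
have h1 : 0 <= P (len ell A) - P (len ell A + ell p0) by rewrite subr_ge0 P_mono // lerDl.
have h2 : P (len ell A) - P (len ell A + ell p0) <= Lip * ell p0.
  by apply: le_trans (P_lip _) _; rewrite ?lerDl // addrC addKr.
by rewrite ler_sqr ?nnegrE // (le_trans h1).
Qed.

Lemma coef_supp D : 1 < len ell D -> coef D = 0.
Proof.
move=> h; rewrite /coef /sieve_coef big1 ?mulr0 // => S DS.
by rewrite P_vanish ?mulr0 // (le_trans (ltW h)) // len_sub.
Qed.

(** Since [wgt / dens = 1 + wgt], dividing by [pr dens D] supplies the missing subsets of [D], and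
    the sum over supersets of [D] is at most one over all sets of length at most [1]. *)
Lemma coef_bound D : `|coef D| <= P 0 * cumul ell wgt 1.
Proof.
rewrite /coef /sieve_coef sum_supersets normrM normrM normrX normrN1 expr1n mul1r.
have -> : `|(pr dens D)^-1| = pr (fun p => (dens p)^-1) D.
  rewrite prV ger0_norm // invr_ge0 pr_ge0 // => p.
  by rewrite /dens divr_ge0 // ltW.
rewrite ger0_norm; last by apply: sumr_ge0 => B _; rewrite mulr_ge0 ?pr_ge0.
rewrite /cumul.
pose E S := pr wgt S * (P 0 * (len ell S <= 1)%R%:R).
have -> : P 0 * \sum_(S | len ell S <= 1) pr wgt S = \sum_(S : {set T}) E S.
  rewrite mulr_sumr big_mkcond; apply: eq_bigr => S _; rewrite /E.
  by case: ifP => _; rewrite ?mulr1 ?mulr0 // mulrC.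
rewrite (sum_split D) mulr_sumr exchange_big /=; apply: ler_sum => B DB.
apply: (@le_trans _ _ (\sum_(C : {set T} | C \subset D) pr wgt C * (pr wgt B * (P 0 * (len ell (D :|: B) <= 1)%R%:R)))); last first.
  apply: ler_sum => C CD; have CB : [disjoint C & B] by exact: disjointWl CD DB.
  rewrite /E prU // -mulrA !ler_wpM2l ?pr_ge0 //.
  have h : len ell (C :|: B) <= len ell (D :|: B) by rewrite len_sub // setSU.
  by case: (leP (len ell (D :|: B)) 1) => h'; rewrite ?ler0n // (le_trans h h').
rewrite -mulr_suml sum_subsets_pr1 prU // -!mulrA [leLHS]mulrA -[X in X * _ <= _]prM.
rewrite (@eq_pr _ _ _ (fun p => 1 + wgt p)) => [|p _]; last first.
  exact: weight_inv_identity.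
rewrite !ler_wpM2l ?pr_ge0 // => [p|]; first by rewrite addr_ge0.
case: (leP (len ell _) 1) => h; first by rewrite mulr1 P_mono.
by rewrite mulr0 P_vanish // ltW.
Qed.

End SieveMainTerms.

Notation weight_def := wgt (only parsing).
Notation density_def := dens (only parsing).

(** * Logarithms, and harmonic sums over integers prime to [W] *)

Import Order.TTheory GRing.Theory Num.Theory.

Bind Scope ring_scope with R.
Arguments ln x%_ring_scope.
Arguments exp x%_ring_scope.
Arguments Rpower (x y)%_ring_scope.

Lemma lnM (x y : R) : 0 < x -> 0 < y -> ln (x * y) = ln x + ln y.
Proof. by move=> /RltP x0 /RltP y0; exact: ln_mult. Qed.

Lemma ltr_ln (x y : R) : 0 < x -> x < y -> ln x < ln y.
Proof. by move=> /RltP x0 /RltP xy; apply/RltP; exact: ln_increasing. Qed.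

Lemma ler_ln (x y : R) : 0 < x -> x <= y -> ln x <= ln y.
Proof. by move=> x0; rewrite le_eqVlt => /predU1P[->//|xy]; rewrite ltW // ltr_ln. Qed.

Lemma ler_ln_inv (x y : R) : 0 < x -> 0 < y -> ln x <= ln y -> x <= y.
Proof. by move=> x0 y0; rewrite !leNgt; apply: contra; apply: ltr_ln. Qed.

Lemma ln1 : ln (1 : R) = 0. Proof. exact: ln_1. Qed.

Lemma lnV (x : R) : 0 < x -> ln x^-1 = - ln x.
Proof. by move=> /RltP x0; exact: ln_Rinv. Qed.

Lemma ln_ge0 (x : R) : 1 <= x -> 0 <= ln x.
Proof. by move=> x1; rewrite -ln1 ler_ln. Qed.

Lemma ln_gt0 (x : R) : 1 < x -> 0 < ln x.
Proof. by move=> x1; rewrite -ln1 ltr_ln. Qed.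

Lemma ln_sub1 (x : R) : 0 < x -> ln x <= x - 1.
Proof.
move=> /RltP x0; have h := exp_ineq1_le (ln x); rewrite exp_ln // in h.
by move/RleP: h; rewrite RplusE R1E; lra.
Qed.

Definition harm (n : nat) : R := \sum_(1 <= i < n.+1) (i%:R)^-1.

Lemma harmS n : harm n.+1 = harm n + (n.+1%:R)^-1.
Proof. by rewrite /harm big_nat_recr. Qed.

Lemma harm_lower n : ln n.+1%:R <= harm n.
Proof.
elim: n => [|n IH]; first by rewrite /harm big_nil ln1.
rewrite harmS; have n0 : 0 < n.+1%:R :> R by rewrite ltr0n.
have -> : n.+2%:R = n.+1%:R * (1 + n.+1%:R^-1) :> R.
  by rewrite mulrDr mulr1 divff ?natr1 // gt_eqF.
have i0 : 0 < n.+1%:R^-1 :> R by rewrite invr_gt0.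
rewrite lnM //; last by rewrite addr_gt0.
by rewrite lerD //; apply: le_trans (ln_sub1 _) _; [rewrite addr_gt0|rewrite addrC addKr].
Qed.

Lemma harm_upper n : (0 < n)%N -> harm n <= 1 + ln n%:R.
Proof.
elim: n => // -[|n] IH _; first by rewrite harmS /harm big_nil ln1 invr1 add0r addr0.
rewrite harmS; apply: le_trans (lerD (IH isT) (lexx _)) _.
have n0 : 0 < n.+1%:R :> R by rewrite ltr0n.
have m0 : 0 < n.+2%:R :> R by rewrite ltr0n.
rewrite -addrA lerD2l -lerBrDl.
have -> : ln n.+2%:R - ln n.+1%:R = - ln (n.+1%:R / n.+2%:R).
  by rewrite lnM ?invr_gt0 // lnV // opprD opprK addrC.
rewrite lerNr; apply: le_trans (ln_sub1 _) _; first by rewrite divr_gt0.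
have e : n.+1%:R / n.+2%:R = 1 - n.+2%:R^-1 :> R.
  have -> : n.+1%:R = n.+2%:R - 1 :> R by rewrite -[n.+2%:R]natr1 addrK.
  by rewrite mulrBl divff ?gt_eqF // mul1r.
by rewrite e addrAC subrr add0r.
Qed.

Lemma ler_sum_inj (F : realFieldType) (I J : finType) (P : pred I) (Q : pred J) (f : I -> J) (g : J -> F) :
  {in P &, injective f} -> (forall i, P i -> Q (f i)) -> (forall j, 0 <= g j) ->
  \sum_(i | P i) g (f i) <= \sum_(j | Q j) g j.
Proof.
move=> finj fPQ g0; rewrite -(big_imset _ finj) /=.
rewrite [leRHS](bigID (mem (f @: P))) /= -[leLHS]addr0 lerD ?sumr_ge0 //.
rewrite [leRHS](eq_bigl (mem (f @: P))) // => j /=.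
by apply/andP/idP => [[]//|jf]; split=> //; case/imsetP: jf => i Pi ->; exact: fPQ.
Qed.

Definition coprime_harm (W X : nat) : R :=
  \sum_(n < X.+1 | (0 < n)%N && coprime n W) (n%:R)^-1.

Lemma coprime_harm_mono W X Y : (X <= Y)%N -> coprime_harm W X <= coprime_harm W Y.
Proof.
move=> XY; rewrite /coprime_harm.
rewrite -(big_mkord (fun n => (0 < n)%N && coprime n W) (fun n => (n%:R)^-1)).
rewrite -(big_mkord (fun n => (0 < n)%N && coprime n W) (fun n => (n%:R)^-1)).
rewrite [leRHS](@big_cat_nat _ _ _ X.+1) //= lerDl; apply: sumr_ge0 => i _.
by rewrite invr_ge0.
Qed.

(** Each block of [W] consecutive integers has [totient W] members prime to [W]; comparing them with
    the end of their block, or of the preceding one, gives the two bounds by [totient W / W] times a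
    harmonic sum. *)
Lemma coprime_harm_block W Q : coprime_harm W (W * Q) =
  \sum_(q < Q) \sum_(1 <= a < W.+1 | coprime a W) ((W * q + a)%:R)^-1.
Proof.
rewrite /coprime_harm -(big_mkord (fun n => (0 < n)%N && coprime n W) (fun n => (n%:R)^-1)).
elim: Q => [|Q IH]; first by rewrite muln0 big_ord0 unlock.
rewrite big_ord_recr /= -IH (@big_cat_nat _ _ _ (W * Q).+1) //=; last first.
  by rewrite mulnS; lia.
congr (_ + _).
rewrite (_ : (W * Q.+1).+1 = W.+1 + W * Q)%N; last by rewrite mulnS; lia.
rewrite (_ : (W * Q).+1 = 1 + W * Q)%N; last by lia.
rewrite big_addn addnK big_nat_cond [RHS]big_nat_cond.
apply: eq_big => [a|a _]; last by rewrite addnC.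
case: (boolP (1 <= a < W.+1)%N) => //= /andP[a1 _].
by rewrite addn_gt0 a1 /= -coprime_modl addnC mulnC modnMDl coprime_modl.
Qed.

Lemma count_coprime W : \sum_(1 <= a < W.+1 | coprime a W) (1 : R) = (totient W)%:R.
Proof.
rewrite totient_count_coprime natr_sum.
case: W => [|W]; first by rewrite !big_geq.
rewrite big_mkcond /= big_nat_recr //= [RHS]big_nat_recl //= addrC; congr (_ + _).
  by rewrite /coprime gcdnn gcdn0; case: eqP.
rewrite big_add1 /=; apply: eq_bigr => a _.
by rewrite coprime_sym; case: ifP.
Qed.

Lemma coprime_harm_lower W Q : (0 < W)%N ->
  (totient W)%:R / W%:R * ln Q.+1%:R <= coprime_harm W (W * Q).
Proof.
move=> W0; have W0' : 0 < W%:R :> R by rewrite ltr0n.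
apply: (@le_trans _ _ ((totient W)%:R / W%:R * harm Q)).
  by rewrite ler_wpM2l ?harm_lower // divr_ge0.
rewrite coprime_harm_block /harm big_add1 big_mkord mulr_sumr.
apply: ler_sum => q _; rewrite -count_coprime -mulrA mulr_suml big_nat_cond [leRHS]big_nat_cond.
apply: ler_sum => a /andP[/andP[a1 aW] _]; rewrite mul1r -invfM -natrM lef_pV2 ?posrE ?ltr0n ?muln_gt0 ?W0 ?addn_gt0 ?a1 ?orbT //.
by rewrite ler_nat mulnS [X in (X <= _)%N]addnC leq_add2r.
Qed.

Lemma coprime_harm_upper W Q : (0 < W)%N ->
  coprime_harm W (W * Q.+1) <= W%:R + (totient W)%:R / W%:R * harm Q.
Proof.
move=> W0; have W0' : 0 < W%:R :> R by rewrite ltr0n.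
rewrite coprime_harm_block big_ord_recl; apply: lerD.
  rewrite big_mkcond /=.
  apply: (@le_trans _ _ (\sum_(1 <= a < W.+1) 1)); last by rewrite sumr_const_nat subSS subn0.
  rewrite big_nat [leRHS]big_nat; apply: ler_sum => a /andP[a1 _].
  by case: ifP => _ //; rewrite muln0 add0n invf_le1 ?ltr0n // ler1n.
rewrite /harm big_add1 big_mkord mulr_sumr.
apply: ler_sum => q _; rewrite -count_coprime -mulrA mulr_suml big_nat_cond [leRHS]big_nat_cond.
apply: ler_sum => a /andP[/andP[a1 aW] _]; rewrite mul1r -invfM -natrM lef_pV2 ?posrE ?ltr0n ?muln_gt0 ?W0 ?addn_gt0 ?a1 ?orbT //.
by rewrite ler_nat /bump /= leq_addr.
Qed.

(** * Sets of primes in [(D0, N]] as squarefree integers prime to [W] *)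

Import Order.TTheory GRing.Theory Num.Theory.

Lemma geometric_tail (p X : nat) : (1 < p)%N ->
  \sum_(1 <= a < X.+1) ((p ^ a)%:R)^-1 <= (p%:R - 1)^-1 :> R.
Proof.
move=> p1; have p1' : 0 < p%:R - 1 :> R by rewrite subr_gt0 (ltr_nat R 1).
have p0 : 0 < p%:R :> R by rewrite ltr0n ltnW.
have -> : \sum_(1 <= a < X.+1) ((p ^ a)%:R)^-1 = (1 - ((p ^ X)%:R)^-1) * (p%:R - 1)^-1 :> R.
  elim: X => [|X IH]; first by rewrite big_geq // expn0 invr1 subrr mul0r.
  rewrite big_nat_recr //= IH expnS natrM invfM.
  have : 0 < (p ^ X)%:R :> R by rewrite ltr0n expn_gt0 ltnW.
  move: ((p ^ X)%:R : R) (p%:R : R) p1' p0 => a b b1 b0 a0; field.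
  by rewrite !gt_eqF.
by rewrite ler_piMl ?invr_ge0 ?(ltW p1') // lerBlDr lerDl invr_ge0.
Qed.

Section PrimeSets.
Variables (D0 N : nat).

Definition primeT : finType := {p : 'I_N.+1 | prime p && (D0 < p)%N}.
Definition pv (p : primeT) : nat := val (val p).
Definition dv (S : {set primeT}) : nat := (\prod_(p in S) pv p)%N.
Definition ker (n : nat) : {set primeT} := [set p | pv p %| n]%N.

Lemma pv_prime p : prime (pv p). Proof. by have /andP[] := valP p. Qed.
Lemma pv_gt p : (D0 < pv p)%N. Proof. by have /andP[] := valP p. Qed.
Lemma pv_le p : (pv p <= N)%N. Proof. by rewrite -ltnS ltn_ord. Qed.
Lemma pv_gt0 p : (0 < pv p)%N. Proof. exact: prime_gt0 (pv_prime p). Qed.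
Lemma pv_inj : injective pv. Proof. by move=> p q /val_inj/val_inj. Qed.

Lemma pv_surj q : prime q -> (D0 < q <= N)%N -> exists p, pv p = q.
Proof.
move=> q_pr /andP[Dq qN]; have Hq : prime (Ordinal (qN : (q < N.+1)%N)) && (D0 < Ordinal (qN : (q < N.+1)%N))%N by rewrite /= q_pr.
by exists (exist (fun p : 'I_N.+1 => prime p && (D0 < p)%N) _ Hq).
Qed.

Lemma dv_gt0 S : (0 < dv S)%N. Proof. by apply: prodn_gt0 => p; exact: pv_gt0. Qed.

Lemma prime_dvd_prod (q : nat) (s : seq primeT) : prime q ->
  (q %| \prod_(p <- s) pv p)%N -> q \in map pv s.
Proof.
move=> q_pr; elim: s => [|p s IH]; first by rewrite big_nil dvdn1 => /eqP q1; rewrite q1 in q_pr.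
rewrite big_cons Euclid_dvdM // inE => /orP[|/IH ->]; last by rewrite orbT.
by rewrite dvdn_prime2 ?pv_prime // => ->.
Qed.

Lemma prime_dvd_dv (q : nat) S : prime q -> (q %| dv S)%N -> exists2 p, p \in S & pv p = q.
Proof.
move=> q_pr; rewrite /dv -big_enum => /(prime_dvd_prod q_pr)/mapP[p].
by rewrite mem_enum => pS ->; exists p.
Qed.

Lemma pv_dvd_dv p S : (pv p %| dv S)%N = (p \in S).
Proof.
apply/idP/idP => [|pS]; last by rewrite /dv (bigD1 p) //= dvdn_mulr.
by move/(prime_dvd_dv (pv_prime p)) => [q qS /pv_inj <-].
Qed.

Lemma dv_inj : injective dv.
Proof. by move=> A B AB; apply/setP => p; rewrite -!pv_dvd_dv AB. Qed.

Lemma dv_dvd n S : (dv S %| n)%N = (S \subset ker n).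
Proof.
apply/idP/subsetP => [Sn p pS|Sn].
  by rewrite inE (dvdn_trans _ Sn) // pv_dvd_dv.
rewrite /dv -big_enum /=.
have : all (fun p => pv p %| n)%N (enum S).
  by apply/allP => p; rewrite mem_enum => /Sn; rewrite inE.
elim: (enum S) (enum_uniq (mem S)) => [|p s IH] /=; first by rewrite big_nil dvd1n.
case/andP=> ps us /andP[pn sn]; rewrite big_cons Gauss_dvd ?pn ?IH //.
rewrite prime_coprime ?pv_prime //; apply/negP => /(prime_dvd_prod (pv_prime p)).
by rewrite (mem_map pv_inj) (negbTE ps).
Qed.

Lemma dvU (A B : {set primeT}) : [disjoint A & B] -> dv (A :|: B) = (dv A * dv B)%N.
Proof. by move=> AB; rewrite /dv -bigU //=; apply: eq_bigl => x; rewrite !inE. Qed.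

Variable W : nat.
Hypothesis W_gt0 : (0 < W)%N.
Hypothesis W_dvd : forall q, prime q -> (q <= D0)%N -> (q %| W)%N.

Let A X S (n : 'I_X.+1) := [&& (0 < n)%N, coprime n W & ker n == S].

(** A prime of [S] may occur in [n] to any positive power, and [1 / (p - 1)] sums the reciprocals of
    these powers. The induction strips one prime with its full power; for empty [S] only [n = 1] is
    left, because every prime factor of [n] lies in [(D0, N]]. *)
Lemma kernel_sum_bound X S : (X <= N)%N ->
  \sum_(n < X.+1 | A S n) (n%:R)^-1 <= pr (fun p => ((pv p)%:R - 1)^-1 : R) S.
Proof.
move=> XN; have [c] := ubnP #|S|; elim: c S => // c IH S cS.
have pv1 p : 0 < (pv p)%:R - 1 :> R by rewrite subr_gt0 (ltr_nat R 1) prime_gt1 // pv_prime.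
case: (set_0Vmem S) => [->|[p pS]].
  rewrite pr0.
  apply: (@le_trans _ _ (\sum_(n < X.+1 | n == 1%N :> nat) (n%:R)^-1)).
    rewrite big_mkcond [leRHS]big_mkcond; apply: ler_sum => n _.
    case: ifP => [/and3P[n0 nW /eqP kn]|_]; last by case: ifP => // _; rewrite invr_ge0.
    suff -> : n = 1%N :> nat by [].
    apply/eqP; rewrite eqn_leq n0 andbT leqNgt; apply/negP => n1.
    have q_pr := pdiv_prime n1; have qn := pdiv_dvd n.
    have qD : (D0 < pdiv n)%N.
      rewrite ltnNge; apply/negP => /(W_dvd q_pr) qW.
      have : (pdiv n %| gcdn n W)%N by rewrite dvdn_gcd qn.
      by rewrite (eqP nW) dvdn1 => /eqP q1; rewrite q1 in q_pr.
    have qN : (pdiv n <= N)%N.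
      by rewrite (leq_trans (dvdn_leq n0 qn)) // (leq_trans _ XN) // -ltnS.
    have [p pq] : exists p, pv p = pdiv n by apply: pv_surj; rewrite ?qD.
    have : p \in ker n by rewrite inE pq.
    by rewrite kn inE.
  case: (X) => [|Y]; first by rewrite big_pred0 // => n; rewrite ord1.
  by rewrite (big_pred1 (inord 1)) ?inordK ?invr1 // => n; rewrite /= -val_eqE /= inordK.
set q := pv p; have q_pr : prime q := pv_prime p.
pose lg (n : 'I_X.+1) : 'I_X.+1 := inord (logn q n).
pose S' := S :\ p.
have lgE (n : 'I_X.+1) : (0 < n)%N -> lg n = logn q n :> nat.
  move=> n0; rewrite /lg inordK // ltnS (leq_trans (ltnW (ltn_logl q n0))) //.
  by rewrite -ltnS.
have lg1 n : A S n -> (0 < lg n)%N.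
  move=> /and3P[n0 _ /eqP kn]; rewrite lgE // logn_gt0 mem_primes q_pr n0 /=.
  have : p \in ker n by rewrite kn.
  by rewrite inE.
rewrite (partition_big lg (fun a => 0 < a)%N) //=.
have -> : pr (fun p => ((pv p)%:R - 1)^-1) S = (q%:R - 1)^-1 * pr (fun p => ((pv p)%:R - 1)^-1) S' :> R.
  by rewrite /pr (big_setD1 p).
have pr0' : 0 <= pr (fun p => ((pv p)%:R - 1)^-1) S' :> R.
  by apply: pr_ge0 => r; rewrite invr_ge0 ltW.
apply: (@le_trans _ _ (\sum_(a < X.+1 | (0 < a)%N) ((q ^ a)%:R)^-1 * pr (fun p => ((pv p)%:R - 1)^-1) S')); last first.
  rewrite -mulr_suml ler_wpM2r //; apply: le_trans (geometric_tail X (prime_gt1 q_pr)).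
  rewrite -(big_mkord (fun a => (0 < a)%N) (fun a => ((q ^ a)%:R)^-1)).
  by rewrite big_ltn_cond //= big_nat_cond [leRHS]big_nat_cond; rewrite le_eqVlt; apply/orP; left; apply/eqP; apply: eq_bigl => a; case: a.
apply: ler_sum => a a0.
pose f (n : 'I_X.+1) : 'I_X.+1 := inord (n %/ q ^ a).
have fE n : A S n -> lg n = a -> f n = (n %/ q ^ a)%N :> nat /\ n = (f n * q ^ a)%N :> nat.
  move=> An la; have n0 : (0 < n)%N by case/and3P: An.
  have fn : f n = (n %/ q ^ a)%N :> nat.
    by rewrite /f inordK // ltnS (leq_trans (leq_div _ _)) // -ltnS.
  split=> //; rewrite fn divnK // -la lgE //; exact: pfactor_dvdnn.
have qa0 : 0 < (q ^ a)%:R :> R by rewrite ltr0n expn_gt0 prime_gt0.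
rewrite (eq_bigr (fun n => ((q ^ a)%:R)^-1 * ((f n)%:R)^-1)); last first.
  by move=> n /andP[An /eqP la]; rewrite {1}(fE n An la).2 natrM invfM mulrC.
rewrite -mulr_sumr ler_wpM2l ?invr_ge0 ?(ltW qa0) //.
apply: le_trans (IH S' _); last first.
  by move: cS; rewrite (cardsD1 p S) pS add1n ltnS.
apply: (@ler_sum_inj R _ _ _ _ f (fun n => (n%:R)^-1)).
- move=> n1 n2 /andP[A1 /eqP l1] /andP[A2 /eqP l2] f12; apply: val_inj => /=.
  by rewrite (fE n1 A1 l1).2 (fE n2 A2 l2).2 f12.
- move=> n /andP[An /eqP la]; have [n0 nW /eqP kn] := and3P An.
  have [fn nE] := fE n An la; apply/and3P; split.
  + by move: n0; rewrite nE muln_gt0 => /andP[].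
  + by move: nW; rewrite nE coprimeMl => /andP[].
  have fp : ~~ (q %| f n)%N.
    apply/negP => qf; have : (q ^ a.+1 %| n)%N by rewrite nE expnS dvdn_mul.
    by rewrite pfactor_dvdn // -lgE // la ltnn.
  apply/eqP/setP => r; rewrite !inE -kn inE; case: eqP => [->|/eqP rp] /=.
    by apply/negbTE.
  rewrite [in RHS]nE Euclid_dvdM ?pv_prime // Euclid_dvdX ?pv_prime //.
  rewrite (dvdn_prime2 (pv_prime r) q_pr) /q (inj_eq pv_inj) (negbTE rp).
  by rewrite orbF.
by move=> n; rewrite invr_ge0.
Qed.

Lemma kernel_sum_lower X : (X <= N)%N ->
  coprime_harm W X <= \sum_(S : {set primeT} | (dv S <= X)%N) pr (fun p => ((pv p)%:R - 1)^-1) S.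
Proof.
move=> XN; rewrite /coprime_harm.
rewrite (partition_big (fun n : 'I_X.+1 => ker n) (fun S => dv S <= X)%N) /=; last first.
  move=> n /andP[n0 _]; apply: leq_trans (_ : n <= X)%N; last by rewrite -ltnS.
  by rewrite dvdn_leq // dv_dvd.
apply: ler_sum => S _; apply: le_trans (kernel_sum_bound _ XN).
by rewrite le_eqVlt; apply/orP; left; apply/eqP; apply: eq_bigl => n; rewrite /A andbA.
Qed.

Hypothesis W_small : forall q, prime q -> (q %| W)%N -> (q <= D0)%N.

Lemma dv_coprime S : coprime (dv S) W.
Proof.
rewrite coprime_has_primes ?dv_gt0 //; apply/negP => /hasP[q].
rewrite !mem_primes => /and3P[q_pr _ qW] /and3P[_ _].
case/(prime_dvd_dv q_pr) => p _ pq.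
by have := pv_gt p; rewrite pq ltnNge (W_small q_pr).
Qed.

Lemma kernel_sum_upper X :
  \sum_(S : {set primeT} | (dv S <= X)%N) pr (fun p => ((pv p)%:R)^-1) S <= coprime_harm W X.
Proof.
have E S : pr (fun p => ((pv p)%:R)^-1) S = ((dv S)%:R)^-1 :> R.
  by rewrite prV /pr /dv natr_prod.
rewrite /coprime_harm (eq_bigr (fun S => (((inord (dv S) : 'I_X.+1) : nat)%:R)^-1)); last first.
  by move=> S SX; rewrite E inordK.
apply: (@ler_sum_inj R _ _ _ _ (fun S => (inord (dv S) : 'I_X.+1)) (fun n => (n%:R)^-1)).
- move=> A1 A2 H1 H2 /(congr1 val) /=; rewrite !inordK ?ltnS //; exact: dv_inj.
- by move=> S SX; rewrite inordK ?ltnS // dv_gt0 dv_coprime.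
by move=> n; rewrite invr_ge0.
Qed.

End PrimeSets.

(** * One-dimensional sums over primes on the logarithmic scale *)

Import Order.TTheory GRing.Theory Num.Theory.

Lemma exp_gt0 (x : R) : 0 < exp x. Proof. by apply/RltP; exact: exp_pos. Qed.

Lemma lnK (x : R) : 0 < x -> exp (ln x) = x. Proof. by move/RltP; exact: exp_ln. Qed.

Lemma expK (x : R) : ln (exp x) = x. Proof. exact: ln_exp. Qed.

Lemma ler_exp (x y : R) : x <= y -> exp x <= exp y.
Proof. by move=> xy; apply: ler_ln_inv; rewrite ?exp_gt0 ?expK. Qed.

Lemma prod_1D_le (F : realFieldType) (I : finType) (e : I -> F) (s : F) :
  (forall i, 0 <= e i) -> \sum_i e i <= s -> s < 1 -> \prod_i (1 + e i) <= (1 - s)^-1.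
Proof.
move=> e0 es s1.
have H (r : seq I) : \sum_(i <- r) e i <= s -> \prod_(i <- r) (1 + e i) * (1 - \sum_(i <- r) e i) <= 1
   /\ 0 <= \prod_(i <- r) (1 + e i).
  elim: r => [|i r IH]; first by rewrite !big_nil subr0 mulr1.
  rewrite !big_cons => h; have {}h' : \sum_(j <- r) e j <= s by apply: le_trans h; rewrite lerDr.
  have [IH1 IH2] := IH h'; split; last by rewrite mulr_ge0 // addr_ge0.
  have r0 : 0 <= \sum_(j <- r) e j by apply: sumr_ge0.
  apply: le_trans IH1; have := e0 i; move: IH2 r0.
  move: (\prod_(j <- r) _) (\sum_(j <- r) _) (e i) => a b c a0 b0 c0.
  have -> : (1 + c) * a * (1 - (c + b)) = a * (1 - b) - a * (c * c + c * b) by ring.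
  by rewrite gerBl mulr_ge0 // addr_ge0 // mulr_ge0.
have [H1 H2] := H _ es.
rewrite -[leRHS]mul1r ler_pdivlMr ?subr_gt0 //; apply: le_trans H1.
by rewrite ler_wpM2l // lerD2l lerN2.
Qed.

Lemma sum_inv_consecutive (D n : nat) : (0 < D)%N ->
  \sum_(D <= i < n) ((i.+1)%:R * i%:R)^-1 <= (D%:R)^-1 :> R.
Proof.
move=> D0; have [Dn|nD] := leqP D n; last by rewrite big_geq ?invr_ge0 // ltnW.
have -> : \sum_(D <= i < n) ((i.+1)%:R * i%:R)^-1 = (D%:R)^-1 - (n%:R)^-1 :> R.
  elim: n Dn => [|n IH]; first by rewrite leqn0 => /eqP ->; rewrite big_geq // subrr.
  rewrite leq_eqVlt => /predU1P[<-|Dn]; first by rewrite big_geq // subrr.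
  rewrite big_nat_recr //= IH //.
  have : 0 < n%:R :> R by rewrite ltr0n (leq_trans D0).
  have : 0 < D%:R :> R by rewrite ltr0n.
  rewrite -natr1; move: (D%:R : R) (n%:R : R) => a b a0 b0; field.
  by rewrite !gt_eqF //; lra.
by rewrite gerBl invr_ge0.
Qed.

Section LogScale.
Variables (D0 N W : nat) (L : R).
Hypothesis L_gt0 : 0 < L.
Hypothesis LN : exp L <= N%:R.
Hypothesis W_gt0 : (0 < W)%N.
Hypothesis W_dvd : forall q, prime q -> (q <= D0)%N -> (q %| W)%N.
Hypothesis W_small : forall q, prime q -> (q %| W)%N -> (q <= D0)%N.
Local Notation T := (primeT D0 N).

Definition ell (p : T) : R := ln (pv p)%:R / L.

Lemma ell_ge0 p : 0 <= ell p.
Proof. by rewrite divr_ge0 ?(ltW L_gt0) // ln_ge0 // ler1n pv_gt0. Qed.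

Lemma ln_prod (I : Type) (r : seq I) (f : I -> nat) : (forall i, 0 < f i)%N ->
  ln (\prod_(i <- r) f i)%:R = \sum_(i <- r) ln (f i)%:R.
Proof.
move=> f0; elim: r => [|i r IH]; first by rewrite !big_nil ln1.
by rewrite !big_cons natrM lnM ?IH // ltr0n ?prodn_gt0.
Qed.

Lemma len_ell (S : {set T}) : len ell S = ln (dv S)%:R / L.
Proof.
rewrite /len /dv -mulr_suml; congr (_ / _).
by rewrite -big_enum -(big_enum _ _ _ (fun p => pv p)) ln_prod //; exact: pv_gt0.
Qed.

Lemma len_ell_le (S : {set T}) t : (len ell S <= t) = (dv S <= Num.truncn (exp (t * L)))%N.
Proof.
have d0 : 0 < (dv S)%:R :> R by rewrite ltr0n dv_gt0.
rewrite len_ell ler_pdivrMr // (truncn_ge_nat _ (ltW (exp_gt0 _))).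
apply/idP/idP => h; last by rewrite -[leRHS]expK ler_ln.
by rewrite -(lnK d0) ler_exp.
Qed.

Local Notation delta := ((totient W)%:R / W%:R : R).

Lemma delta_ge0 : 0 <= delta. Proof. by rewrite divr_ge0. Qed.

Lemma totient_le n : (totient n <= n)%N.
Proof.
rewrite totient_count_coprime (leq_trans (_ : _ <= \sum_(0 <= d < n) 1)%N) //.
  by apply: leq_sum => i _; exact: leq_b1.
by rewrite sum_nat_const_nat subn0 muln1.
Qed.

Lemma delta_le1 : delta <= 1.
Proof. by rewrite ler_pdivrMr ?ltr0n // mul1r ler_nat totient_le. Qed.

(** The harmonic sum runs over about [exp (t * L) / W] blocks, hence the loss [ln W]. The bound
    [exp L <= N] puts every relevant prime into the type. *)
Lemma cumul_prime_lower t : t <= 1 ->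
  delta * (t * L - ln W%:R) <= cumul ell (fun p => ((pv p)%:R - 1)^-1) t.
Proof.
move=> t1; have W0 : 0 < W%:R :> R by rewrite ltr0n.
set X := Num.truncn (exp (t * L)).
have XN : (X <= N)%N.
  rewrite -(ler_nat R); apply: le_trans LN; apply: le_trans (_ : exp (t * L) <= _).
    by rewrite truncn_le ltW // exp_gt0.
  by rewrite ler_exp // ler_piMl // ltW.
rewrite /cumul (eq_bigl (fun S => dv S <= X)%N) => [|S]; last exact: len_ell_le.
apply: le_trans (kernel_sum_lower W_dvd XN).
apply: le_trans (_ : coprime_harm W (W * (X %/ W)) <= _); last first.
  by apply: coprime_harm_mono; rewrite mulnC leq_trunc_div.
apply: le_trans (coprime_harm_lower _ W_gt0); rewrite ler_wpM2l ?delta_ge0 //.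
rewrite lerBlDr -lnM ?ltr0n // -[leLHS]expK ler_ln ?exp_gt0 //.
have /andP[_ /ltW] := truncn_itv (ltW (exp_gt0 (t * L))); move/le_trans; apply.
by rewrite -natrM ler_nat -/X {1}(divn_eq X W) mulSn addnC ltn_add2r ltn_pmod.
Qed.

(** A perturbation [v] of the density costs no more than its full Euler product, since its own
    length is simply ignored. *)
Lemma cumul_add (u v : T -> R) t : (forall p, 0 <= u p) -> (forall p, 0 <= v p) ->
  cumul ell (fun p => v p + u p) t <= (\prod_p (1 + v p)) * cumul ell u t.
Proof.
move=> u0 v0; pose ind s : R := (s <= t)%R%:R.
have E w : cumul ell w t = \sum_(S : {set T}) pr w S * ind (len ell S).
  rewrite /cumul big_mkcond; apply: eq_bigr => S _; rewrite /ind.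
  by case: (leP (len ell S) t); rewrite ?mulr1 ?mulr0.
rewrite !E; apply: le_trans (@sum_pr_add_upper _ _ ell u v ind u0 v0 _) _.
  by move=> s; exact: ler0n.
rewrite mulr_sumr; apply: ler_sum => S _; rewrite mulrCA ler_wpM2l ?pr_ge0 //.
rewrite (_ : \prod_p (1 + v p) = \sum_(S : {set T}) pr v S); last first.
  rewrite (eq_bigl (fun A : {set T} => A \subset setT)) ?sum_subsets_pr1 => [|A]; last by rewrite subsetT.
  by rewrite /pr; apply: eq_bigl => p; rewrite inE.
rewrite mulr_suml; apply: ler_sum => S2 _; rewrite ler_wpM2l ?pr_ge0 // /ind.
case: (leP (_ + _) t) => h; rewrite ?ler0n //.
by rewrite (le_trans _ h) // lerDr len_ge0 //; exact: ell_ge0.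
Qed.

(** This is the cost of replacing [1 / p] by [1 / (p - k)], which differ by [k / (p (p - k))]; it
    tends to [1] as [D0] grows, by a telescoping sum. *)
Lemma prod_excess (k : nat) : (0 < k)%N -> (4 * k <= D0)%N ->
  \prod_(p : T) (1 + k%:R / ((pv p)%:R * ((pv p)%:R - k%:R))) <= (1 - (2 * k)%:R / D0%:R)^-1 :> R.
Proof.
move=> k0 kD; have D00 : (0 < D0)%N by lia.
have D0r : 0 < D0%:R :> R by rewrite ltr0n.
have kp (p : T) : (2 * k)%:R < (pv p)%:R :> R by rewrite ltr_nat; apply: leq_ltn_trans (pv_gt p); lia.
have kr : 1 <= k%:R :> R by rewrite ler1n.
have kp' (p : T) : 2 * k%:R < (pv p)%:R :> R by have := kp p; rewrite natrM.
apply: prod_1D_le.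
- by move=> p; have := kp' p => h; rewrite divr_ge0 // mulr_ge0 // subr_ge0; lra.
- apply: (@le_trans _ _ (\sum_(p : T) (2 * k)%:R * ((pv p)%:R * ((pv p)%:R - 1))^-1)).
    apply: ler_sum => p _; have := kp' p; rewrite natrM.
    move: ((pv p)%:R : R) (k%:R : R) kr => a b b1 ab.
    rewrite ler_pdivrMr; last by rewrite mulr_gt0; lra.
    have -> : 2 * b * (a * (a - 1))^-1 * (a * (a - b)) = 2 * b * ((a - b) / (a - 1)).
      by field; rewrite !gt_eqF //; lra.
    have : 2^-1 <= (a - b) / (a - 1) by rewrite ler_pdivlMr; lra.
    move: ((a - b) / (a - 1)) => r r2; nra.
  rewrite -mulr_sumr ler_wpM2l //; apply: le_trans (sum_inv_consecutive N D00).
  pose g (i : nat) : R := (i%:R * (i.-1)%:R)^-1.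
  have -> : \sum_(D0 <= i < N) ((i.+1)%:R * i%:R)^-1 = \sum_(i < N.+1 | (D0 < i)%N) g i :> R.
    rewrite -(big_geq_mkord D0.+1 N.+1 xpredT g) big_add1 /=.
    by [].
  rewrite (eq_bigr (fun p : T => g (pv p))) => [|p _]; last first.
    by rewrite /g -[in RHS]subn1 natrB ?pv_gt0.
  apply: (@ler_sum_inj R _ _ _ _ (fun p : T => val p) (fun i => g (nat_of_ord i))).
  - by move=> p q _ _ /val_inj.
  - by move=> p _; exact: pv_gt.
  by move=> i; rewrite /g invr_ge0 mulr_ge0.
by rewrite ltr_pdivrMr // mul1r ltr_nat; lia.
Qed.

Lemma cumul_prime_upper (k : nat) t : (0 < k)%N -> (4 * k <= D0)%N -> 0 <= t ->
  cumul ell (fun p => ((pv p)%:R - k%:R)^-1) t <=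
  (1 - (2 * k)%:R / D0%:R)^-1 * (W%:R + 1 + delta * (t * L)).
Proof.
move=> k0 kD t0; have W0 : 0 < W%:R :> R by rewrite ltr0n.
have kp (p : T) : k%:R < (pv p)%:R :> R by rewrite ltr_nat; apply: leq_ltn_trans (pv_gt p); lia.
have p0 (p : T) : 0 < (pv p)%:R :> R by rewrite ltr0n pv_gt0.
pose u (p : T) : R := ((pv p)%:R)^-1.
pose v (p : T) : R := k%:R / ((pv p)%:R * ((pv p)%:R - k%:R)).
have u0 p : 0 <= u p by rewrite invr_ge0.
have v0 p : 0 <= v p by rewrite divr_ge0 // mulr_ge0 // subr_ge0 ltW.
rewrite (_ : cumul _ _ _ = cumul ell (fun p => v p + u p) t); last first.
  apply: eq_bigr => S _; apply: eq_pr => p _; rewrite /u /v.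
  have := kp p; have := p0 p; move: ((pv p)%:R : R) (k%:R : R) => a b a0 ab.
  by field; rewrite !gt_eqF // subr_gt0.
apply: le_trans (cumul_add _ u0 v0) _.
have c0 : 0 <= cumul ell u t by apply: sumr_ge0 => S _; apply: pr_ge0.
have E0 : 0 <= (1 - (2 * k)%:R / D0%:R)^-1 :> R.
  have D00 : 0 < D0%:R :> R by rewrite ltr0n; lia.
  by rewrite invr_ge0 subr_ge0 ler_pdivrMr // mul1r ler_nat; lia.
apply: le_trans (ler_wpM2r c0 (prod_excess k0 kD)) _; rewrite ler_wpM2l //.
set X := Num.truncn (exp (t * L)).
rewrite /cumul (eq_bigl (fun S => dv S <= X)%N) => [|S]; last exact: len_ell_le.
apply: le_trans (kernel_sum_upper N W_gt0 W_small X) _.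
apply: le_trans (_ : coprime_harm W (W * (X %/ W).+1) <= _).
  by apply: coprime_harm_mono; rewrite {1}(divn_eq X W) mulnS addnC mulnC leq_add2r ltnW // ltn_pmod.
apply: le_trans (coprime_harm_upper _ W_gt0) _; rewrite -addrA lerD2l.
have tL0 : 0 <= t * L by rewrite mulr_ge0 // ltW.
have X0 : (0 < X)%N.
  rewrite truncn_gt0 -[X in X <= _](lnK ltr01) ler_exp // ln1 //.
have H : harm (X %/ W) <= 1 + t * L.
  apply: le_trans (_ : harm X <= _).
    rewrite /harm [leRHS](@big_cat_nat _ _ _ (X %/ W).+1) //= ?lerDl ?ltnS ?leq_div //.
    by apply: sumr_ge0 => i _; rewrite invr_ge0.
  apply: le_trans (harm_upper X0) _; rewrite lerD2l -[leRHS]expK ler_ln ?ltr0n //.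
  by rewrite truncn_le ltW // exp_gt0.
apply: le_trans (ler_wpM2l delta_ge0 H) _; rewrite mulrDr mulr1 lerD2r.
exact: delta_le1.
Qed.
End LogScale.

(** * Residue classes with prescribed divisibility, and their number *)

Import Order.TTheory GRing.Theory Num.Theory.

Lemma crt_count (m p : nat) (A B : pred nat) : coprime m p -> (0 < m)%N -> (0 < p)%N ->
  (\sum_(a < m * p) (A (a %% m) && B (a %% p)) =
   (\sum_(r < m) A r) * (\sum_(s < p) B s))%N.
Proof.
case: m p => // m [//|p] mp _ _.
pose f (a : 'I_(m.+1 * p.+1)) : 'I_m.+1 * 'I_p.+1 := (inord (a %% m.+1), inord (a %% p.+1)).
have finj : injective f.
  move=> a b [] /(congr1 val) /= + /(congr1 val) /=; rewrite !inordK ?ltn_mod // => am ap.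
  apply: val_inj; rewrite /= -(modn_small (ltn_ord a)) -(modn_small (ltn_ord b)).
  by apply/eqP; rewrite chinese_remainder // am ap !eqxx.
have fbij : bijective f by apply: inj_card_bij => //; rewrite card_prod !card_ord.
rewrite big_distrlr /= pair_big /= (reindex f) /=; last exact: onW_bij.
apply: eq_bigr => a _; rewrite !inordK ?ltn_mod //.
by rewrite -mulnb.
Qed.

Definition hit (H : seq nat) (q n : nat) : bool := has (fun h => q %| n + h)%N H.

Lemma hit_mod (H : seq nat) q n d : (q %| d)%N -> hit H q (n %% d) = hit H q n.
Proof.
move=> qd; apply: eq_has => h /=; rewrite /dvdn -modnDml modn_dvdm //.
by rewrite modnDml.
Qed.

Lemma dvd_add_unique q n h h' : (h < q)%N -> (h' < q)%N ->
  (q %| n + h)%N -> (q %| n + h')%N -> h = h'.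
Proof.
wlog hh : h h' / (h <= h')%N.
  by move=> W; case/orP: (leq_total h h') => hh ? ? ? ?; [|symmetry]; apply: W.
move=> hq hq' d1 d2.
have : (q %| h' - h)%N by rewrite -(subnDl n) dvdn_sub.
move/dvdnP => [[|c]] E; first by move: E; rewrite mul0n; lia.
by move: E; rewrite mulSn; lia.
Qed.

Lemma count_hit (H : seq nat) q : uniq H -> (forall h, h \in H -> (h < q)%N) ->
  (\sum_(r < q) hit H q r = size H)%N.
Proof.
elim: H => [|h H IH]; first by rewrite big1.
move=> /= /andP[hH uH] Hq.
have hq : (h < q)%N by apply: Hq; rewrite inE eqxx.
have q0 : (0 < q)%N by case: q hq {IH Hq}.
have Hq' h' : h' \in H -> (h' < q)%N by move=> hh; apply: Hq; rewrite inE hh orbT.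
rewrite (eq_bigr (fun r : 'I_q => (q %| r + h) + hit H q r)%N) => [|r _]; last first.
  rewrite /hit /=; case: (boolP (q %| r + h)%N) => //= rh.
  case: hasP => // -[h' h'H rh'].
  by move: hH; rewrite (dvd_add_unique hq (Hq' _ h'H) rh rh') h'H.
rewrite big_split /= IH //.
have r0 : ((q - h) %% q < q)%N by rewrite ltn_mod.
rewrite (bigD1 (Ordinal r0)) //= big1 ?addn0 => [|r rn].
  by rewrite /dvdn modnDml subnK 1?ltnW // modnn eqxx.
apply/eqP; rewrite eqb0; apply/negP => rh; case/negP: rn; apply/eqP/val_inj => /=.
case: h hq rh {r0 hH Hq} => [|h] hq rh.
  rewrite addn0 in rh; rewrite subn0 modnn; apply/eqP.
  by move: rh; rewrite /dvdn modn_small.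
rewrite modn_small; last by lia.
case/dvdnP: rh => -[|[|c]] E.
- by move: E; lia.
- by move: E; lia.
by have := ltn_ord r; move: E; rewrite !mulSn; lia.
Qed.

Section Counting.
Variables (D0 N W v : nat) (H : seq nat).
Hypothesis W_gt0 : (0 < W)%N.
Hypothesis W_dvd : forall q, prime q -> (q <= D0)%N -> (q %| W)%N.
Hypothesis W_small : forall q, prime q -> (q %| W)%N -> (q <= D0)%N.
Hypothesis H_uniq : uniq H.
Hypothesis H_le : forall h, h \in H -> (h <= D0)%N.
Hypothesis v_coprime : forall h, h \in H -> coprime (v + h) W.
Local Notation T := (primeT D0 N).
Implicit Types (U : {set T}) (n a : nat).

Definition hits (H' : seq nat) U n : bool := [forall p in U, hit H' (pv p) n].

Definition modulus U : nat := (W * dv U)%N.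

Lemma modulus_gt0 U : (0 < modulus U)%N.
Proof. by rewrite muln_gt0 W_gt0 dv_gt0. Qed.

Lemma pv_dvd_modulus U p : p \in U -> (pv p %| modulus U)%N.
Proof. by move=> pU; rewrite dvdn_mull // pv_dvd_dv. Qed.

Definition class_sum (f : nat -> R) (n0 q a : nat) : R :=
  \sum_(1 <= n < n0.+1 | (n %% q == a %% q)%N) f n.

Definition Res (H' : seq nat) U (a : nat) : bool := (a %% W == v %% W)%N && hits H' U a.

Lemma Res_mod (H' : seq nat) U n : Res H' U (n %% modulus U) = Res H' U n.
Proof.
rewrite /Res modn_dvdm ?dvdn_mulr //; congr (_ && _).
by apply: eq_forallb_in => p pU; rewrite hit_mod // pv_dvd_modulus.
Qed.

Lemma sum_classes (f : nat -> R) n0 U :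
  \sum_(1 <= n < n0.+1 | Res H U n) f n =
  \sum_(a < modulus U | Res H U a) class_sum f n0 (modulus U) a.
Proof.
rewrite big_mkcond /= (eq_bigr (fun n => \sum_(a < modulus U) if (n %% modulus U == a)%N && Res H U a then f n else 0)); last first.
  move=> n _; have nq : (n %% modulus U < modulus U)%N by rewrite ltn_mod modulus_gt0.
  rewrite (bigD1 (Ordinal nq)) //= eqxx Res_mod /= big1 ?addr0 // => a an.
  case: eqP => //= E; case/negP: an; apply/eqP/val_inj; by rewrite /= E.
rewrite exchange_big /= [RHS]big_mkcond; apply: eq_bigr => a _.
rewrite /class_sum; case: (Res H U a); last by rewrite big1 // => n _; rewrite andbF.
rewrite [RHS]big_mkcond; apply: eq_bigr => n _.
by rewrite andbT (modn_small (ltn_ord a)).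
Qed.

(** Primes are added one at a time by the Chinese remainder theorem. Each multiplies the count by
    [size H'], because the shifts are at most [D0] and so are distinct modulo a larger prime. *)
Lemma count_Res_seq (H' : seq nat) (s : seq T) : uniq s ->
  uniq H' -> (forall h, h \in H' -> (h <= D0)%N) ->
  (\sum_(a < W * \prod_(p <- s) pv p)
     ((a %% W == v %% W) && all (fun p => hit H' (pv p) a) s) = size H' ^ size s)%N.
Proof.
move=> + uH' H'D; elim: s => [_|p s IH /= /andP[ps us]].
  rewrite big_nil muln1 expn0.
  have vW : (v %% W < W)%N by rewrite ltn_mod.
  rewrite (bigD1 (Ordinal vW)) //= modn_mod eqxx big1 // => a an.
  rewrite modn_small // andbT; case: eqP => // E; case/negP: an; apply/eqP/val_inj.
  by rewrite /= E.
rewrite big_cons mulnCA [(pv p * _)%N]mulnC.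
set m := (W * _)%N.
have m0 : (0 < m)%N by rewrite muln_gt0 W_gt0 prodn_gt0 // => q; exact: pv_gt0.
have mp : coprime m (pv p).
  rewrite coprime_sym prime_coprime ?pv_prime // Euclid_dvdM ?pv_prime // negb_or.
  apply/andP; split.
    by apply/negP => /(W_small (pv_prime p)); rewrite leqNgt pv_gt.
  apply/negP => /(prime_dvd_prod (pv_prime p)).
  by rewrite (mem_map (@pv_inj _ _)) (negbTE ps).
rewrite expnS -(IH us) -(@count_hit H' (pv p)) //; last first.
  by move=> h /H'D hD; exact: leq_ltn_trans hD (pv_gt p).
rewrite [RHS]mulnC -/m -(@crt_count m (pv p) (fun a => (a %% W == v %% W)%N && all (fun p => hit H' (pv p) a) s)
  (hit H' (pv p)) mp m0 (pv_gt0 p)).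
apply: eq_bigr => a _; congr (nat_of_bool _).
rewrite (hit_mod _ _ (dvdnn _)) modn_dvdm ?dvdn_mulr // -andbA [X in _ = _ && X]andbC; congr (_ && (_ && _)).
apply: eq_in_all => q qs; rewrite hit_mod //.
by rewrite dvdn_mull // (big_rem q) //= dvdn_mulr.
Qed.

Lemma count_Res (H' : seq nat) U : uniq H' -> (forall h, h \in H' -> (h <= D0)%N) ->
  (\sum_(a < modulus U | Res H' U a) 1 = size H' ^ #|U|)%N.
Proof.
move=> uH' H'D; rewrite cardE -(count_Res_seq (enum_uniq (mem U)) uH' H'D).
rewrite /modulus /dv -(big_enum _ _ (mem U) (fun p => pv p)) /= big_mkcond /=.
apply: eq_bigr => a _; rewrite /Res /hits.
have -> : [forall p in U, hit H' (pv p) a] = all (fun p => hit H' (pv p) a) (enum U).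
  apply/forall_inP/allP => h p; first by rewrite mem_enum => /h.
  by move=> pU; apply: h; rewrite mem_enum.
by case: ifP.
Qed.

Lemma coprime_dv m U : coprime m (dv U) = [forall p in U, ~~ (pv p %| m)%N].
Proof.
have -> : [forall p in U, ~~ (pv p %| m)%N] = all (fun p => ~~ (pv p %| m)%N) (enum U).
  apply/forall_inP/allP => h p; first by rewrite mem_enum => /h.
  by move=> pU; apply: h; rewrite mem_enum.
rewrite /dv -(big_enum _ _ (mem U) (fun p => pv p)) /=.
elim: (enum U) => [|p s IH]; first by rewrite big_nil coprimen1.
by rewrite big_cons coprimeMr IH /= coprime_sym prime_coprime ?pv_prime.
Qed.

(** A prime above [D0] divides at most one shift of [a], so [a + h0] is prime to the modulus exactly
    when every prime of [U] divides another shift. This turns [k] classes per prime into [k - 1]. *)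
Lemma Res_rem h0 U a : h0 \in H ->
  Res (rem h0 H) U a = Res H U a && coprime (a + h0) (modulus U).
Proof.
move=> h0H; rewrite /Res -andbA; case: eqP => //= aW.
have cW : coprime (a + h0) W.
  by rewrite -coprime_modl -modnDml aW modnDml coprime_modl v_coprime.
have lt_pv h (p : T) : h \in H -> (h < pv p)%N.
  by move=> /H_le hD; exact: leq_ltn_trans hD (pv_gt p).
rewrite coprimeMr cW coprime_dv /=.
apply/forall_inP/andP => [h|[/forall_inP h /forall_inP c] p pU].
  split; apply/forall_inP => p pU; have /hasP[h' + d] := h p pU; rewrite mem_rem_uniq // inE => /andP[hh h'H].
    by apply/hasP; exists h'.
  apply/negP => d0; case/negP: hh.
  by apply/eqP; exact: dvd_add_unique (lt_pv _ p h'H) (lt_pv _ p h0H) d d0.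
have /hasP[h' h'H d] := h p pU; apply/hasP; exists h' => //.
rewrite mem_rem_uniq // inE h'H andbT; apply/eqP => E.
by have := c p pU; rewrite -E d.
Qed.

Lemma class_sum_count n0 q a : (0 < q)%N ->
  `|class_sum (fun=> 1) n0 q a - n0%:R / q%:R| <= 1.
Proof.
move=> q0; have q0' : 0 < q%:R :> R by rewrite ltr0n.
have H1 c : class_sum (fun=> 1) (q * c) q a = c%:R.
  elim: c => [|c IH]; first by rewrite muln0 /class_sum big_geq.
  rewrite /class_sum (@big_cat_nat _ _ _ (q * c).+1) //=; last by rewrite ltnS leq_mul2l leqnSn orbT.
  rewrite [X in X + _]IH -natr1; congr (_ + _).
  rewrite (_ : (q * c.+1).+1 = q.+1 + q * c)%N; last by rewrite mulnS.
  rewrite (_ : (q * c).+1 = 1 + q * c)%N // big_addn addnK.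
  under eq_bigl => n do rewrite addnC mulnC modnMDl.
  have aq : (a %% q < q)%N by rewrite ltn_mod.
  rewrite big_mkcond; case: q q0 {q0' IH} aq => // q _ aq.
  rewrite big_nat_recr //= modnn; case: (posnP (a %% q.+1)) => [->|a0].
    rewrite eqxx big1_seq ?add0r // => i /andP[_]; rewrite mem_index_iota => /andP[i1 iq].
    by rewrite modn_small // eqn0Ngt i1.
  rewrite ltn_eqF // addr0 (bigD1_seq (a %% q.+1)%N) ?iota_uniq //=; last first.
    by rewrite mem_index_iota a0.
  rewrite modn_mod eqxx big1_seq ?addr0 // => i /andP[ia].
  by rewrite mem_index_iota => /andP[i1 iq]; rewrite modn_small // (negbTE ia).
have mono x y : (x <= y)%N -> class_sum (fun=> 1) x q a <= class_sum (fun=> 1) y q a.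
  move=> xy; rewrite /class_sum [leRHS](@big_cat_nat _ _ _ x.+1) //= lerDl.
  by apply: sumr_ge0.
have := mono (q * (n0 %/ q))%N n0; rewrite H1 mulnC leq_trunc_div => /(_ isT) L1.
have := mono n0 (q * (n0 %/ q).+1)%N; rewrite H1 => L2.
have e : (n0 <= q * (n0 %/ q).+1)%N by rewrite mulnC ltnW // ltn_ceil.
have {}L2 := L2 e; rewrite -natr1 in L2.
have B1 : (n0 %/ q)%:R <= n0%:R / q%:R :> R by rewrite ler_pdivlMr // -natrM ler_nat leq_trunc_div.
have B2 : n0%:R / q%:R <= (n0 %/ q)%:R + 1 :> R by rewrite natr1 ler_pdivrMr // -natrM ler_nat ltnW // ltn_ceil.
rewrite ler_norml; lra.
Qed.

End Counting.

Notation modulus_def := modulus (only parsing).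
Notation residue_def := Res (only parsing).

(** * Class sums of [1], of logarithms of primes and of the Liouville function *)

Import Order.TTheory GRing.Theory Num.Theory.

Definition EA (n0 q : nat) : R :=
  \big[Rmax/0]_(a < q | coprime a q) Rabs (prime_AP_error n0 q a).
Definition EB (n0 q : nat) : R :=
  \big[Rmax/0]_(y < n0.+1) \big[Rmax/0]_(a < q) Rabs (liouville_AP_sum y q a).

Lemma bigRmax_ge0 (I : Type) (r : seq I) (P : pred I) (f : I -> R) :
  0 <= \big[Rmax/0]_(i <- r | P i) f i.
Proof.
elim: r => [|i r IH]; first by rewrite big_nil.
by rewrite big_cons; case: (P i) => //; rewrite RmaxE le_max IH orbT.
Qed.

Lemma le_bigRmax (I : finType) (P : pred I) (f : I -> R) i : P i ->
  f i <= \big[Rmax/0]_(i | P i) f i.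
Proof.
move=> Pi; have : i \in index_enum I by rewrite mem_index_enum.
elim: (index_enum I) => // j r IH; rewrite inE big_cons => /predU1P[<-|/IH h].
  by rewrite Pi RmaxE le_max lexx.
by case: (P j) => //; rewrite RmaxE le_max h orbT.
Qed.

Lemma bigRmax_le (I : finType) (P : pred I) (f : I -> R) (b : R) : 0 <= b ->
  (forall i, P i -> f i <= b) -> \big[Rmax/0]_(i | P i) f i <= b.
Proof.
move=> b0 fb; elim: (index_enum I) => [|j r IH]; first by rewrite big_nil.
by rewrite big_cons; case Pj: (P j) => //; rewrite RmaxE ge_max fb.
Qed.

Lemma EA_ge0 n0 q : 0 <= EA n0 q. Proof. exact: bigRmax_ge0. Qed.
Lemma EB_ge0 n0 q : 0 <= EB n0 q. Proof. exact: bigRmax_ge0. Qed.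

Lemma EA_bound n0 q a : (0 < q)%N -> coprime a q -> `|prime_AP_error n0 q a| <= EA n0 q.
Proof.
move=> q0 aq; have h : (a %% q < q)%N by rewrite ltn_mod.
have -> : prime_AP_error n0 q a = prime_AP_error n0 q (Ordinal h).
  by rewrite /prime_AP_error /= modn_mod.
rewrite -RabsE; apply: (@le_bigRmax _ (fun a : 'I_q => coprime a q) (fun a => Rabs (prime_AP_error n0 q a))).
by rewrite /= coprime_modl.
Qed.

Lemma EB_bound n0 y q a : (0 < q)%N -> (y <= n0)%N -> `|liouville_AP_sum y q a| <= EB n0 q.
Proof.
move=> q0 yn; have h : (a %% q < q)%N by rewrite ltn_mod.
have -> : liouville_AP_sum y q a = liouville_AP_sum y q (Ordinal h).
  by rewrite /liouville_AP_sum /= modn_mod.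
rewrite -RabsE.
apply: le_trans (@le_bigRmax _ xpredT (fun a : 'I_q => Rabs (liouville_AP_sum y q a)) (Ordinal h) isT) _.
have yn' : (y < n0.+1)%N by [].
exact: (@le_bigRmax _ xpredT (fun y : 'I_n0.+1 => \big[Rmax/0]_(a < q) Rabs (liouville_AP_sum y q a)) (Ordinal yn') isT).
Qed.

Definition log_prime (h n : nat) : R := if prime (n + h)%N then ln (n + h)%:R else 0.

Section ClassSums.
Variables (D0 N W v : nat) (H : seq nat).
Hypothesis W_gt0 : (0 < W)%N.
Hypothesis W_dvd : forall q, prime q -> (q <= D0)%N -> (q %| W)%N.
Hypothesis W_small : forall q, prime q -> (q %| W)%N -> (q <= D0)%N.
Hypothesis H_uniq : uniq H.
Hypothesis H_le : forall h, h \in H -> (h <= D0)%N.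
Hypothesis v_coprime : forall h, h \in H -> coprime (v + h) W.
Local Notation T := (primeT D0 N).
Local Notation modulus := (@modulus D0 N W).
Local Notation Res := (@Res D0 N W v).
Implicit Types (U : {set T}) (n a : nat).

Lemma sum_Res_const (H' : seq nat) U (c : R) : uniq H' -> (forall h, h \in H' -> (h <= D0)%N) ->
  \sum_(a < modulus U | Res H' U a) c = c * (size H')%:R ^+ #|U|.
Proof.
move=> uH' H'D; rewrite -natrX -(count_Res v W_gt0 W_small U uH' H'D) natr_sum mulr_sumr.
by apply: eq_bigr => a _; rewrite mulr1.
Qed.

Lemma modulus_real U : (modulus U)%:R = W%:R * pr (fun p => (pv p)%:R) U :> R.
Proof. by rewrite natrM /dv natr_prod. Qed.

Lemma sum_Res_one n0 U :
  `|\sum_(1 <= n < n0.+1 | Res H U n) (1 : R) - n0%:R / W%:R * pr (fun p => (size H)%:R / (pv p)%:R) U|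
  <= (size H)%:R ^+ #|U| :> R.
Proof.
rewrite (sum_classes v H W_gt0 (fun=> 1)).
have -> : n0%:R / W%:R * pr (fun p => (size H)%:R / (pv p)%:R) U =
    \sum_(a < modulus U | Res H U a) (n0%:R / (modulus U)%:R) :> R.
  rewrite sum_Res_const // modulus_real prM prV pr_const invfM; ring.
rewrite -sumrB; apply: le_trans (ler_norm_sum _ _ _) _.
rewrite -[leRHS]mul1r -sum_Res_const //; apply: ler_sum => a _.
by apply: class_sum_count; exact: modulus_gt0.
Qed.

Lemma totient_modulus U :
  (totient (modulus U))%:R = (totient W)%:R * pr (fun p => (pv p)%:R - 1) U :> R.
Proof.
rewrite /modulus_def totient_coprime; last by rewrite coprime_sym dv_coprime.
rewrite natrM; congr (_ * _); rewrite /dv /pr -!big_enum /=.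
elim: (enum U) (enum_uniq (mem U)) => [|p s IH] /=; first by rewrite !big_nil totient1 || rewrite !big_nil.
case/andP=> ps us; rewrite !big_cons totient_coprime; last first.
  rewrite prime_coprime ?pv_prime //; apply/negP => /(prime_dvd_prod (pv_prime p)).
  by rewrite (mem_map (@pv_inj _ _)) (negbTE ps).
rewrite natrM IH // totient_prime ?pv_prime // -subn1 natrB ?pv_gt0 //.
Qed.

(** Passing from [n] to [n + h0] drops the primes up to [h0]. None of them lies in the class, since
    it would divide both [W] and [v + h0]. *)
Lemma class_sum_log_prime n0 h0 U a : h0 \in H -> Res H U a ->
  class_sum (log_prime h0) n0 (modulus U) a =
  \sum_(p < (n0 + h0).+1 | prime p && (p %% modulus U == (a + h0) %% modulus U)%N) ln (INR p).
Proof.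
move=> h0H /andP[/eqP aW _]; set q := modulus U.
have Wq : (W %| q)%N by rewrite dvdn_mulr.
rewrite -(big_mkord (fun p => prime p && (p %% q == (a + h0) %% q)%N) (fun p => ln (INR p))).
rewrite (@big_cat_nat _ _ _ h0.+1) //=; last by rewrite ltnS leq_addl.
rewrite [X in _ = X + _]big1_seq ?add0r; last first.
  move=> p /andP[/andP[p_pr /eqP pq]]; rewrite mem_index_iota ltnS => /= ph.
  have pW : (p %| W)%N by apply: W_dvd => //; apply: leq_trans ph (H_le h0H).
  have := v_coprime h0H; rewrite coprime_sym.
  have pd : (p %| v + h0)%N.
    have : (p %| a + h0)%N.
      by rewrite /dvdn -(modn_dvdm (a + h0) (dvdn_trans pW Wq)) -pq modn_dvdm ?modnn // (dvdn_trans pW).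
    rewrite /dvdn -(modn_dvdm (a + h0) pW) -(modn_dvdm (v + h0) pW).
    by rewrite -[in X in X -> _](modnDml a) aW modnDml.
  move/(coprime_dvdl pW)/(coprime_dvdr pd); rewrite /coprime gcdnn => /eqP p1.
  by rewrite p1 in p_pr.
rewrite (_ : (n0 + h0).+1 = n0.+1 + h0)%N; last by lia.
rewrite (_ : h0.+1 = 1 + h0)%N // big_addn addnK /class_sum.
rewrite big_mkcond [RHS]big_mkcond /=; apply: eq_bigr => n _.
rewrite /log_prime eqn_modDr INRE; by case: (prime _); case: eqP.
Qed.

Lemma sum_Res_prime n0 h0 U : h0 \in H -> (0 < n0)%N ->
  `|\sum_(1 <= n < n0.+1 | Res H U n) log_prime h0 n -
    (n0 + h0)%:R / (totient W)%:R * pr (fun p => ((size H).-1)%:R / ((pv p)%:R - 1)) U|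
  <= (size H)%:R ^+ #|U| * (EA (n0 + h0) (modulus U) + ln (n0 + h0)%:R).
Proof.
move=> h0H n00; rewrite (sum_classes v H W_gt0).
set q := modulus U; have q0 : (0 < q)%N by exact: modulus_gt0.
have ln0 : 0 <= ln (n0 + h0)%:R by rewrite ln_ge0 // ler1n addn_gt0 n00.
have -> : (n0 + h0)%:R / (totient W)%:R * pr (fun p => ((size H).-1)%:R / ((pv p)%:R - 1)) U =
    \sum_(a < q | Res H U a) (if coprime (a + h0) q then (n0 + h0)%:R / (totient q)%:R else 0) :> R.
  rewrite -big_mkcondr /= (eq_bigl (fun a : 'I_q => Res (rem h0 H) U a)) => [|a]; last first.
    by rewrite Res_rem.
  rewrite sum_Res_const ?rem_uniq // => [|h /mem_rem]; last exact: H_le.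
  by rewrite size_rem // totient_modulus prM prV pr_const invfM; ring.
rewrite -sumrB; apply: le_trans (ler_norm_sum _ _ _) _.
rewrite [leRHS]mulrC -sum_Res_const //; apply: ler_sum => a Ra.
rewrite class_sum_log_prime //; case: ifP => aq.
  have := EA_bound (n0 + h0) q0 aq; rewrite /prime_AP_error RminusE RdivE !INRE => h.
  by apply: le_trans h _; rewrite lerDl.
rewrite subr0 ger0_norm; last first.
  by apply: sumr_ge0 => p /andP[p_pr _]; rewrite INRE ln_ge0 // ler1n prime_gt0.
(* When the class is not prime to the modulus, some prime of [U] divides all its members, so it
   contains at most that one prime and contributes at most one logarithm. *)
apply: (@le_trans _ _ (ln (n0 + h0)%:R)); last by rewrite lerDr EA_ge0.
have [p pU pd] : exists2 p : T, p \in U & (pv p %| a + h0)%N.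
  move: aq; rewrite coprimeMr; case/andP: Ra => /eqP aW _.
  have -> : coprime (a + h0) W by rewrite -coprime_modl -modnDml aW modnDml coprime_modl v_coprime.
  rewrite /= coprime_dv => /negbT; rewrite negb_forall_in => /exists_inP[p pU].
  by rewrite negbK; exists p.
have pq : (pv p %| q)%N by exact: pv_dvd_modulus.
apply: (@le_trans _ _ (\sum_(r < (n0 + h0).+1 | r == pv p :> nat) ln (n0 + h0)%:R)).
  rewrite big_mkcond [leRHS]big_mkcond /=; apply: ler_sum => r _.
  case: ifP => [/andP[r_pr /eqP rq]|_]; last by case: ifP.
  have : (pv p %| r)%N by rewrite /dvdn -(modn_dvdm r pq) rq modn_dvdm.
  rewrite dvdn_prime2 ?pv_prime // => /eqP E; rewrite E eqxx INRE.
  by apply: ler_ln; rewrite ?ltr0n ?prime_gt0 // ler_nat -ltnS.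
have [pn|pn] := ltnP (pv p) (n0 + h0).+1; last first.
  by rewrite big_pred0 // => r; apply: ltn_eqF; apply: leq_trans pn.
by rewrite (big_pred1 (Ordinal pn)) // => r; rewrite /= -val_eqE.
Qed.

Lemma sum_Res_liouville n0 h0 U : h0 \in H ->
  `|\sum_(1 <= n < n0.+1 | Res H U n) liouville (n + h0)|
  <= (size H)%:R ^+ #|U| * (2 * EB (n0 + h0) (modulus U)).
Proof.
move=> h0H; rewrite (sum_classes v H W_gt0 (fun n => liouville (n + h0))).
set q := modulus U; have q0 : (0 < q)%N by exact: modulus_gt0.
apply: le_trans (ler_norm_sum _ _ _) _; rewrite [leRHS]mulrC -sum_Res_const //.
apply: ler_sum => a _.
(* The shift makes this a difference of two initial sums, whence the factor [2]; both are covered by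
   the maximum over [y] in condition (B). *)
have -> : class_sum (fun n => liouville (n + h0)) n0 q a =
    liouville_AP_sum (n0 + h0) q (a + h0) - liouville_AP_sum h0 q (a + h0).
  rewrite /liouville_AP_sum [X in _ = X - _](@big_cat_nat _ _ _ h0.+1) //=; last by rewrite ltnS leq_addl.
  rewrite [RHS]addrC addKr (_ : (n0 + h0).+1 = n0.+1 + h0)%N; last by lia.
  rewrite (_ : h0.+1 = 1 + h0)%N // big_addn addnK /class_sum.
  by apply: eq_bigl => n; rewrite eqn_modDr.
apply: le_trans (ler_normB _ _) _.
by rewrite mulr_natl mulr2n lerD // EB_bound // leq_addl.
Qed.

End ClassSums.

(** * Summation of the error terms over pairs of divisors *)

Import Order.TTheory GRing.Theory Num.Theory.

Lemma lnX (x : R) n : 0 < x -> ln (x ^+ n) = n%:R * ln x.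
Proof.
move=> x0; elim: n => [|n IH]; first by rewrite expr0 ln1 mul0r.
by rewrite exprS lnM ?exprn_gt0 // IH -natr1 mulrDl mul1r addrC.
Qed.

Lemma expD (x y : R) : exp (x + y) = exp x * exp y.
Proof. exact: exp_plus. Qed.

Lemma cumul_pow (T : finType) (l : T -> R) (u : T -> R) (t : R) n :
  (forall p, 0 <= l p) -> (forall p, 0 <= u p) ->
  cumul l (fun p => n%:R * u p) t <= cumul l u t ^+ n.
Proof.
move=> l0 u0; elim: n => [|n IH].
  rewrite expr0 /cumul big_mkcond (bigD1 set0) //= big1 ?addr0 => [|S /set0Pn[p pS]].
    by case: ifP => //; rewrite pr0.
  by case: ifP => // _; rewrite /pr (bigD1 p) //= !mul0r.
pose v p := n%:R * u p; have v0 p : 0 <= v p by rewrite mulr_ge0.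
pose ind s : R := (s <= t)%R%:R.
have E w : cumul l w t = \sum_(S : {set T}) pr w S * ind (len l S).
  rewrite /cumul big_mkcond; apply: eq_bigr => S _; rewrite /ind.
  by case: (leP (len l S) t); rewrite ?mulr1 ?mulr0.
rewrite (_ : cumul _ _ _ = \sum_(S : {set T}) pr (fun p => v p + u p) S * ind (len l S)); last first.
  by rewrite E; apply: eq_bigr => S _; congr (_ * _); apply: eq_pr => p _; rewrite /v -natr1; ring.
apply: le_trans (@sum_pr_add_upper _ _ l u v ind u0 v0 _) _; first by move=> s; exact: ler0n.
rewrite exprS; apply: (@le_trans _ _ (cumul l u t * cumul l v t)).
  rewrite !E mulr_suml; apply: ler_sum => S1 _; rewrite -mulrA ler_wpM2l ?pr_ge0 // mulr_sumr.
  apply: ler_sum => S2 _; rewrite mulrCA ler_wpM2l ?pr_ge0 // /ind -natrM ler_nat.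
  case: (leP (_ + _) t) => //= h.
  have h1 : len l S1 <= t by apply: le_trans h; rewrite lerDr len_ge0.
  have h2 : len l S2 <= t by apply: le_trans h; rewrite lerDl len_ge0.
  by rewrite h1 h2.
by rewrite ler_wpM2l // cumul_ge0.
Qed.

Lemma coprime_harm_le_harm W X : coprime_harm W X <= harm X.
Proof.
rewrite /coprime_harm /harm -(big_mkord (fun n => (0 < n)%N && coprime n W) (fun n => (n%:R)^-1)).
rewrite big_ltn_cond //= big_mkcond /=; apply: ler_sum => i _.
by case: ifP => // _; rewrite invr_ge0.
Qed.

Section ErrorSums.
Variables (D0 N W : nat) (L : R) (k : nat).
Hypothesis L_gt0 : 0 < L.
Hypothesis W_gt0 : (0 < W)%N.
Hypothesis W_small : forall q, prime q -> (q %| W)%N -> (q <= D0)%N.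
Hypothesis k_gt0 : (0 < k)%N.
Local Notation T := (primeT D0 N).
Local Notation ell := (@ell D0 N L).
Implicit Types (U D E : {set T}).

Let ell0 p : 0 <= ell p. Proof. exact: ell_ge0. Qed.

Lemma count_sets t : 0 <= t -> \sum_(D : {set T} | len ell D <= t) (1 : R) <= exp (t * L).
Proof.
move=> t0; set X := Num.truncn (exp (t * L)).
have XL : X%:R <= exp (t * L) by rewrite truncn_le ltW // exp_gt0.
apply: le_trans XL.
have -> : X%:R = \sum_(n < X.+1 | (0 < n)%N) (1 : R).
  by rewrite big_mkcond big_ord_recl /= add0r (eq_bigr (fun=> 1)) ?sumr_const ?card_ord.
rewrite (eq_bigl (fun S => dv S <= X)%N) => [|S]; last exact: len_ell_le.
apply: (@ler_sum_inj R _ _ _ _ (fun S => (inord (dv S) : 'I_X.+1)) (fun=> 1)).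
- move=> A1 A2 H1 H2 /(congr1 val) /=; rewrite !inordK ?ltnS //; exact: dv_inj.
- by move=> S SX; rewrite inordK ?ltnS // dv_gt0.
by move=> _; exact: ler01.
Qed.

(** Each prime exceeds [k ^ s], so [k] is at most its power [1 / s], and the divisor-type factor is
    a small power of [dv D]. *)
Lemma pow_card_bound (s : nat) (t : R) D : (0 < s)%N -> (k ^ s <= D0)%N -> len ell D <= t ->
  k%:R ^+ #|D| <= exp (t * L / s%:R).
Proof.
move=> s0 ks; have k0 : 0 < k%:R :> R by rewrite ltr0n.
have s0' : 0 < s%:R :> R by rewrite ltr0n.
rewrite len_ell ler_pdivrMr // => h.
rewrite -(lnK (exprn_gt0 #|D| k0)) ler_exp // ler_pdivlMr // lnX //; apply: le_trans h.
have -> : ln (dv D)%:R = \sum_(p in D) ln (pv p)%:R.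
  by rewrite /dv -!big_enum /= ln_prod //; exact: pv_gt0.
rewrite -mulrA mulr_natl -sumr_const; apply: ler_sum => p _.
rewrite mulrC -lnX // ler_ln ?exprn_gt0 // -natrX ler_nat.
by rewrite (leq_trans ks) // ltnW // pv_gt.
Qed.

Lemma error_sum_trivial (s : nat) : (0 < s)%N -> (k ^ s <= D0)%N ->
  \sum_(D : {set T} | len ell D <= 1) \sum_(E : {set T} | len ell E <= 1) k%:R ^+ #|D :|: E|
  <= exp (2 * L * (1 + (s%:R)^-1)).
Proof.
move=> s0 ks; have k1 : 1 <= k%:R :> R by rewrite ler1n.
have B : \sum_(D : {set T} | len ell D <= 1) k%:R ^+ #|D| <= exp (L * (1 + (s%:R)^-1)).
  rewrite mulrDr mulr1 expD.
  apply: le_trans (_ : \sum_(D : {set T} | len ell D <= 1) 1 * exp (L / s%:R) <= _).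
    apply: ler_sum => D h; rewrite mul1r; have := pow_card_bound s0 ks h.
    by rewrite mul1r.
  rewrite -mulr_suml ler_wpM2r ?(ltW (exp_gt0 _)) //.
  by have := count_sets ler01; rewrite mul1r.
have -> : 2 * L * (1 + (s%:R)^-1) = L * (1 + (s%:R)^-1) + L * (1 + (s%:R)^-1) by ring.
rewrite expD.
have B0 : 0 <= \sum_(D : {set T} | len ell D <= 1) k%:R ^+ #|D| :> R by apply: sumr_ge0 => D _; rewrite exprn_ge0.
apply: le_trans (ler_pM B0 B0 B B).
rewrite mulr_suml; apply: ler_sum => D _; rewrite mulr_sumr; apply: ler_sum => E _.
rewrite -exprD ler_weXn2l // -cardsUI leq_addr //.
Qed.

(** A set [U] is the union of at most [4 ^ #|U|] pairs, both members being subsets of [U]. *)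
Lemma error_sum_union (Er : {set T} -> R) : (forall U, 0 <= Er U) ->
  \sum_(D : {set T} | len ell D <= 1) \sum_(E : {set T} | len ell E <= 1) k%:R ^+ #|D :|: E| * Er (D :|: E)
  <= \sum_(U : {set T} | len ell U <= 2) (4 * k)%:R ^+ #|U| * Er U.
Proof.
move=> Er0; pose G U := k%:R ^+ #|U| * Er U.
have G0 U : 0 <= G U by rewrite mulr_ge0 // exprn_ge0.
have E1 : \sum_(D : {set T} | len ell D <= 1) \sum_(E : {set T} | len ell E <= 1) G (D :|: E) <=
  \sum_(D : {set T}) \sum_(E : {set T}) \sum_(U : {set T} | len ell U <= 2)
     if (D \subset U) && (E \subset U) then G U else 0.
  rewrite big_mkcond; apply: ler_sum => D _; case: ifP => hD; last first.
    by do 2 (apply: sumr_ge0 => ? _); case: ifP.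
  rewrite big_mkcond; apply: ler_sum => E _; case: ifP => hE; last first.
    by apply: sumr_ge0 => ? _; case: ifP.
  rewrite (bigD1 (D :|: E)) /=; last first.
    have -> : D :|: E = D :|: (E :\: D) by apply/setP=> x; rewrite !inE; case: (x \in D).
    rewrite lenU; last by rewrite disjoints_subset; apply/subsetP => x xA; rewrite !inE xA.
    have : len ell (E :\: D) <= len ell E by rewrite len_sub // subsetDl.
    by move: hD hE; lra.
  rewrite subsetUl subsetUr /= lerDl; apply: sumr_ge0 => ? _; by case: ifP.
apply: le_trans E1 _.
under eq_bigr => D _ do rewrite exchange_big /=.
rewrite exchange_big /=; apply: ler_sum => U _.
have sub_card : \sum_(D : {set T} | D \subset U) (1 : R) = 2 ^+ #|U|.
  rewrite -(pr_const (1 + 1 : R)) -(sum_subsets_pr1 (fun=> 1)).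
  by apply: eq_bigr => D _; rewrite pr_const expr1n.
have -> : \sum_(D : {set T}) \sum_(E : {set T}) (if (D \subset U) && (E \subset U) then G U else 0) =
   (\sum_(D : {set T} | D \subset U) (1 : R)) * (\sum_(D : {set T} | D \subset U) (1 : R)) * G U.
  rewrite -mulrA mulr_suml [RHS]big_mkcond; apply: eq_bigr => D _.
  case: ifP => DU /=; last by rewrite big1.
  by rewrite mul1r mulr_suml [RHS]big_mkcond; apply: eq_bigr => E _; rewrite mul1r.
rewrite sub_card /G mulrA -!exprMn -!natrM ler_wpM2r //.
Qed.

(** The inequality [z <= B + z ^+ 2 / B] takes the place of Cauchy-Schwarz: the part without divisor
    weight is left to the level of distribution, the other to trivial bounds. A power of the
    logarithm will serve as [B]. *)
Lemma error_sum_split (a B : R) (Er : {set T} -> R) : 0 < B -> (forall U, 0 <= Er U) ->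
  \sum_(U : {set T} | len ell U <= 2) a ^+ #|U| * Er U <=
  B * (\sum_(U : {set T} | len ell U <= 2) Er U) +
  B^-1 * (\sum_(U : {set T} | len ell U <= 2) (a ^+ 2) ^+ #|U| * Er U).
Proof.
move=> B0 Er0; rewrite !mulr_sumr -big_split /=; apply: ler_sum => U _.
rewrite -exprM mulnC exprM mulrA -mulrDl ler_wpM2r //.
move: (a ^+ #|U|) => z; rewrite -subr_ge0.
have -> : B + B^-1 * z ^+ 2 - z = ((z - B / 2) ^+ 2 + 3 / 4 * B ^+ 2) / B.
  by field; rewrite gt_eqF.
by rewrite divr_ge0 ?(ltW B0) // addr_ge0 ?sqr_ge0 // mulr_ge0 ?sqr_ge0 //; lra.
Qed.

Lemma divisor_sum_bound (n : nat) :
  \sum_(U : {set T} | len ell U <= 2) n%:R ^+ #|U| / (dv U)%:R <= (1 + 2 * L) ^+ n.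
Proof.
have L2 : 0 <= 2 * L by rewrite mulr_ge0 // ltW.
have u0 (p : T) : 0 <= ((pv p)%:R)^-1 :> R by rewrite invr_ge0.
have -> : \sum_(U : {set T} | len ell U <= 2) n%:R ^+ #|U| / (dv U)%:R =
   cumul ell (fun p => n%:R * ((pv p)%:R)^-1) 2.
  apply: eq_bigr => U _; rewrite prM pr_const prV; congr (_ / _).
  by rewrite /dv natr_prod.
apply: le_trans (cumul_pow _ _ ell0 u0) _.
rewrite lerXn2r ?nnegrE ?addr_ge0 ?cumul_ge0 //.
set X := Num.truncn (exp (2 * L)).
rewrite /cumul (eq_bigl (fun S => dv S <= X)%N) => [|S]; last exact: len_ell_le.
apply: le_trans (kernel_sum_upper N W_gt0 W_small X) _.
apply: le_trans (coprime_harm_le_harm _ _) _.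
have X0 : (0 < X)%N by rewrite truncn_gt0 -[X in X <= _](lnK ltr01) ler_exp // ln1.
apply: le_trans (harm_upper X0) _; rewrite lerD2l -[leRHS]expK ler_ln ?ltr0n //.
by rewrite truncn_le ltW // exp_gt0.
Qed.

Lemma sum_moduli (E : nat -> R) (y : R) (n0 : nat) : (forall q, 0 <= E q) ->
  W%:R * exp (2 * L) <= y -> y <= n0%:R ->
  \sum_(U : {set T} | len ell U <= 2) E (modulus W U) <=
  \sum_(1 <= q < n0.+1 | Rleb (INR q) y) E q.
Proof.
move=> E0 Wy yn.
have HU U : len ell U <= 2 -> (modulus W U)%:R <= y.
  rewrite (len_ell_le L_gt0) => h; apply: le_trans Wy; rewrite natrM ler_wpM2l //.
  apply: le_trans (_ : (Num.truncn (exp (2 * L)))%:R <= _); first by rewrite ler_nat.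
  by rewrite truncn_le ltW // exp_gt0.
have HU' U : len ell U <= 2 -> (modulus W U < n0.+1)%N.
  by move=> h; rewrite ltnS -(ler_nat R) (le_trans (HU _ h)).
have -> : \sum_(1 <= q < n0.+1 | Rleb (INR q) y) E q =
  \sum_(q < n0.+1 | Rleb (INR q) y && (0 < q)%N) E q by rewrite big_geq_mkord.
rewrite (eq_bigr (fun U => E (inord (modulus W U) : 'I_n0.+1))); last first.
  by move=> U h; rewrite inordK // HU'.
apply: (@ler_sum_inj R _ _ _ _ (fun U => (inord (modulus W U) : 'I_n0.+1)) (fun q => E (nat_of_ord q))) => //.
- move=> A1 A2 H1 H2 /(congr1 val) /=; rewrite !inordK ?HU' // => /eqP.
  by rewrite /modulus eqn_pmul2l // => /eqP; exact: dv_inj.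
- move=> U h; rewrite inordK ?HU' // modulus_gt0 // andbT /Rleb.
  by case: Rle_dec => // -[]; apply/RleP; rewrite INRE HU.
Qed.

End ErrorSums.

(** * Trivial bounds, and the error terms below the level of distribution *)

Import Order.TTheory GRing.Theory Num.Theory.

Lemma class_sum_le n0 q a : (0 < q)%N -> (q <= n0)%N ->
  class_sum (fun=> 1) n0 q a <= 2 * n0%:R / q%:R.
Proof.
move=> q0 qn; have q0' : 0 < q%:R :> R by rewrite ltr0n.
have := class_sum_count n0 a q0; rewrite ler_norml => /andP[_ h].
have : 1 <= n0%:R / q%:R :> R by rewrite ler_pdivlMr // mul1r ler_nat.
by rewrite -mulrA; lra.
Qed.

Lemma EA_trivial n q : (0 < q)%N -> (q <= n)%N ->
  EA n q <= 2 * n%:R / q%:R * ln n%:R + n%:R / (totient q)%:R.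
Proof.
move=> q0 qn; have n1 : (1 <= n)%N by exact: leq_trans qn.
have ln0 : 0 <= ln n%:R by rewrite ln_ge0 // ler1n.
have t0 : 0 <= n%:R / (totient q)%:R :> R by rewrite divr_ge0.
have A0 : 0 <= 2 * n%:R / q%:R :> R by rewrite divr_ge0 // mulr_ge0.
apply: bigRmax_le => [|a _]; first by rewrite addr_ge0 // mulr_ge0.
rewrite RabsE /prime_AP_error RminusE RdivE !INRE.
apply: le_trans (ler_normB _ _) _; rewrite [X in _ + X]ger0_norm // lerD2r.
rewrite ger0_norm; last first.
  by apply: sumr_ge0 => p /andP[p_pr _]; rewrite INRE ln_ge0 // ler1n prime_gt0.
apply: le_trans (ler_wpM2r ln0 (class_sum_le a q0 qn)).
rewrite /class_sum mulr_suml big_geq_mkord big_mkcond [leRHS]big_mkcond /=.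
apply: ler_sum => p _; case: ifP => [/andP[p_pr pq]|_].
  rewrite pq prime_gt0 //= mul1r INRE ler_ln ?ltr0n ?prime_gt0 // ler_nat -ltnS //.
by case: ifP => // _; rewrite mul1r.
Qed.

Lemma liouville_norm n : `|liouville n| = 1.
Proof. by rewrite /liouville RpowE RoppE normrX normrN INRE normr1 expr1n. Qed.

Lemma EB_trivial n q : (0 < q)%N -> (q <= n)%N -> EB n q <= 2 * n%:R / q%:R.
Proof.
move=> q0 qn; have A0 : 0 <= 2 * n%:R / q%:R :> R by rewrite divr_ge0 // mulr_ge0.
apply: bigRmax_le => // y _; apply: bigRmax_le => // a _.
rewrite RabsE /liouville_AP_sum; apply: le_trans (ler_norm_sum _ _ _) _.
apply: le_trans (class_sum_le a q0 qn).
under eq_bigr => i _ do rewrite liouville_norm.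
have yn : (y < n.+1)%N by [].
rewrite /class_sum [leRHS](@big_cat_nat _ _ _ y.+1) //=.
by rewrite lerDl; apply: sumr_ge0.
Qed.

Section Level.
Variables (D0 N W k n : nat) (L : R).
Hypothesis L_gt0 : 0 < L.
Hypothesis W_gt0 : (0 < W)%N.
Hypothesis W_small : forall q, prime q -> (q %| W)%N -> (q <= D0)%N.
Hypothesis k_gt0 : (0 < k)%N.
Hypothesis D0_gt0 : (0 < D0)%N.
Hypothesis ln1n : 1 <= ln n%:R.
Local Notation T := (primeT D0 N).
Local Notation ell := (@ell D0 N L).
Implicit Types (U D E : {set T}).

Lemma pr_pv1 U : (dv U)%:R / 2 ^+ #|U| <= pr (fun p => (pv p)%:R - 1) U :> R.
Proof.
have -> : (dv U)%:R / 2 ^+ #|U| = pr (fun p => (pv p)%:R / 2) U :> R.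
  by rewrite prM pr_const exprVn /dv natr_prod.
apply: ler_pr => p; rewrite divr_ge0 //=.
have : 2 <= (pv p)%:R :> R by rewrite (ler_nat R 2) prime_gt1 // pv_prime.
lra.
Qed.

Lemma EA_modulus U : (modulus W U <= n)%N ->
  EA n (modulus W U) <= 3 * n%:R * ln n%:R * (2 ^+ #|U| / (dv U)%:R).
Proof.
move=> qn; have q0 := modulus_gt0 W_gt0 U.
apply: le_trans (EA_trivial q0 qn) _.
have d0 : 0 < (dv U)%:R :> R by rewrite ltr0n dv_gt0.
have p0 : 1 <= 2 ^+ #|U| :> R by rewrite exprn_ege1 // ler1n.
have n0 : 0 <= n%:R :> R by [].
have A : 2 * n%:R / (modulus W U)%:R * ln n%:R <= 2 * n%:R * ln n%:R * (2 ^+ #|U| / (dv U)%:R) :> R.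
  rewrite mulrAC ler_wpM2l ?mulr_ge0 //; first exact: le_trans ln1n.
  rewrite ler_pdivlMr // mulrC; apply: le_trans p0.
  by rewrite ler_pdivrMr ?ltr0n // mul1r ler_nat leq_pmull.
have B : n%:R / (totient (modulus W U))%:R <= n%:R * ln n%:R * (2 ^+ #|U| / (dv U)%:R) :> R.
  rewrite -mulrA ler_wpM2l //.
  have pp := pr_pv1 U; have tW : 1 <= (totient W)%:R :> R by rewrite ler1n totient_gt0.
  have q0' : 0 < (dv U)%:R / 2 ^+ #|U| :> R by rewrite divr_gt0 // (lt_le_trans ltr01).
  rewrite totient_modulus //.
  apply: (@le_trans _ _ (2 ^+ #|U| / (dv U)%:R)).
    rewrite -[leRHS]invrK invf_div lef_pV2 ?posrE //; last first.
      exact: mulr_gt0 (lt_le_trans ltr01 tW) (lt_le_trans q0' pp).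
    apply: le_trans pp _; apply: ler_peMl => //; exact: le_trans (ltW q0') (pr_pv1 U).
  by rewrite ler_peMl // divr_ge0 // (le_trans ler01).
have := lerD A B; congr (_ <= _); ring.
Qed.

Lemma EB_modulus U : (modulus W U <= n)%N ->
  EB n (modulus W U) <= 3 * n%:R * ln n%:R * (2 ^+ #|U| / (dv U)%:R).
Proof.
move=> qn; have q0 := modulus_gt0 W_gt0 U.
apply: le_trans (EB_trivial q0 qn) _.
have d0 : 0 < (dv U)%:R :> R by rewrite ltr0n dv_gt0.
have p0 : 1 <= 2 ^+ #|U| :> R by rewrite exprn_ege1 // ler1n.
apply: (@le_trans _ _ (3 * n%:R * ln n%:R * ((modulus W U)%:R)^-1)).
  rewrite ler_wpM2r ?invr_ge0 //; have := ler0n R n; move: ln1n; nra.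
rewrite ler_wpM2l ?mulr_ge0 //; first by apply: le_trans ln1n; lra.
rewrite ler_pdivlMr // mulrC; apply: le_trans p0.
by rewrite ler_pdivrMr ?ltr0n // mul1r ler_nat leq_pmull.
Qed.

Lemma error_level (Er : nat -> R) (y S0 B : R) : 0 < B -> (forall q, 0 <= Er q) ->
  (forall U, (modulus W U <= n)%N -> Er (modulus W U) <= 3 * n%:R * ln n%:R * (2 ^+ #|U| / (dv U)%:R)) ->
  W%:R * exp (2 * L) <= y -> y <= n%:R ->
  \sum_(1 <= q < n.+1 | Rleb (INR q) y) Er q <= S0 ->
  \sum_(D : {set T} | len ell D <= 1) \sum_(E : {set T} | len ell E <= 1)
     k%:R ^+ #|D :|: E| * Er (modulus W (D :|: E))
  <= B * S0 + B^-1 * (3 * n%:R * ln n%:R * (1 + 2 * L) ^+ (32 * k ^ 2)).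
Proof.
move=> B0 E0 Et Wy yn ES.
pose e U := Er (modulus W U); have e0 U : 0 <= e U by exact: E0.
apply: le_trans (error_sum_union k L_gt0 e0) _.
apply: le_trans (error_sum_split L _ B0 e0) _.
apply: lerD; first by rewrite ler_wpM2l ?(ltW B0) // (le_trans (sum_moduli _ _ L_gt0 W_gt0 E0 Wy yn)).
rewrite ler_wpM2l ?invr_ge0 ?(ltW B0) //.
apply: le_trans (ler_wpM2l _ (divisor_sum_bound N L_gt0 W_gt0 W_small (32 * k ^ 2))); last first.
  by rewrite !mulr_ge0 //; apply: le_trans ln1n.
rewrite mulr_sumr; apply: ler_sum => U hU.
have qn : (modulus W U <= n)%N.
  rewrite -(ler_nat R); apply: le_trans yn; apply: le_trans Wy; rewrite natrM ler_wpM2l //.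
  move: hU; rewrite (len_ell_le L_gt0) => hU.
  apply: le_trans (_ : (Num.truncn (exp (2 * L)))%:R <= _); first by rewrite ler_nat.
  by rewrite truncn_le ltW // exp_gt0.
apply: le_trans (ler_wpM2l _ (Et U qn)) _; first by rewrite exprn_ge0 // sqr_ge0.
apply: le_of_eq.
(* The square of [4 * k] comes from the split, the factor [2] from the trivial bound for one
   modulus. *)
have -> : (32 * k ^ 2)%:R = (4 * k)%:R ^+ 2 * 2 :> R by rewrite -natrX -natrM; congr (_%:R); nia.
rewrite [in RHS](exprMn _ (_ ^+ 2)); move: (((4 * k)%:R ^+ 2) ^+ #|U| : R) (2 ^+ #|U| : R) => a b; ring.
Qed.

End Level.

(** * Weighted sums over [n] *)

Import Order.TTheory GRing.Theory Num.Theory.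

Section Sieve.
Variables (D0 N W v K m s : nat) (H : seq nat) (L Lip : R) (P : R -> R).
Local Notation k := (K.+2).
Hypothesis L_gt0 : 0 < L.
Hypothesis LN : exp L <= N%:R.
Hypothesis W_gt0 : (0 < W)%N.
Hypothesis W_dvd : forall q, prime q -> (q <= D0)%N -> (q %| W)%N.
Hypothesis W_small : forall q, prime q -> (q %| W)%N -> (q <= D0)%N.
Hypothesis H_uniq : uniq H.
Hypothesis H_size : size H = k.
Hypothesis H_le : forall h, h \in H -> (h <= D0)%N.
Hypothesis v_coprime : forall h, h \in H -> coprime (v + h) W.
Hypothesis kD : (4 * k <= D0)%N.
Hypothesis m_gt0 : (0 < m)%N.
Hypothesis s_gt0 : (0 < s)%N.
Hypothesis ksD : (k ^ s <= D0)%N.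
Hypothesis P_ge0 : forall x, 0 <= P x.
Hypothesis P_mono : forall r x, r <= x -> P x <= P r.
Hypothesis P_vanish : forall x, 1 <= x -> P x = 0.
Hypothesis P_lip : forall r x, r <= x -> P r - P x <= Lip * (x - r).
Local Notation T := (primeT D0 N).
Local Notation ell := (@ell D0 N L).
Local Notation xv := (fun p : T => (pv p)%:R : R).
Local Notation coef := (@coef R T xv ell K P).
Local Notation wgt := (@wgt R T xv K).
Local Notation dens := (@dens R T xv K).
Local Notation quad := (quad_form dens wgt (fun S => P (len ell S))).
Local Notation Res := (@Res D0 N W v H).
Implicit Types (U D E : {set T}) (n : nat).

Let ell0 p : 0 <= ell p. Proof. exact: ell_ge0. Qed.
Let xv_gt (p : T) : k%:R < xv p.
Proof.
rewrite ltr_nat; apply: leq_ltn_trans (pv_gt p); apply: leq_trans kD.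
exact: leq_pmull.
Qed.

Definition mass : R := cumul ell wgt 1.
Definition coef_max : R := P 0 * mass.
Definition delta : R := (totient W)%:R / W%:R.
(** [c_up] and [c_low] bound the one-dimensional mass of a grid cell; both are close to
    [delta * L / m] when [L] and [D0] are large. *)
Definition c_up : R := (1 - (2 * k)%:R / D0%:R)^-1 * (delta * L / m%:R + W%:R + 1).
Definition c_low : R := delta * (L / m%:R - ln W%:R).
Definition e_triv : R := exp (2 * L * (1 + (s%:R)^-1)).

Let wgt0 p : 0 <= wgt p.
Proof. by rewrite /weight_def divr_ge0 // subr_ge0 ltW. Qed.

Lemma mass_ge0 : 0 <= mass. Proof. exact: cumul_ge0. Qed.
Lemma coef_max_ge0 : 0 <= coef_max. Proof. by rewrite mulr_ge0 // mass_ge0. Qed.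

Let E_ge0 : 0 <= (1 - (2 * k)%:R / D0%:R)^-1 :> R.
Proof.
have D00 : 0 < D0%:R :> R by rewrite ltr0n; apply: leq_trans kD.
by rewrite invr_ge0 subr_ge0 ler_pdivrMr // mul1r ler_nat (leq_trans _ kD) // leq_mul2r orbT.
Qed.

Let dl0 : 0 <= delta. Proof. by rewrite divr_ge0. Qed.

Let c_up_ge0 : 0 <= c_up.
Proof. by rewrite mulr_ge0 // !addr_ge0 // divr_ge0 // mulr_ge0 // ltW. Qed.

Let Hup i : (i <= m)%N ->
  cumul ell (fun p => (xv p - k%:R)^-1) (i%:R / m%:R) <= c_up * (i.+1)%:R.
Proof.
move=> im; have m0 : 0 < m%:R :> R by rewrite ltr0n.
have t0 : 0 <= i%:R / m%:R :> R by rewrite divr_ge0.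
apply: le_trans (cumul_prime_upper L_gt0 LN W_gt0 W_small _ kD t0) _ => //.
rewrite /c_up -[leRHS]mulrA ler_wpM2l // -/delta -natr1.
have dL : 0 <= delta * L / m%:R by rewrite divr_ge0 // mulr_ge0 // ltW.
have -> : delta * (i%:R / m%:R * L) = i%:R * (delta * L / m%:R) by ring.
have i0 : 0 <= i%:R :> R by [].
have W0 : 0 <= W%:R :> R by [].
move: dL i0 W0; move: (delta * L / m%:R) (i%:R : R) (W%:R : R) => a b c a0 b0 c0; nra.
Qed.

Lemma mass_upper : mass <= c_up ^+ k * 'C(m + k.*2, k)%:R.
Proof.
have := cumul_wgt_upper ell0 xv_gt m_gt0 c_up_ge0 Hup (leqnn m).
by rewrite /= divff // pnatr_eq0 -lt0n.
Qed.

Definition SC (C : {set T} -> R) : R :=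
  \sum_(D : {set T}) \sum_(E : {set T}) coef D * coef E * C (D :|: E).

(** Every average reduces to this: the density [g] produces the quadratic form, and the errors are
    summed over the support of the coefficients with [coef_max] as the only bound. *)
Lemma SC_approx (C Err : {set T} -> R) (X : R) (g : T -> R) :
  (forall U, `|C U - X * pr g U| <= Err U) ->
  `|SC C - X * quad g| <= coef_max ^+ 2 *
     \sum_(D : {set T} | len ell D <= 1) \sum_(E : {set T} | len ell E <= 1) Err (D :|: E).
Proof.
move=> HC; have cs D : ~~ (len ell D <= 1) -> coef D = 0.
  by rewrite -ltNge => h; exact: coef_supp.
have cb D : `|coef D| <= coef_max by exact: (coef_bound ell0 xv_gt P_ge0 P_mono P_vanish D).
rewrite /SC /quad_form mulr_sumr -sumrB; apply: le_trans (ler_norm_sum _ _ _) _.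
rewrite mulr_sumr [leRHS]big_mkcond; apply: ler_sum => D _.
rewrite mulr_sumr -sumrB; case: ifP => [_|/negbT/cs c0]; last first.
  rewrite big1 ?normr0 // => E _; rewrite -/(coef D) c0; ring.
apply: le_trans (ler_norm_sum _ _ _) _.
rewrite mulr_sumr [leRHS]big_mkcond; apply: ler_sum => E _.
rewrite -/(coef D) -/(coef E).
have -> : coef D * coef E * C (D :|: E) - X * (coef D * coef E * pr g (D :|: E)) =
  coef D * coef E * (C (D :|: E) - X * pr g (D :|: E)) by ring.
case: ifP => [_|/negbT/cs cE]; last by rewrite cE mulr0 mul0r normr0.
rewrite (normrM (coef D * coef E)) (normrM (coef D)).
by rewrite expr2 !ler_pM ?mulr_ge0.
Qed.

Definition weight n : R := (\sum_(D : {set T} | hits H D n) coef D) ^+ 2.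

Definition Ssum (f : nat -> R) : R :=
  \sum_(1 <= n < N.+1 | (n %% W == v %% W)%N) f n * weight n.

Lemma hitsU D E n : hits H (D :|: E) n = hits H D n && hits H E n.
Proof.
apply/forall_inP/andP => [h|[/forall_inP hD /forall_inP hE] p].
  by split; apply/forall_inP => p pD; apply: h; rewrite inE pD ?orbT.
by rewrite inE => /orP[/hD|/hE].
Qed.

Lemma Ssum_expand f : Ssum f = SC (fun U => \sum_(1 <= n < N.+1 | Res U n) f n).
Proof.
rewrite /Ssum /SC.
have -> : \sum_(1 <= n < N.+1 | (n %% W == v %% W)%N) f n * weight n =
  \sum_(1 <= n < N.+1) \sum_(D : {set T}) \sum_(E : {set T})
     (if Res (D :|: E) n then coef D * coef E * f n else 0).
  rewrite big_mkcond; apply: eq_bigr => n _; rewrite /residue_def.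
  case: ifP => nW /=; last by rewrite big1 // => D _; rewrite big1.
  rewrite /weight expr2 mulr_suml mulr_sumr big_mkcond; apply: eq_bigr => D _.
  case: ifP => hD; last by rewrite big1 // => E _; rewrite hitsU hD.
  rewrite !mulr_sumr big_mkcond; apply: eq_bigr => E _.
  by rewrite hitsU hD /=; case: ifP => // _; ring.
rewrite exchange_big /=; apply: eq_bigr => D _.
rewrite exchange_big /=; apply: eq_bigr => E _.
rewrite mulr_sumr [RHS]big_mkcond; apply: eq_bigr => n _; by case: ifP.
Qed.

Lemma e_triv_bound :
  \sum_(D : {set T} | len ell D <= 1) \sum_(E : {set T} | len ell E <= 1) k%:R ^+ #|D :|: E| <= e_triv.
Proof. by apply: error_sum_trivial. Qed.

Lemma Ssum_one : Ssum (fun=> 1) <=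
  N%:R / W%:R * (c_up ^+ k * @upper_const R K m P) + coef_max ^+ 2 * e_triv.
Proof.
rewrite Ssum_expand.
have HC U : `|\sum_(1 <= n < N.+1 | Res U n) 1 - N%:R / W%:R * pr dens U| <= k%:R ^+ #|U| :> R.
  by have := sum_Res_one v W_gt0 W_small H_uniq H_le N U; rewrite H_size.
have := SC_approx HC; rewrite ler_norml => /andP[_]; rewrite lerBlDl => h.
apply: le_trans h _; apply: lerD.
  rewrite ler_wpM2l ?divr_ge0 //.
  exact: (quad_form_dens_upper ell0 xv_gt m_gt0 P_ge0 P_mono P_vanish c_up_ge0 Hup).
by rewrite ler_wpM2l ?sqr_ge0 // e_triv_bound.
Qed.

Lemma Ssum_prime h0 (eA : R) : h0 \in H -> 0 <= c_low -> (0 < N)%N ->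
  \sum_(D : {set T} | len ell D <= 1) \sum_(E : {set T} | len ell E <= 1)
     k%:R ^+ #|D :|: E| * EA (N + h0) (modulus W (D :|: E)) <= eA ->
  (N + h0)%:R / (totient W)%:R * (c_low ^+ k.+1 * @lower_const R K m P)
    - coef_max ^+ 2 * (eA + ln (N + h0)%:R * e_triv) <= Ssum (log_prime h0).
Proof.
move=> h0H cl0 N0 HA; rewrite Ssum_expand.
have ln0 : 0 <= ln (N + h0)%:R by rewrite ln_ge0 // ler1n addn_gt0 N0.
have HC U : `|\sum_(1 <= n < N.+1 | Res U n) log_prime h0 n -
    (N + h0)%:R / (totient W)%:R * pr (@dens_prime R T xv K) U|
  <= k%:R ^+ #|U| * EA (N + h0) (modulus W U) + k%:R ^+ #|U| * ln (N + h0)%:R :> R.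
  have := sum_Res_prime W_gt0 W_dvd W_small H_uniq H_le v_coprime U h0H N0.
  by rewrite H_size /= mulrDr.
have := SC_approx HC; rewrite ler_norml => /andP[+ _]; rewrite lerBrDl => h.
apply: le_trans h; apply: lerD.
  rewrite ler_wpM2l ?divr_ge0 //.
  apply: (quad_form_prime_lower ell0 xv_gt m_gt0 P_ge0 P_mono cl0) => i im.
  have m0 : 0 < m%:R :> R by rewrite ltr0n.
  have t1 : i%:R / m%:R <= 1 :> R by rewrite ler_pdivrMr // mul1r ler_nat.
  case: i im t1 => [|i] im t1.
    rewrite mulr0; apply: cumul_ge0 => p; rewrite invr_ge0 subr_ge0 ler1n pv_gt0 //.
  apply: le_trans (cumul_prime_lower L_gt0 LN W_gt0 W_dvd t1).
  rewrite /c_low -/delta -mulrA ler_wpM2l //.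
  have lW : 0 <= ln W%:R by rewrite ln_ge0 // ler1n.
  have -> : i.+1%:R / m%:R * L = i.+1%:R * (L / m%:R) by ring.
  have i1 : 1 <= i.+1%:R :> R by rewrite ler1n.
  move: i1 lW; move: (i.+1%:R : R) (L / m%:R) (ln W%:R) => a b c a1 c0; nra.
rewrite lerN2 ler_wpM2l ?sqr_ge0 //.
under eq_bigr => D _ do rewrite big_split /=.
rewrite big_split /= lerD //.
apply: le_trans (ler_wpM2l ln0 e_triv_bound); rewrite mulr_sumr; apply: ler_sum => D _.
by rewrite mulr_sumr; apply: ler_sum => E _; rewrite mulrC.
Qed.

Lemma Ssum_liouville h0 (eB : R) : h0 \in H ->
  \sum_(D : {set T} | len ell D <= 1) \sum_(E : {set T} | len ell E <= 1)
     k%:R ^+ #|D :|: E| * EB (N + h0) (modulus W (D :|: E)) <= eB ->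
  `|Ssum (fun n => liouville (n + h0))| <= coef_max ^+ 2 * (2 * eB).
Proof.
move=> h0H HB; rewrite Ssum_expand.
(* The main term is zero, so [X = 0] is taken with a dummy density. *)
have HC U : `|\sum_(1 <= n < N.+1 | Res U n) liouville (n + h0) - 0 * pr (fun=> 1) U|
  <= 2 * (k%:R ^+ #|U| * EB (N + h0) (modulus W U)).
  have := sum_Res_liouville v W_gt0 W_small H_uniq H_le N U h0H.
  by rewrite H_size mul0r subr0 mulrCA.
have := SC_approx HC; rewrite mul0r subr0 => h; apply: le_trans h _.
rewrite ler_wpM2l ?sqr_ge0 //; apply: le_trans (ler_wpM2l _ HB) => //.
by rewrite mulr_sumr; apply: ler_sum => D _; rewrite mulr_sumr.
Qed.

Definition bad (c : R) n : bool := [exists p : T, (ell p <= c) && hit H (pv p) n].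

(** Union bound over the small primes. Imposing a hit at [p] extracts the factor [dens p] and leaves
    [dens_at p] as density, so [quad_form_at] gives a term with [ell p ^+ 2 / p]. The error terms
    are multiplied by the number of such primes, at most [exp (c * L)]. *)
Lemma Ssum_bad (c Ch : R) : 0 <= c ->
  \sum_(p : T | ell p <= c) ell p ^+ 2 / (pv p)%:R <= Ch ->
  Ssum (fun n => (bad c n)%:R) <=
  N%:R / W%:R * (k%:R * Lip ^+ 2 * mass * Ch) + exp (c * L) * (k%:R * coef_max ^+ 2 * e_triv).
Proof.
move=> c0 HCh.
have w0 n : 0 <= weight n by exact: sqr_ge0.
apply: (@le_trans _ _ (\sum_(p : T | ell p <= c) Ssum (fun n => (hit H (pv p) n)%:R))).
  rewrite /Ssum exchange_big /=; apply: ler_sum => n _; rewrite -mulr_suml ler_wpM2r //.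
  rewrite /bad; case: existsP => [[p /andP[pc hp]]|_]; last by apply: sumr_ge0.
  by rewrite (bigD1 p) //= hp lerDl; apply: sumr_ge0.
have one p : Ssum (fun n => (hit H (pv p) n)%:R) <=
   N%:R / W%:R * (k%:R * Lip ^+ 2 * mass * (ell p ^+ 2 / (pv p)%:R)) + k%:R * coef_max ^+ 2 * e_triv.
  rewrite Ssum_expand.
  have CE U : \sum_(1 <= n < N.+1 | Res U n) (hit H (pv p) n)%:R =
     \sum_(1 <= n < N.+1 | Res (p |: U) n) (1 : R).
    rewrite big_mkcond [RHS]big_mkcond; apply: eq_bigr => n _; rewrite /residue_def.
    have -> : hits H (p |: U) n = hit H (pv p) n && hits H U n.
      rewrite hitsU; congr (_ && _); apply/forall_inP/idP => [->|hp q]; rewrite ?inE //.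
      by move/eqP->.
    by case: (_ == _) => //=; case: (hit _ _ _); case: (hits _ _ _).
  have HC U : `|\sum_(1 <= n < N.+1 | Res U n) (hit H (pv p) n)%:R -
      N%:R / W%:R * dens p * pr (@dens_at R T xv K p) U| <= k%:R * k%:R ^+ #|U| :> R.
    have -> : N%:R / W%:R * dens p * pr (@dens_at R T xv K p) U = N%:R / W%:R * pr dens (p |: U).
      rewrite -mulrA; congr (_ * _); have [pU|pU] := boolP (p \in U).
        rewrite (setUidPr _) ?sub1set // /pr (bigD1 p) //= [in RHS](bigD1 p) //= /dens_at eqxx mul1r.
        by congr (_ * _); apply: eq_bigr => q /andP[_ /negbTE ->].
      rewrite /pr big_setU1 //=; congr (_ * _); apply: eq_bigr => q qU; rewrite /dens_at.
      by case: eqP qU pU => // -> ->.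
    rewrite CE; have := sum_Res_one v W_gt0 W_small H_uniq H_le N (p |: U); rewrite H_size => h.
    apply: le_trans h _; rewrite -exprS ler_weXn2l ?ler1n //.
    by rewrite cardsU1; case: (p \notin U).
  have := SC_approx HC; rewrite ler_norml => /andP[_]; rewrite lerBlDl => h.
  apply: le_trans h _; apply: lerD.
    have X0 : 0 <= N%:R / W%:R * dens p.
      by rewrite !mulr_ge0 ?invr_ge0.
    apply: le_trans (ler_wpM2l X0 (quad_form_at ell0 xv_gt P_mono P_vanish P_lip p)) _.
    by rewrite -/mass /density_def; apply: le_of_eq; ring.
  rewrite -mulrA mulrCA ler_wpM2l ?sqr_ge0 //.
  apply: le_trans (ler_wpM2l _ e_triv_bound) => //.
  by rewrite mulr_sumr; apply: ler_sum => D _; rewrite mulr_sumr.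
apply: le_trans (ler_sum _ (fun p _ => one p)) _.
rewrite big_split /= -mulr_sumr -mulr_sumr; apply: lerD.
  by rewrite ler_wpM2l ?divr_ge0 // ler_wpM2l // mulr_ge0 ?mass_ge0 // mulr_ge0 // sqr_ge0.
set z := k%:R * coef_max ^+ 2 * e_triv.
have z0 : 0 <= z.
  by apply: mulr_ge0; [apply: mulr_ge0 => //; exact: sqr_ge0 | exact: ltW (exp_gt0 _)].
rewrite (eq_bigr (fun=> 1 * z)) => [|p _]; last by rewrite mul1r.
rewrite -mulr_suml ler_wpM2r //.
apply: le_trans (count_sets _ _ L_gt0 c0).
apply: (@le_trans _ _ (\sum_(p : T | ell p <= c) (fun=> 1) [set p])) => //.
apply: (@ler_sum_inj R _ _ _ _ (fun p : T => [set p]) (fun=> 1)) => //.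
- by move=> p q _ _ /set1_inj.
- by move=> p pc; rewrite /len big_set1.
Qed.

End Sieve.

(** * Bounds of Chebyshev and Mertens type, the test function, admissible tuples *)

Import Order.TTheory GRing.Theory Num.Theory.

Lemma ln2_ge : 2^-1 <= ln (2 : R).
Proof.
have h : ln (2^-1 : R) <= 2^-1 - 1 by apply: ln_sub1; lra.
by move: h; rewrite lnV; lra.
Qed.

Lemma Rpower_exp (x y : R) : Rpower x y = exp (y * ln x).
Proof. by []. Qed.

(** The term [q = 1] of condition (A) bounds the sum of logarithms of primes by a multiple of
    [n]. *)
Lemma chebyshev (theta : R) : 0 < theta -> condA theta ->
  exists2 C : R, 0 <= C & forall n, \sum_(p < n.+1 | prime p) ln p%:R <= C * n%:R.
Proof.
move=> th0 HA.
have e0 : Rlt (0 : R)%R (theta / 2)%R by apply/RltP; lra.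
have A0 : Rlt (0 : R)%R (1 : R)%R by apply/RltP; exact: ltr01.
have [K HK] := HA _ _ e0 A0.
have ln2 := ln2_ge; exists (1 + `|K| * 2); first by have := normr_ge0 K; lra.
case=> [|[|n]].
- by rewrite big1 ?mulr0 // => -[[]].
- by rewrite big1 ?mulr1 => [|[[|[|]]]] //; have := normr_ge0 K; lra.
set N := n.+2; have N0 : 0 < N%:R :> R by rewrite ltr0n.
have lnN : 2^-1 <= ln N%:R by apply: le_trans ln2 _; rewrite ler_ln // (ler_nat R 2).
have /RleP := HK N isT; rewrite RmultE RdivE !INRE => h.
have h1 : EA N 1 <= K * (N%:R / Rpower (ln N%:R) 1).
  apply: le_trans h; rewrite big_ltn_cond //.
  case: ifP => [_|]; first by rewrite lerDl; apply: sumr_ge0 => q _; exact: bigRmax_ge0.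
  rewrite /Rleb; case: Rle_dec => // -[]; apply/RleP; rewrite ?INRE Rpower_exp.
  rewrite -[leLHS](lnK ltr01) ln1 ler_exp // mulr_ge0 ?ln_ge0 ?ler1n //.
  by rewrite RminusE; lra.
have := EA_bound N (ltnSn 0) (coprimen1 0); rewrite /prime_AP_error RminusE RdivE !INRE.
rewrite (eq_bigl (fun p : 'I_N.+1 => prime p)) => [|p]; last by rewrite !modn1 eqxx andbT.
rewrite (eq_bigr (fun p : 'I_N.+1 => ln p%:R)) => [|p _]; last by rewrite INRE.
rewrite divr1 ler_norml => /andP[_ h2].
have h3 : K * (N%:R / Rpower (ln N%:R) 1) <= `|K| * 2 * N%:R.
  rewrite Rpower_1; last by apply/RltP; apply: lt_le_trans lnN; rewrite ?R0E; lra.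
  have l0 : 0 < ln N%:R by apply: lt_le_trans lnN; lra.
  have X0 : 0 <= N%:R / ln N%:R by rewrite divr_ge0 // ltW.
  apply: le_trans (ler_wpM2r X0 (ler_norm K)) _; rewrite -mulrA ler_wpM2l //.
  by rewrite ler_pdivrMr //; nra.
by rewrite mulrDl mul1r; lra.
Qed.

(** Dyadic decomposition: on each block [1 / p] is at most the reciprocal of its left end, so
    Chebyshev's bound gives a constant per block. *)
Lemma mertens_upper (theta : R) : 0 < theta -> condA theta ->
  exists2 C : R, 0 <= C & forall X, (0 < X)%N ->
    \sum_(p < X.+1 | prime p) ln p%:R / p%:R <= C * (ln X%:R + 1).
Proof.
move=> th0 HA; have [C C0 HC] := chebyshev th0 HA.
have tp (p : nat) : prime p -> 0 <= ln p%:R :> R by move=> pp; rewrite ln_ge0 // ler1n prime_gt0.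
have dy i : \sum_(p < (2 ^ i).+1 | prime p) ln p%:R / p%:R <= 2 * C * i%:R.
  elim: i => [|i IH].
    rewrite mulr0 big1 // => p pp; have := ltn_ord p; have := prime_gt1 pp; lia.
  rewrite -(big_mkord (fun p => prime p) (fun p => ln p%:R / p%:R)).
  rewrite (@big_cat_nat _ _ _ (2 ^ i).+1) //=; last by rewrite ltnS leq_exp2l.
  rewrite big_mkord -[i.+1%:R]natr1 mulrDr mulr1 lerD //.
  have q0 : 0 < (2 ^ i)%:R :> R by rewrite ltr0n expn_gt0.
  apply: (@le_trans _ _ ((\sum_(p < (2 ^ i.+1).+1 | prime p) ln p%:R) / (2 ^ i)%:R)); last first.
    rewrite ler_pdivrMr //; apply: le_trans (HC _) _; rewrite expnS natrM.
    by rewrite mulrCA mulrA.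
  rewrite -(big_mkord (fun p => prime p) (fun p => ln p%:R)) mulr_suml.
  rewrite [leRHS](@big_cat_nat _ _ _ (2 ^ i).+1) //=; last by rewrite ltnS leq_exp2l.
  rewrite -[leLHS]add0r; apply: lerD.
    by apply: sumr_ge0 => p pp; rewrite divr_ge0 // tp.
  rewrite big_nat_cond [leRHS]big_nat_cond; apply: ler_sum => p /andP[/andP[ip _] pp].
  have p0 : 0 < p%:R :> R by rewrite ltr0n prime_gt0.
  by rewrite ler_wpM2l ?tp // lef_pV2 ?posrE // ler_nat ltnW.
exists (4 * C) => [|X X0]; first by rewrite mulr_ge0.
set i := trunc_log 2 X.
have X2 : (X < 2 ^ i.+1)%N by rewrite trunc_log_ltn.
have iX : i%:R <= 2 * ln X%:R :> R.
  have : (2 ^ i <= X)%N by rewrite trunc_logP.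
  have ln2 := ln2_ge.
  rewrite -(ler_nat R) natrX => h; have := ler_ln (exprn_gt0 i (ltr0Sn R 1)) h.
  rewrite lnX // => h2; have := ler0n R i; nra.
apply: (@le_trans _ _ (2 * C * i.+1%:R)).
  apply: le_trans (dy i.+1); rewrite -(big_mkord (fun p => prime p) (fun p => ln p%:R / p%:R)).
  rewrite -(big_mkord (fun p => prime p) (fun p => ln p%:R / p%:R)).
  rewrite [leRHS](@big_cat_nat _ _ _ X.+1) //= ?lerDl //; last by rewrite ltnS ltnW.
  by apply: sumr_ge0 => p pp; rewrite divr_ge0 // tp.
rewrite -natr1; nra.
Qed.

(** One factor [ell p] is at most [c] and the other is summed by Mertens; the result is a constant
    times [c * (c + 1 / L)], small with [c]. *)
Lemma small_prime_sum (D0 N : nat) (L c C : R) : 0 < L -> 0 <= c -> 0 <= C ->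
  (forall X, (0 < X)%N -> \sum_(p < X.+1 | prime p) ln p%:R / p%:R <= C * (ln X%:R + 1)) ->
  \sum_(p : primeT D0 N | ell L p <= c) ell L p ^+ 2 / (pv p)%:R <= c / L * (C * (c * L + 1)).
Proof.
move=> L0 c0 C0 HC.
set X := Num.truncn (exp (c * L)).
have cL : 0 <= c * L by rewrite mulr_ge0 // ltW.
have X0 : (0 < X)%N by rewrite truncn_gt0 -[X in X <= _](lnK ltr01) ler_exp // ln1.
have XL : ln X%:R <= c * L.
  by rewrite -[leRHS]expK ler_ln ?ltr0n // truncn_le ltW // exp_gt0.
apply: (@le_trans _ _ (c / L * \sum_(p : primeT D0 N | ell L p <= c) ln (pv p)%:R / (pv p)%:R)).
  rewrite mulr_sumr; apply: ler_sum => p pc.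
  have e0 : 0 <= ell L p by rewrite ell_ge0.
  rewrite mulrA ler_wpM2r ?invr_ge0 // -mulrA [L^-1 * _]mulrC -/(ell L p) expr2.
  by rewrite ler_wpM2r.
rewrite ler_wpM2l ?divr_ge0 ?(ltW L0) //.
apply: le_trans (_ : C * (ln X%:R + 1) <= _); last by rewrite ler_wpM2l // lerD2r.
apply: le_trans (HC X X0).
have pX (p : primeT D0 N) : ell L p <= c -> (pv p < X.+1)%N.
  rewrite /ell ler_pdivrMr // => h; rewrite ltnS truncn_ge_nat ?(ltW (exp_gt0 _)) //.
  by rewrite -(@lnK (pv p)%:R) ?ltr0n ?pv_gt0 // ler_exp.
rewrite (eq_bigr (fun p => ln (inord (pv p) : 'I_X.+1)%:R / (inord (pv p) : 'I_X.+1)%:R)); last first.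
  by move=> p pc; rewrite inordK // pX.
have -> : \sum_(p < X.+1 | prime p) ln p%:R / p%:R = \sum_(p < X.+1 | prime p) `|ln p%:R / p%:R| :> R.
  apply: eq_bigr => p pp; rewrite ger0_norm // divr_ge0 // ln_ge0 // ler1n prime_gt0 //.
rewrite (eq_bigr (fun p => `|ln (inord (pv p) : 'I_X.+1)%:R / (inord (pv p) : 'I_X.+1)%:R|)); last first.
  by move=> p pc; rewrite inordK ?pX // ger0_norm // divr_ge0 // ln_ge0 // ler1n pv_gt0.
apply: (@ler_sum_inj R _ _ _ _ (fun p => (inord (pv p) : 'I_X.+1)) (fun p => `|ln (nat_of_ord p)%:R / (nat_of_ord p)%:R|)) => //.
- move=> p q pc qc /(congr1 val) /=; rewrite !inordK ?pX //; exact: pv_inj.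
- by move=> p pc; rewrite inordK ?pX // pv_prime.
Qed.

Section TestFunction.
Variables (a b c : R) (m : nat).
Hypotheses (a0 : 0 <= a) (b0 : 0 <= b) (c0 : 0 <= c) (m_gt0 : (0 < m)%N).

(* The argument [u = 1 - t] is clamped to [0, 1]; the last factor makes the function Lipschitz
   while changing its values at the grid points [j / m] only for [j = m]. *)
Definition test_fun (t : R) : R :=
  let u := Num.min 1 (Num.max 0 (1 - t)) in (a + b * u + c * u ^+ 2) * Num.min 1 (m%:R * u).

Let U t : R := Num.min 1 (Num.max 0 (1 - t)).
Let Ub t : 0 <= U t <= 1.
Proof. by rewrite /U le_min ge_min lexx ler01 le_max lexx. Qed.
Let Umono r t : r <= t -> U t <= U r <= U t + (t - r).
Proof. by rewrite /U !minEle !maxEle; do !case: ifP; move=> *; lra. Qed.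
Let V u : R := Num.min 1 (m%:R * u).
Let Vb u : 0 <= u -> 0 <= V u <= 1.
Proof. by move=> u0; rewrite /V le_min ge_min lexx ler01 mulr_ge0. Qed.
Let Vmono u w : 0 <= u -> u <= w -> V u <= V w <= V u + m%:R * (w - u).
Proof.
move=> u0 uw; have m0 : 0 <= m%:R :> R by []; have : m%:R * u <= m%:R * w by rewrite ler_wpM2l.
by rewrite /V mulrBr !minEle; do !case: ifP; move=> *; lra.
Qed.

Lemma test_fun_ge0 t : 0 <= test_fun t.
Proof.
rewrite /test_fun -/(U t); have /andP[u0 _] := Ub t; have /andP[v0 _] := Vb u0.
by rewrite mulr_ge0 // !addr_ge0 // mulr_ge0 // sqr_ge0.
Qed.

Lemma test_fun_vanish t : 1 <= t -> test_fun t = 0.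
Proof.
move=> t1; rewrite /test_fun (_ : Num.max 0 (1 - t) = 0); last by apply/max_idPl; lra.
have e : Num.min 1 0 = 0 :> R by apply/min_idPr.
by rewrite e (mulr0 m%:R) e mulr0.
Qed.

Lemma test_fun_lip r t : r <= t ->
  0 <= test_fun r - test_fun t <= (b + 2 * c + (a + b + c) * m%:R) * (t - r).
Proof.
move=> rt; rewrite /test_fun -/(U t) -/(U r) -/(V (U t)) -/(V (U r)).
have /andP[u0 u1] := Ub t; have /andP[w0 w1] := Ub r; have /andP[uw wu] := Umono rt.
have /andP[v0 v1] := Vb u0; have /andP[x0 x1] := Vb w0; have /andP[vx xv] := Vmono u0 uw.
have m0 : 0 <= m%:R :> R by [].
move: (U t) (U r) (V (U t)) (V (U r)) u0 u1 w0 w1 uw wu v0 v1 x0 x1 vx xv.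
move=> u w v x u0 u1 w0 w1 uw wu v0 v1 x0 x1 vx xv.
set q := a + b * w + c * w ^+ 2; set q' := a + b * u + c * u ^+ 2.
have d1 : 0 <= w - u <= t - r by lra.
have E1 : q - q' = (w - u) * (b + c * (w + u)) by rewrite /q /q'; ring.
have B1 : 0 <= b + c * (w + u) <= b + 2 * c.
  by have := c0 => c0'; have := b0 => b0'; apply/andP; split; nra.
have B2 : 0 <= q <= a + b + c.
  have hb : 0 <= b * w <= b by have := b0 => b0'; apply/andP; split; nra.
  have w2 : 0 <= w ^+ 2 <= 1 by apply/andP; split; nra.
  have hc : 0 <= c * w ^+ 2 <= c.
    by have := c0 => c0'; case/andP: w2 => ? ?; apply/andP; split; nra.
  by rewrite /q; have := a0; lra.
have -> : q * x - q' * v = (q - q') * v + q * (x - v) by ring.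
have T1 : 0 <= (q - q') * v <= (b + 2 * c) * (t - r).
  rewrite E1; have ? : 0 <= (w - u) * (b + c * (w + u)) <= (t - r) * (b + 2 * c).
    by apply/andP; split; [rewrite mulr_ge0; lra | apply: ler_pM; lra].
  by apply/andP; split; [rewrite mulr_ge0; lra | nra].
have T2 : 0 <= q * (x - v) <= (a + b + c) * (m%:R * (t - r)).
  apply/andP; split; first by rewrite mulr_ge0; lra.
  by apply: ler_pM; try lra; apply: le_trans (_ : m%:R * (w - u) <= _); [lra | rewrite ler_wpM2l; lra].
have -> : (b + 2 * c + (a + b + c) * m%:R) * (t - r) = (b + 2 * c) * (t - r) + (a + b + c) * (m%:R * (t - r)) by ring.
by case/andP: T1 => ? ?; case/andP: T2 => ? ?; apply/andP; split; lra.
Qed.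

Lemma test_fun_grid j : (j < m)%N ->
  test_fun (j%:R / m%:R) = a + b * ((m - j)%:R / m%:R) + c * ((m - j)%:R / m%:R) ^+ 2.
Proof.
move=> jm; have m0 : 0 < m%:R :> R by rewrite ltr0n.
have E : 1 - j%:R / m%:R = (m - j)%:R / m%:R :> R.
  by rewrite natrB 1?ltnW // mulrBl divff // gt_eqF.
have g0 : 0 <= (m - j)%:R / m%:R :> R by rewrite divr_ge0.
have g1 : (m - j)%:R / m%:R <= 1 :> R by rewrite ler_pdivrMr // mul1r ler_nat leq_subr.
rewrite /test_fun E (max_idPr g0) (min_idPr g1) (_ : Num.min 1 _ = 1) ?mulr1 //.
by apply/min_idPl; rewrite mulrCA divff ?gt_eqF // mulr1 ler1n subn_gt0.
Qed.

End TestFunction.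

Definition primorial (D : nat) : nat := (\prod_(p <- [seq p <- iota 0 D.+1 | prime p]) p)%N.

Lemma primorial_gt0 D : (0 < primorial D)%N.
Proof.
rewrite /primorial big_seq prodn_cond_gt0 // => p; rewrite mem_filter => /andP[/prime_gt0] //.
Qed.

Lemma primorial_dvd D q : prime q -> (q <= D)%N -> (q %| primorial D)%N.
Proof.
move=> qp qD; rewrite /primorial (big_rem q) /= ?dvdn_mulr //.
by rewrite mem_filter qp mem_iota add1n ltnS prime_gt0.
Qed.

Lemma primorial_small D q : prime q -> (q %| primorial D)%N -> (q <= D)%N.
Proof.
move=> qp; rewrite /primorial.
have : all (fun p => prime p && (p <= D))%N [seq p <- iota 0 D.+1 | prime p].
  by apply/allP => p; rewrite mem_filter mem_iota add0n ltnS => /andP[-> ->].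
elim: [seq p <- _ | _] => [|p s IH] /=; first by rewrite big_nil dvdn1 => _ /eqP q1; rewrite q1 in qp.
case/andP=> /andP[pp pD] sD; rewrite big_cons Euclid_dvdM // => /orP[|/(IH sD)//].
by rewrite dvdn_prime2 // => /eqP ->.
Qed.

Lemma crt_avoid (H : seq nat) (s : seq nat) : uniq s -> all prime s ->
  (forall p, p \in s -> exists a, ~~ hit H p a) ->
  exists v, forall h, h \in H -> coprime (v + h) (\prod_(p <- s) p).
Proof.
elim: s => [|p s IH] /=; first by exists 0%N => h _; rewrite big_nil coprimen1.
case/andP=> ps us /andP[pp sp] Ha.
have [v Hv] : exists v, forall h, h \in H -> coprime (v + h) (\prod_(p <- s) p).
  by apply: IH => // q qs; apply: Ha; rewrite inE qs orbT.
have [a ha] := Ha p (mem_head _ _).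
have cop : coprime p (\prod_(p <- s) p).
  rewrite prime_coprime //; apply/negP; elim: s ps sp {IH us Ha v Hv} => [|q s IH] /=.
    by rewrite big_nil dvdn1 => _ _ /eqP p1; rewrite p1 in pp.
  rewrite inE negb_or => /andP[pq ps] /andP[qp sp]; rewrite big_cons Euclid_dvdM // => /orP[|].
    by rewrite dvdn_prime2 // (negbTE pq).
  exact: IH.
exists (chinese p (\prod_(p <- s) p) a v) => h hH.
rewrite big_cons coprimeMr; apply/andP; split.
  rewrite coprime_sym prime_coprime //; apply: contra ha => d; apply/hasP; exists h => //.
  by move: d; rewrite /dvdn -modnDml chinese_modl // modnDml.
by rewrite -coprime_modl -modnDml chinese_modr // modnDml coprime_modl Hv.
Qed.

(** A prime at least [40] exceeds every shift and the number of shifts, so some class is free; the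
    moduli below [40] are tested by computation. *)
Lemma admissible_residue (H : seq nat) (D : nat) : uniq H -> (size H < 40)%N ->
  (forall h, h \in H -> (h < 40)%N) ->
  all (fun p => has (fun r => ~~ hit H p r) (iota 0 p)) (iota 2 38) ->
  exists v, forall h, h \in H -> coprime (v + h) (primorial D).
Proof.
move=> uH sH hH adm; apply: crt_avoid.
- by rewrite filter_uniq // iota_uniq.
- by apply/allP => p; rewrite mem_filter => /andP[].
move=> p; rewrite mem_filter => /andP[pp _]; have [p40|p40] := ltnP p 40.
  have pi : p \in iota 2 38 by rewrite mem_iota prime_gt1.
  by have /hasP[r _ hr] := allP adm p pi; exists r.
have := @count_hit H p uH (fun h hh => leq_trans (hH h hh) p40) => E.
have [/forallP A|] := boolP [forall r : 'I_p, hit H p r]; last first.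
  by rewrite negb_forall => /existsP[r hr]; exists r.
by move: E; rewrite (eq_bigr (fun=> 1%N)) => [|r _]; rewrite ?A // sum1_card card_ord; lia.
Qed.

(** * Growth rates, the slack [xi], and the pointwise inequality *)

Import Order.TTheory GRing.Theory Num.Theory.

Lemma exp_ge (x : R) : x <= exp x.
Proof.
have [x0|x0] := lerP x 0; first by apply: le_trans x0 _; exact: ltW (exp_gt0 x).
by have := ln_sub1 (exp_gt0 x); rewrite expK; lra.
Qed.

Lemma exp_ge1 (x : R) : 0 <= x -> 1 <= exp x.
Proof. by move=> x0; rewrite -[leLHS](lnK ltr01) ln1 ler_exp. Qed.

Lemma expX (x : R) n : exp x ^+ n = exp (n%:R * x).
Proof.
elim: n => [|n IH]; first by rewrite expr0 mul0r -ln1 lnK.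
by rewrite exprS IH -expD -natr1 mulrDl mul1r addrC.
Qed.

Lemma growth (C ka : R) j : 0 < ka -> exists l1 : R, forall l, l1 <= l -> C * l ^+ j <= exp (ka * l).
Proof.
move=> ka0; set q := ka / j.+1%:R; have q0 : 0 < q by rewrite divr_gt0.
exists (`|C| / q ^+ j.+1) => l h.
have l0 : 0 <= l by apply: le_trans h; rewrite divr_ge0 // exprn_ge0 // ltW.
have -> : ka * l = j.+1%:R * (q * l).
  by rewrite /q mulrA mulrCA divff ?mulr1 // pnatr_eq0.
rewrite -expX; apply: (@le_trans _ _ ((q * l) ^+ j.+1)); last first.
  by apply: lerXn2r; rewrite ?nnegrE; [exact: mulr_ge0 (ltW q0) l0 | exact: ltW (exp_gt0 _) | exact: exp_ge].
rewrite exprMn [l ^+ j.+1]exprS mulrA ler_wpM2r ?exprn_ge0 //.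
apply: le_trans (ler_norm C) _; move: h; rewrite ler_pdivrMr ?exprn_gt0 //.
by rewrite mulrC.
Qed.

Lemma pow1D_le (x : R) n : 0 <= x <= 1 -> (1 + x) ^+ n <= 1 + 2 ^+ n * x.
Proof.
move=> /andP[x0 x1]; apply: (@le_trans _ _ (1 + (2 ^+ n - 1) * x)); last by lra.
elim: n => [|n IH]; first by rewrite !expr0; lra.
have p1 : 1 <= 2 ^+ n :> R by rewrite exprn_ege1 // ler1n.
rewrite !exprS; apply: le_trans (ler_wpM2l _ IH) _; first by lra.
move: (2 ^+ n : R) p1 => p p1; rewrite -subr_ge0.
have -> : 1 + (2 * p - 1) * x - (1 + x) * (1 + (p - 1) * x) = (p - 1) * (x * (1 - x)) by ring.
by rewrite !mulr_ge0 // subr_ge0.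
Qed.

Lemma pow1B_ge (x : R) n : 0 <= x <= 1 -> 1 - n%:R * x <= (1 - x) ^+ n.
Proof.
move=> /andP[x0 x1]; elim: n => [|n IH]; first by rewrite expr0; lra.
rewrite exprS; apply: le_trans (ler_wpM2l _ IH); last by lra.
by rewrite -natr1; have := ler0n R n; move: (n%:R : R) => p p0; nra.
Qed.

(** The strict numerical inequality leaves room for a relative error [xi]. The exponents count the
    losses to come: two factors [1 + xi] for each of [k] cell masses in the total, [k + 2] factors
    [1 - xi] in the prime sum. *)
Lemma choose_xi (I A : R) k : 0 <= I -> I < A -> exists2 xi : R, 0 < xi <= 2^-1 &
  (1 + xi) ^+ (2 * k) * I + (4 * k)%:R * xi < A * (1 - xi) ^+ k.+2.
Proof.
move=> I0 IA; set B := 2 ^+ (2 * k) * I + (4 * k)%:R + A * k.+2%:R + 1.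
have B0 : 0 < B by rewrite ltr_pwDr // !addr_ge0 // mulr_ge0 // ?exprn_ge0 //; lra.
set xi := Num.min 2^-1 ((A - I) / (2 * B)).
have x0 : 0 < xi by rewrite lt_min divr_gt0 ?subr_gt0 ?mulr_gt0 //; lra.
have x2 : xi <= 2^-1 by rewrite ge_min lexx.
have xB : xi * B < A - I.
  have : xi <= (A - I) / (2 * B) by rewrite ge_min lexx orbT.
  rewrite ler_pdivlMr ?mulr_gt0 //; lra.
have xx : 0 <= xi <= 1 by lra.
exists xi; first by rewrite x0.
have h1 := ler_wpM2r I0 (pow1D_le (2 * k) xx).
have A0 : 0 <= A by lra.
have h2 := ler_wpM2l A0 (pow1B_ge k.+2 xx).
apply: le_lt_trans (lerD h1 (lexx _)) _; apply: lt_le_trans h2.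
by move: xB; rewrite /B; lra.
Qed.

(** Lowering [theta] is the same as enlarging [eps], with the range of [q] unchanged. *)
Lemma condA_mono (t t1 : R) : t1 <= t -> condA t -> condA t1.
Proof.
move=> tt HA eps A /RltP e0 A0.
have e1 : Rlt (0 : R)%R (t - t1 + eps)%R by apply/RltP; move: e0; rewrite R0E; lra.
have [K HK] := HA _ _ e1 A0; exists K => N N2.
have E : Rminus t (t - t1 + eps)%R = Rminus t1 eps by rewrite !RminusE; ring.
by have := HK N N2; rewrite E.
Qed.

Lemma condB_mono (t t1 : R) : t1 <= t -> condB t -> condB t1.
Proof.
move=> tt HA eps A /RltP e0 A0.
have e1 : Rlt (0 : R)%R (t - t1 + eps)%R by apply/RltP; move: e0; rewrite R0E; lra.
have [K HK] := HA _ _ e1 A0; exists K => N N2.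
have E : Rminus t (t - t1 + eps)%R = Rminus t1 eps by rewrite !RminusE; ring.
by have := HK N N2; rewrite E.
Qed.

Lemma condA_nat (t eps : R) (b : nat) : condA t -> 0 < eps -> (0 < b)%N ->
  exists2 K : R, 0 <= K & forall n, (2 <= n)%N ->
    \sum_(1 <= q < n.+1 | Rleb (INR q) (exp ((t - eps) * ln n%:R))) EA n q
      <= K * (n%:R / ln n%:R ^+ b).
Proof.
move=> HA /RltP e0 b0; have A0 : Rlt (0 : R)%R (INR b) by apply/RltP; rewrite INRE ltr0n.
have [K HK] := HA _ _ e0 A0; exists `|K| => // n n2.
have l0 : 0 < ln n%:R :> R by rewrite ln_gt0 // (ltr_nat R 1).
have /RleP := HK n n2; rewrite Rpower_pow; last by apply/RltP; rewrite INRE.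
rewrite RmultE RdivE !INRE RpowE => h; apply: le_trans (_ : K * (n%:R / ln n%:R ^+ b) <= _) => //.
by rewrite ler_wpM2r ?ler_norm // divr_ge0 // exprn_ge0 // ltW.
Qed.

Lemma condB_nat (t eps : R) (b : nat) : condB t -> 0 < eps -> (0 < b)%N ->
  exists2 K : R, 0 <= K & forall n, (2 <= n)%N ->
    \sum_(1 <= q < n.+1 | Rleb (INR q) (exp ((t - eps) * ln n%:R))) EB n q
      <= K * (n%:R / ln n%:R ^+ b).
Proof.
move=> HA /RltP e0 b0; have A0 : Rlt (0 : R)%R (INR b) by apply/RltP; rewrite INRE ltr0n.
have [K HK] := HA _ _ e0 A0; exists `|K| => // n n2.
have l0 : 0 < ln n%:R :> R by rewrite ln_gt0 // (ltr_nat R 1).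
have /RleP := HK n n2; rewrite Rpower_pow; last by apply/RltP; rewrite INRE.
rewrite RmultE RdivE !INRE RpowE => h; apply: le_trans (_ : K * (n%:R / ln n%:R ^+ b) <= _) => //.
by rewrite ler_wpM2r ?ler_norm // divr_ge0 // exprn_ge0 // ltW.
Qed.

(** This is the split with [B = l' ^ b]. The second half loses [j] logarithms to the divisor sum and
    one to the trivial bound, so [b = j + e + 2] still saves [e + 1]. *)
Lemma level_bound (l l' L n' K : R) (j e : nat) :
  1 <= l -> l <= l' -> 0 <= L -> L <= l -> 0 <= n' -> 0 <= K ->
  let b := (j + e).+2 in
  l' ^+ b * (K * (n' / l' ^+ (2 * b))) + (l' ^+ b)^-1 * (3 * n' * l' * (1 + 2 * L) ^+ j)
  <= (K + 3 ^+ j.+1) * n' / l' ^+ e.+1.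
Proof.
move=> l1 ll L0 Ll n0 K0; cbv zeta; set b := (j + e).+2.
have l'1 : 1 <= l' by lra.
have l'0 : 0 < l' by lra.
have p0 n : 0 < l' ^+ n by rewrite exprn_gt0.
rewrite (_ : (K + 3 ^+ j.+1) * n' / l' ^+ e.+1 = K * n' / l' ^+ e.+1 + 3 ^+ j.+1 * n' / l' ^+ e.+1); last by ring.
apply: lerD.
  rewrite (_ : l' ^+ b * _ = K * n' / l' ^+ b); last first.
    rewrite mulnC exprM; move: (l' ^+ b) (p0 b) => x x0; field.
    by rewrite gt_eqF.
  rewrite ler_wpM2l ?mulr_ge0 // lef_pV2 ?posrE //.
  by rewrite ler_weXn2l // /b; lia.
have h : (1 + 2 * L) ^+ j <= (3 * l') ^+ j.
  by rewrite lerXn2r ?nnegrE //; lra.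
apply: le_trans (_ : (l' ^+ b)^-1 * (3 * n' * l' * (3 * l') ^+ j) <= _).
  by rewrite ler_wpM2l ?invr_ge0 ?(ltW (p0 b)) // ler_wpM2l // !mulr_ge0 //; lra.
rewrite exprMn /b -addSn -addnS exprD exprS [3 ^+ j.+1]exprS.
have := p0 j; have := p0 e.+1.
move: (l' ^+ j) (l' ^+ e.+1) (3 ^+ j : R) => x y w y0 x0; apply: le_of_eq; field.
by rewrite !gt_eqF.
Qed.

Lemma bigOmega_prime p : prime p -> bigOmega p = 1%N.
Proof. by move=> pp; rewrite /bigOmega primes_prime // big_seq1 pfactorK // || rewrite /bigOmega primes_prime // big_seq1 lognE pp dvdnn divnn prime_gt0 //= logn1. Qed.

Lemma liouville_prime p : prime p -> liouville p = -1.
Proof. by move=> pp; rewrite /liouville bigOmega_prime // RpowE expr1 RoppE INRE. Qed.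

Lemma liouville_pm n : liouville n = 1 \/ liouville n = -1.
Proof.
rewrite /liouville RpowE RoppE INRE -signr_odd; case: (odd _); [right|left].
  by rewrite expr1.
by rewrite expr0.
Qed.

(** If [n] is not bad, a prime [n + h] forces the other Liouville values to be [1], so it is the
    only prime; the Liouville sum is then [-1 + (k - 1)] and equality holds. Without primes, or for
    bad [n], trivial bounds suffice. *)
Lemma pointwise_bound (H : seq nat) (n : nat) (bad : bool) : uniq H ->
  (~~ bad -> forall h h', h \in H -> h' \in H -> h != h' -> prime (n + h)%N -> liouville (n + h') <> -1) ->
  ((2 * size H)%:R - 2) * (\sum_(h <- H) (prime (n + h)%N)%:R) <=
  \sum_(h <- H) liouville (n + h) + (size H)%:R + ((2 * size H)%:R - 2) * (size H)%:R * bad%:R :> R.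
Proof.
move=> uH Hn.
have lam (s : seq nat) : - (size s)%:R <= \sum_(h <- s) liouville (n + h) :> R.
  elim: s => [|h s IH]; first by rewrite big_nil oppr0.
  rewrite big_cons /= -natr1; case: (liouville_pm (n + h)) => ->; lra.
have pk (s : seq nat) : \sum_(h <- s) (prime (n + h)%N)%:R <= (size s)%:R :> R.
  elim: s => [|h s IH]; first by rewrite big_nil.
  by rewrite big_cons /= -natr1 addrC lerD // (ler_nat R _ 1); case: (prime _).
case: bad Hn => [_|/(_ isT) Hn].
  have := lam H; have := pk H; rewrite natrM; have := ler0n R (size H).
  case: (H) uH => [|h s] _ /=; first by rewrite !big_nil; lra.
  have : 1 <= (size s).+1%:R :> R by rewrite ler1n.
  move: (\sum_(h <- _) _) (\sum_(h <- _) _) ((size s).+1%:R : R) => x y z; nra.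
rewrite mulr0 addr0; have [/hasP[h hH hp]|] := boolP (has (fun h => prime (n + h)%N) H); last first.
  rewrite -all_predC => /allP np; rewrite big1_seq ?mulr0; first by have := lam H; lra.
  by move=> h /andP[_ /np] /= /negbTE ->.
rewrite (bigD1_seq h) //= [in leRHS](bigD1_seq h) //= hp liouville_prime //.
have l1 h' : h' \in H -> h' != h -> liouville (n + h') = 1.
  by move=> h'H hh; have := Hn h h' hH h'H; rewrite eq_sym hh => /(_ isT hp); case: (liouville_pm (n + h')).
rewrite big1_seq ?addr0; last first.
  move=> h' /andP[hh h'H]; case: (boolP (prime _)) => // pp.
  by have := l1 h' h'H hh; rewrite liouville_prime //; lra.
rewrite [in leRHS]big_seq_cond (eq_bigr (fun=> 1)); last by move=> h' /andP[h'H hh]; exact: l1.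
rewrite -big_seq_cond -big_filter big_const_seq iter_addr addr0 count_predT size_filter.
have -> : count (fun i => i != h) H = (size H).-1.
  have := count_predC (pred1 h) H; rewrite count_uniq_mem // hH add1n => <-.
  by [].
have H1 : (0 < size H)%N by case: (H) hH.
have E : (size H)%:R = (size H).-1%:R + 1 :> R by rewrite natr1 prednK.
by rewrite natrM E (_ : true%:R = 1 :> R) // mulr1; lra.
Qed.

(** * Comparison of the averages at one fixed large [N] *)

Import Order.TTheory GRing.Theory Num.Theory.

Ltac side := solve [assumption | exact: primorial_small | exact: primorial_dvd | done].

Section Core.
Variables (H : seq nat) (K m s D0 v N j0 : nat) (a b c rho theta xi eps ka cc C KA KB : R).
Local Notation k := (K.+2).
Local Notation W := (primorial D0).
Local Notation P := (test_fun a b c m).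
Local Notation Lip := (b + 2 * c + (a + b + c) * m%:R).
Local Notation I := (@upper_const R K m P).
Local Notation J := (@lower_const R K m P).
Local Notation l := (ln N%:R).
Local Notation L := (rho * ln N%:R).
Local Notation y0 := (delta W * rho / m%:R).
Local Notation Y := (y0 * l).
Local Notation z := (y0 ^+ k / W%:R).
Local Notation Cm := ((4 * y0) ^+ k * 'C(m + k.*2, k)%:R).
Local Notation Cc := (P 0 * Cm).
Local Notation bb := (j0 + 2 * k).+2.
Local Notation SS f := (@Ssum D0 N W v K H L P f).
Local Notation T := (primeT D0 N).
Local Notation ll := (@ell D0 N L).
Local Notation cm := (@coef_max D0 N K L P).
Local Notation et := (e_triv s L).
(** All averages are measured in units of [Z]: [Y] approximates the mass of a grid cell, and the
    total weight is [N / W] times its [k]-th power times a constant. *)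
Local Notation Z := (N%:R / W%:R * Y ^+ k).
Hypothesis j0E : j0 = (32 * k ^ 2)%N.
Hypotheses (H_uniq : uniq H) (H_size : size H = k) (H_le : forall h, h \in H -> (h <= 26)%N).
Hypothesis v_coprime : forall h, h \in H -> coprime (v + h) W.
Hypotheses (D26 : (26 <= D0)%N) (kD : (4 * k <= D0)%N) (ksD : (k ^ s <= D0)%N) (s_gt0 : (0 < s)%N).
Hypotheses (m_gt0 : (0 < m)%N) (a0 : 0 <= a) (b0 : 0 <= b) (c0 : 0 <= c).
Hypothesis E_le : (1 - (2 * k)%:R / D0%:R)^-1 <= 1 + xi :> R.
Hypotheses (xi_gt0 : 0 < xi) (xi_le : xi <= 2^-1) (rho_gt0 : 0 < rho) (rho_le : 2 * rho + eps <= 1).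
Hypotheses (eps_gt0 : 0 < eps) (theta_eq : theta - eps = 2 * rho + eps).
Hypotheses (ka_gt0 : 0 < ka) (ks : 2 * rho * (1 + (s%:R)^-1) <= 1 - 2 * ka).
Hypotheses (cc_gt0 : 0 < cc) (cc_le : cc <= 1) (cc_ka : cc * rho <= ka).
Hypotheses (C_ge0 : 0 <= C) (HC : forall X, (0 < X)%N ->
  \sum_(p < X.+1 | prime p) ln p%:R / p%:R <= C * (ln X%:R + 1)).
Hypothesis cc_small : k%:R * Lip ^+ 2 * Cm * (2 * cc * C) / W%:R <= xi * z / 2.
Hypotheses (KA_ge0 : 0 <= KA) (KB_ge0 : 0 <= KB).
Hypothesis HA : forall n, (2 <= n)%N ->
  \sum_(1 <= q < n.+1 | Rleb (INR q) (exp ((theta - eps) * ln n%:R))) EA n q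
    <= KA * (n%:R / ln n%:R ^+ (2 * bb)).
Hypothesis HB : forall n, (2 <= n)%N ->
  \sum_(1 <= q < n.+1 | Rleb (INR q) (exp ((theta - eps) * ln n%:R))) EB n q
    <= KB * (n%:R / ln n%:R ^+ (2 * bb)).
Hypotheses (N26 : (26 <= N)%N) (l_ge1 : 1 <= l) (lW : W%:R + 1 <= xi * Y) (l27 : 27 <= xi * l).
Hypotheses (lcc : 1 <= cc * L) (lWeps : W%:R <= exp (eps * l)).
Hypothesis lerr : 8 * Cc ^+ 2 * (KA + KB + 3 ^+ j0.+1) <= xi * z * l.
Hypothesis lgrow : 8 * k%:R * Cc ^+ 2 * l ^+ (2 * k).+1 <= xi * z * exp (ka * l).
Hypothesis numerics : (1 + xi) ^+ (2 * k) * I + (4 * k)%:R * xi <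
  (2 * k%:R - 2) * (rho / m%:R * J) * (1 - xi) ^+ k.+2.

Let W0 : (0 < W)%N. Proof. exact: primorial_gt0. Qed.
Let W0r : 0 < W%:R :> R. Proof. by rewrite ltr0n primorial_gt0. Qed.
Let m0 : 0 < m%:R :> R. Proof. by rewrite ltr0n. Qed.
Let N0 : (0 < N)%N. Proof. exact: leq_trans N26. Qed.
Let N0r : 0 < N%:R :> R. Proof. by rewrite ltr0n (leq_trans _ N26). Qed.
Let l0 : 0 < l. Proof. exact: lt_le_trans ltr01 l_ge1. Qed.
Let L0 : 0 < L. Proof. by rewrite mulr_gt0. Qed.
Let dl0 : 0 < delta W. Proof. by rewrite divr_gt0 // ltr0n totient_gt0. Qed.
Let dl1 : delta W <= 1. Proof. by apply: delta_le1. Qed.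
Let y00 : 0 < y0. Proof. by rewrite divr_gt0 // mulr_gt0. Qed.
Let Y0 : 0 < Y. Proof. by rewrite mulr_gt0. Qed.
Let z0 : 0 < z. Proof. by rewrite divr_gt0 // exprn_gt0. Qed.
Let YE : delta W * L / m%:R = Y. Proof. by ring. Qed.
Let ZE : Z = z * N%:R * l ^+ k. Proof. by rewrite exprMn; ring. Qed.
Let Z0 : 0 < Z. Proof. by rewrite mulr_gt0 ?divr_gt0 ?exprn_gt0. Qed.
Let zNZ : z * N%:R <= Z.
Proof.
rewrite ZE; apply: ler_peMr; last exact: exprn_ege1.
by apply: mulr_ge0 => //; exact: ltW z0.
Qed.
Let LN : exp L <= N%:R.
Proof.
rewrite -[leRHS](lnK N0r) ler_exp // ler_piMl ?(ltW l0) //.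
by have := rho_le; have := rho_gt0; have := eps_gt0; lra.
Qed.
Let H_leD h : h \in H -> (h <= D0)%N.
Proof. by move/H_le => h26; exact: leq_trans h26 D26. Qed.
Let P_ge0 x : 0 <= P x. Proof. exact: test_fun_ge0. Qed.
Let P_mono r x : r <= x -> P x <= P r.
Proof.
move=> rx; have /andP[h _] : 0 <= P r - P x <= Lip * (x - r) by apply: test_fun_lip.
by rewrite -subr_ge0.
Qed.
Let P_vanish x : 1 <= x -> P x = 0. Proof. exact: test_fun_vanish. Qed.
Let P_lip r x : r <= x -> P r - P x <= Lip * (x - r).
Proof. by move=> rx; have /andP[_ h] : 0 <= P r - P x <= Lip * (x - r) by apply: test_fun_lip. Qed.

(** One factor [1 + xi] pays for the excess over [1 / p], the other for the additive [W + 1]. *)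
Let up_le : @c_up D0 W K m L <= (1 + xi) ^+ 2 * Y.
Proof.
rewrite /c_up YE; move: Y Y0 lW => y y0' lW'; have x0 := xi_gt0.
have -> : (1 + xi) ^+ 2 * y = (1 + xi) * ((1 + xi) * y) by ring.
have D00 : 0 < D0%:R :> R by rewrite ltr0n (leq_trans _ D26).
apply: ler_pM.
- by rewrite invr_ge0 subr_ge0 ler_pdivrMr // mul1r ler_nat (leq_trans _ kD) // leq_mul2r orbT.
- by rewrite !addr_ge0 // ltW.
- exact: E_le.
by rewrite [leRHS]mulrDl mul1r -addrA lerD2l.
Qed.

Let up_ge0 : 0 <= @c_up D0 W K m L.
Proof.
have D00 : 0 < D0%:R :> R by rewrite ltr0n (leq_trans _ D26).
rewrite /c_up mulr_ge0 //; last by rewrite YE !addr_ge0 // ltW.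
by rewrite invr_ge0 subr_ge0 ler_pdivrMr // mul1r ler_nat (leq_trans _ kD) // leq_mul2r orbT.
Qed.

Let mass_le : @mass D0 N K L <= Cm * l ^+ k.
Proof.
have h : @mass D0 N K L <= @c_up D0 W K m L ^+ k * 'C(m + k.*2, k)%:R by apply: mass_upper; side.
apply: le_trans h _; rewrite [leRHS]mulrAC; apply: ler_wpM2r => //; rewrite -exprMn.
apply: lerXn2r; rewrite ?nnegrE; [exact: up_ge0 | | ].
  by apply: mulr_ge0; [apply: mulr_ge0 => //; exact: ltW | exact: ltW].
apply: le_trans up_le _; rewrite -[leRHS]mulrA; apply: ler_wpM2r; first exact: ltW.
by have := xi_le; have := xi_gt0; move=> x0 x1; nra.
Qed.

Let cm_ge0 : 0 <= cm. Proof. by apply: coef_max_ge0; side. Qed.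
Let Cc_ge0 : 0 <= Cc. Proof.
apply: mulr_ge0 => //; apply: mulr_ge0 => //; apply: exprn_ge0; apply: mulr_ge0 => //.
exact: ltW.
Qed.
Let cm_le : cm ^+ 2 <= Cc ^+ 2 * l ^+ (2 * k).
Proof.
rewrite [(2 * k)%N]mulnC exprM -exprMn; apply: lerXn2r; rewrite ?nnegrE; [exact: cm_ge0 | | ].
  by apply: mulr_ge0; [exact: Cc_ge0 | apply: exprn_ge0; exact: ltW].
by rewrite /coef_max -[leRHS]mulrA; apply: ler_wpM2l => //; exact: mass_le.
Qed.

(** [g] is [N ^ ka], and the trivial errors are at most [N / g ^+ 2]: one [g] absorbs powers of
    logarithms, the other the number of small primes in the bound for bad [n]. *)
Let g : R := exp (ka * l).
Let g1 : 1 <= g. Proof. by apply: exp_ge1; rewrite mulr_ge0 // ltW. Qed.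
Let g0 : 0 < g. Proof. exact: exp_gt0. Qed.
Let et_le : et <= N%:R / g ^+ 2.
Proof.
rewrite ler_pdivlMr ?exprn_gt0 // /et /g expX -expD -[leRHS](lnK N0r) ler_exp //.
have -> : 2 * (rho * l) * (1 + s%:R^-1) + 2 * (ka * l) = (2 * rho * (1 + s%:R^-1) + 2 * ka) * l by ring.
by apply: ler_piMl; [exact: ltW | have := ks; lra].
Qed.
Let et0 : 0 <= et. Proof. exact: ltW (exp_gt0 _). Qed.

Let triv_err : cm ^+ 2 * (2 * l) * et * g <= xi * z * N%:R / (4 * k%:R).
Proof.
have k0 : 0 < k%:R :> R by rewrite ltr0n.
apply: (@le_trans _ _ (Cc ^+ 2 * l ^+ (2 * k) * (2 * l) * (N%:R / g ^+ 2) * g)).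
  have ll0 : 0 <= 2 * l by apply: mulr_ge0 => //; exact: ltW.
  apply: ler_wpM2r; first exact: ltW.
  apply: ler_pM; [by apply: mulr_ge0 => //; exact: sqr_ge0 | exact: et0 | | exact: et_le].
  by apply: ler_wpM2r => //; exact: cm_le.
have -> : Cc ^+ 2 * l ^+ (2 * k) * (2 * l) * (N%:R / g ^+ 2) * g =
  (8 * k%:R * Cc ^+ 2 * l ^+ (2 * k).+1) * (N%:R / (4 * k%:R * g)).
  rewrite [l ^+ _.+1]exprS; move: (Cc ^+ 2) (l ^+ _) g g0 (k%:R : R) k0 => u w x x0 y y0'.
  by field; rewrite !gt_eqF.
have q0 : 0 <= N%:R / (4 * k%:R * g) by rewrite divr_ge0 // !mulr_ge0 // ltW.
apply: le_trans (ler_wpM2r q0 lgrow) _; rewrite -/g; apply: le_of_eq.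
by move: g g0 (k%:R : R) k0 => x x0 y y0'; field; rewrite !gt_eqF.
Qed.

(** Stated for an abstract [Er] to serve both conditions. The squared coefficient bound costs
    [l ^+ (2 * k)], so a saving of [2 * k + 1] logarithms leaves [1 / l], which beats any
    constant. *)
Let level (Er : nat -> nat -> R) (KE : R) h : h \in H -> 0 <= KE -> KE <= KA + KB ->
  (forall n q, 0 <= Er n q) ->
  (forall n (U : {set T}), 1 <= ln n%:R -> (modulus W U <= n)%N ->
     Er n (modulus W U) <= 3 * n%:R * ln n%:R * (2 ^+ #|U| / (dv U)%:R)) ->
  (forall n, (2 <= n)%N ->
    \sum_(1 <= q < n.+1 | Rleb (INR q) (exp ((theta - eps) * ln n%:R))) Er n q
      <= KE * (n%:R / ln n%:R ^+ (2 * bb))) ->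
  exists2 e : R, \sum_(D : {set T} | len ll D <= 1) \sum_(E : {set T} | len ll E <= 1)
     k%:R ^+ #|D :|: E| * Er (N + h)%N (modulus W (D :|: E)) <= e
   & cm ^+ 2 * e <= xi * z * N%:R / 4.
Proof.
move=> hH KE0 KEl Er0 Ert HE; set n' := (N + h)%N; set l' := ln n'%:R.
have nN : N%:R <= n'%:R :> R by rewrite ler_nat leq_addr.
have n2N : n'%:R <= 2 * N%:R :> R.
  by rewrite -natrM ler_nat mul2n -addnn leq_add2l (leq_trans (H_le hH)).
have lll : l <= l' by rewrite ler_ln.
have l'1 : 1 <= l' by exact: le_trans lll.
have n'0 : 0 < n'%:R :> R by exact: lt_le_trans nN.
have B0 : 0 < l' ^+ bb by rewrite exprn_gt0 // (lt_le_trans ltr01).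
have n2 : (2 <= n')%N by apply: leq_trans (leq_addr _ _); exact: leq_trans N26.
have HE' := HE n' n2.
exists ((KE + 3 ^+ j0.+1) * n'%:R / l' ^+ (2 * k).+1).
  have Ll : L <= l.
    apply: ler_piMl; [exact: ltW | ].
    by have := rho_le; have := rho_gt0; have := eps_gt0; lra.
  apply: le_trans (@level_bound l l' L n'%:R KE j0 (2 * k) l_ge1 lll (ltW L0) Ll (ltW n'0) KE0).
  have Er0' q : 0 <= Er n' q := Er0 n' q.
  have Ert' (U : {set T}) := Ert n' U l'1.
  have Wy : W%:R * exp (2 * L) <= exp ((theta - eps) * l').
    apply: le_trans (ler_wpM2r (ltW (exp_gt0 _)) lWeps) _; rewrite -expD; apply: ler_exp.
    rewrite theta_eq (_ : eps * l + 2 * L = (2 * rho + eps) * l); last by ring.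
    by apply: ler_wpM2l => //; apply: addr_ge0; [apply: mulr_ge0 => // |]; exact: ltW.
  have yn : exp ((theta - eps) * l') <= n'%:R.
    rewrite -[leRHS](lnK n'0); apply: ler_exp; rewrite theta_eq; apply: ler_piMl => //.
    exact: le_trans ler01 l'1.
  have hlev (B S1 : R) : 0 < B ->
      \sum_(1 <= q < n'.+1 | Rleb (INR q) (exp ((theta - eps) * l'))) Er n' q <= S1 ->
      \sum_(D : {set T} | len ll D <= 1) \sum_(E : {set T} | len ll E <= 1)
        k%:R ^+ #|D :|: E| * Er n' (modulus W (D :|: E)) <=
      B * S1 + B^-1 * (3 * n'%:R * ln n'%:R * (1 + 2 * L) ^+ j0).
    move=> hB hS; rewrite j0E.
have hk : (0 < k)%N by [].
    have hD0 : (0 < D0)%N by exact: leq_trans D26.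
    have hsm : forall q, prime q -> (q %| W)%N -> (q <= D0)%N by exact: primorial_small.
    by first [exact: (error_level L0 W0 hsm hk hD0 l'1 hB Er0' Ert' Wy yn hS) | exact: (error_level L0 W0 hsm hD0 l'1 hB Er0' Ert' Wy yn hS) | exact: (error_level L0 W0 hsm hk l'1 hB Er0' Ert' Wy yn hS) | exact: (error_level L0 W0 hsm l'1 hB Er0' Ert' Wy yn hS)].

  exact: hlev B0 HE'.
set KK := KE + 3 ^+ j0.+1.
have KK0 : 0 <= KK by apply: addr_ge0 => //; exact: exprn_ge0.
have l'0 : 0 < l' by exact: lt_le_trans ltr01 l'1.
have lX n : 0 <= l ^+ n by apply: exprn_ge0; exact: ltW.
have l'X n : 0 < l' ^+ n by exact: exprn_gt0.
have Q0 : 0 <= KK * n'%:R / l' ^+ (2 * k).+1 by apply: divr_ge0; [exact: mulr_ge0 | exact: ltW].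
apply: le_trans (ler_wpM2r Q0 cm_le) _.
have lp : l ^+ (2 * k) / l' ^+ (2 * k).+1 <= l^-1.
  rewrite exprS invfM mulrCA -[leRHS]mulr1; apply: ler_pM.
  - by rewrite invr_ge0 ltW.
  - by apply: divr_ge0 => //; exact: ltW.
  - by rewrite lef_pV2 // posrE.
  rewrite ler_pdivrMr // mul1r.
  by apply: lerXn2r; rewrite ?nnegrE; [exact: ltW | exact: ltW | exact: lll].
apply: (@le_trans _ _ (Cc ^+ 2 * KK * (2 * N%:R) * l^-1)).
  have -> : Cc ^+ 2 * l ^+ (2 * k) * (KK * n'%:R / l' ^+ (2 * k).+1) =
     Cc ^+ 2 * KK * n'%:R * (l ^+ (2 * k) / l' ^+ (2 * k).+1) by ring.
  have CK0 : 0 <= Cc ^+ 2 * KK by apply: mulr_ge0 => //; exact: sqr_ge0.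
  apply: ler_pM => //.
  - exact: mulr_ge0.
  - by apply: divr_ge0 => //; exact: ltW.
  exact: ler_wpM2l.
rewrite ler_pdivrMr //.
have K1 : 8 * Cc ^+ 2 * KK <= xi * z * l.
  apply: le_trans lerr; apply: ler_wpM2l; last by rewrite /KK lerD2r.
  by apply: mulr_ge0 => //; exact: sqr_ge0.
have := ler_wpM2r (ltW N0r) K1; move: (Cc ^+ 2) => u; lra.
Qed.

Let B1 : SS (fun=> 1) <= Z * ((1 + xi) ^+ (2 * k) * I + xi).
Proof.
have h : SS (fun=> 1) <= N%:R / W%:R * (@c_up D0 W K m L ^+ k * I) + cm ^+ 2 * et by apply: Ssum_one; side.
apply: le_trans h _.
rewrite mulrDr; apply: lerD.
  have I0 : 0 <= I by apply: sumr_ge0 => i _; rewrite mulr_ge0 // sqr_ge0.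
  rewrite -[Z * _]mulrA; apply: ler_wpM2l; first exact: divr_ge0.
  rewrite [leRHS]mulrA; apply: ler_wpM2r => //.
  rewrite [leRHS]mulrC exprM -exprMn; apply: lerXn2r; rewrite ?nnegrE; [exact: up_ge0 | | exact: up_le].
  by apply: mulr_ge0; [exact: sqr_ge0 | exact: ltW].
have k1 : 1 <= k%:R :> R by rewrite ler1n.
have zN0 : 0 <= xi * z * N%:R by apply: mulr_ge0 => //; apply: ltW; exact: mulr_gt0.
apply: (@le_trans _ _ (cm ^+ 2 * (2 * l) * et * g)).
  have := l_ge1 => l1.
  have c20 : 0 <= cm ^+ 2 * et by rewrite mulr_ge0 // sqr_ge0.
  have -> : cm ^+ 2 * (2 * l) * et * g = cm ^+ 2 * et * (2 * l * g) by ring.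
  by rewrite ler_peMr //; have := g1 => gg; nra.
have k40 : 0 < 4 * k%:R :> R by lra.
apply: le_trans triv_err _; rewrite ler_pdivrMr //.
apply: (@le_trans _ _ (Z * xi)).
  by rewrite [Z * xi]mulrC -mulrA; apply: ler_wpM2l => //; exact: ltW.
by apply: ler_peMr; [apply: mulr_ge0; exact: ltW | lra].
Qed.

Let B3 h : h \in H -> `|SS (fun n => liouville (n + h))| <= Z * xi.
Proof.
move=> hH; have KBl : KB <= KA + KB by rewrite lerDr.
have EBm n (U : {set T}) : 1 <= ln n%:R -> (modulus W U <= n)%N ->
    EB n (modulus W U) <= 3 * n%:R * ln n%:R * (2 ^+ #|U| / (dv U)%:R).
  by move=> h1 h2; apply: EB_modulus; side.
have [e He Hc] := level hH KB_ge0 KBl EB_ge0 EBm HB.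
have hS : `|SS (fun n => liouville (n + h))| <= cm ^+ 2 * (2 * e) by apply: Ssum_liouville; side.
apply: le_trans hS _.
have zN := ler_wpM2l (ltW xi_gt0) zNZ.
have zN0 : 0 <= xi * z * N%:R by apply: mulr_ge0 => //; apply: ltW; exact: mulr_gt0.
by rewrite mulrCA [Z * xi]mulrC; rewrite mulrA in zN; lra.
Qed.

Let l2 : R := ln (N + 26)%:R.
Let l2_le : l2 <= (1 + xi) * l.
Proof.
apply: (@le_trans _ _ (ln (27 * N%:R))).
  apply: ler_ln; first by rewrite ltr0n; exact: leq_trans N0 (leq_addr _ _).
  have N1 : 1 <= N%:R :> R by rewrite ler1n.
  by rewrite natrD; lra.
have h : ln (27 : R) <= 27 - 1 by apply: ln_sub1; lra.
by rewrite lnM //; have := l27; lra.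
Qed.
Let l2_ge : l <= l2. Proof. by rewrite ler_ln // ler_nat leq_addr. Qed.

Let SS_mono f1 f2 : (forall n, (0 < n <= N)%N -> (n %% W == v %% W)%N -> f1 n <= f2 n) -> SS f1 <= SS f2.
Proof.
move=> hf; rewrite /Ssum big_nat_cond [leRHS]big_nat_cond; apply: ler_sum => n /andP[n1 nW].
by rewrite ler_wpM2r ?sqr_ge0 // hf.
Qed.

Let SS_scale x f : SS (fun n => x * f n) = x * SS f.
Proof. by rewrite /Ssum mulr_sumr; apply: eq_bigr => n _; rewrite mulrA. Qed.

Let SS_add f1 f2 : SS (fun n => f1 n + f2 n) = SS f1 + SS f2.
Proof. by rewrite /Ssum -big_split; apply: eq_bigr => n _; rewrite mulrDl. Qed.

Let SS_sum (f : nat -> nat -> R) : SS (fun n => \sum_(h <- H) f h n) = \sum_(h <- H) SS (f h).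
Proof.
rewrite /Ssum exchange_big /=; apply: eq_bigr => n _; by rewrite mulr_suml.
Qed.

(** The logarithm of a prime [n + h] is at most [l2], so dividing the logarithmic sum by [l2] bounds
    the prime count from below. This costs one more [1 - xi], whence [k.+2] where the cell masses
    give [k.+1]. *)
Let B2 h : h \in H ->
  Z * (rho / m%:R * J * (1 - xi) ^+ k.+2 - xi) <= SS (fun n => (prime (n + h)%N)%:R).
Proof.
move=> hH; have l20 : 0 < l2 by exact: lt_le_trans l2_ge.
have J0 : 0 <= J by apply: sumr_ge0 => i _; rewrite mulr_ge0 // sqr_ge0.
have x1 : 0 <= 1 - xi by have := xi_le; lra.
rewrite -(ler_pM2l l20) -SS_scale.
apply: (@le_trans _ _ (SS (log_prime h))); last first.
  apply: SS_mono => n /andP[n1 nN] _; rewrite /log_prime; case: ifP => pp; rewrite ?mulr0 // mulr1.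
  apply: ler_ln; first by rewrite ltr0n prime_gt0.
  by rewrite ler_nat leq_add // H_le.
have KAl : KA <= KA + KB by rewrite lerDl.
have EAm n (U : {set T}) : 1 <= ln n%:R -> (modulus W U <= n)%N ->
    EA n (modulus W U) <= 3 * n%:R * ln n%:R * (2 ^+ #|U| / (dv U)%:R).
  by move=> h1 h2; apply: EA_modulus; side.
have [e He Hc] := level hH KA_ge0 KAl EA_ge0 EAm HA.
have lnW : ln W%:R <= W%:R by have := ln_sub1 W0r; lra.
have low_ge : (1 - xi) * Y <= @c_low W m L.
  have -> : @c_low W m L = Y - delta W * ln W%:R by rewrite /c_low; ring.
  rewrite mulrBl mul1r lerD2l lerN2.
  apply: le_trans (_ : 1 * W%:R <= _); last by have := lW; lra.
  by apply: ler_pM => //; [exact: ltW | rewrite ln_ge0 // ler1n].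
have xY0 : 0 <= (1 - xi) * Y by apply: mulr_ge0 => //; exact: ltW.
have low0 : 0 <= @c_low W m L by exact: le_trans low_ge.
have hS : (N + h)%:R / (totient W)%:R * (@c_low W m L ^+ k.+1 * J)
    - cm ^+ 2 * (e + ln (N + h)%:R * et) <= SS (log_prime h) by apply: Ssum_prime; side.
apply: le_trans hS.
have tW : 0 < (totient W)%:R :> R by rewrite ltr0n totient_gt0.
have main : Z * (rho * l / m%:R) * (1 - xi) ^+ k.+1 * J <=
   (N + h)%:R / (totient W)%:R * (@c_low W m L ^+ k.+1 * J).
  apply: (@le_trans _ _ (N%:R / (totient W)%:R * (((1 - xi) * Y) ^+ k.+1 * J))).
    apply: le_of_eq; rewrite (exprMn k.+1 (1 - xi) Y) [Y ^+ k.+1]exprS /delta.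
    move: (Y ^+ k) ((1 - xi) ^+ k.+1) (W%:R : R) W0r ((totient W)%:R : R) tW (m%:R : R) m0.
    by move=> u w x x0 t t0 q q0; field; rewrite !gt_eqF.
  apply: ler_pM.
  - exact: divr_ge0.
  - by apply: mulr_ge0 => //; exact: exprn_ge0.
  - by apply: ler_wpM2r; [rewrite invr_ge0 | rewrite ler_nat leq_addr].
  by apply: ler_wpM2r => //; apply: lerXn2r; rewrite ?nnegrE.
have l'2 : ln (N + h)%:R <= 2 * l.
  apply: le_trans (_ : l2 <= _).
    apply: ler_ln; first by rewrite ltr0n; exact: leq_trans N0 (leq_addr _ _).
    by rewrite ler_nat leq_add2l H_le.
  by apply: le_trans l2_le _; have := xi_le; have := l0; nra.
have err : cm ^+ 2 * (e + ln (N + h)%:R * et) <= xi * Z.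
  rewrite mulrDr; have k1 : 1 <= k%:R :> R by rewrite ler1n.
  have zN := ler_wpM2l (ltW xi_gt0) zNZ; rewrite mulrA in zN.
  have zN0 : 0 <= xi * z * N%:R by apply: mulr_ge0 => //; apply: ltW; exact: mulr_gt0.
  have e2 : cm ^+ 2 * (ln (N + h)%:R * et) <= xi * z * N%:R / 4.
    apply: (@le_trans _ _ (cm ^+ 2 * (2 * l) * et * g)).
      rewrite mulrA; apply: (@le_trans _ _ (cm ^+ 2 * (2 * l) * et)).
        by apply: ler_wpM2r => //; apply: ler_wpM2l => //; exact: sqr_ge0.
      apply: ler_peMr => //; apply: mulr_ge0 => //; apply: mulr_ge0; first exact: sqr_ge0.
      by apply: mulr_ge0 => //; exact: ltW.
    apply: le_trans triv_err _; apply: ler_wpM2l => //.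
    by rewrite lef_pV2 ?posrE; lra.
  lra.
apply: le_trans (lerB main err); rewrite [leLHS]mulrCA.
have -> : Z * (rho * l / m%:R) * (1 - xi) ^+ k.+1 * J - xi * Z =
  Z * (l * (rho / m%:R * J * (1 - xi) ^+ k.+1) - xi) by ring.
apply: ler_wpM2l; first exact: ltW.
rewrite [(1 - xi) ^+ k.+2]exprS.
have u0 : 0 <= rho / m%:R * J * (1 - xi) ^+ k.+1 by apply: mulr_ge0; [apply: mulr_ge0 => //; apply: divr_ge0; exact: ltW | exact: exprn_ge0].
have -> : rho / m%:R * J * ((1 - xi) * (1 - xi) ^+ k.+1) = (1 - xi) * (rho / m%:R * J * (1 - xi) ^+ k.+1) by ring.
move: (rho / m%:R * J * (1 - xi) ^+ k.+1) u0 => u u0.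
have h1 : l2 * (1 - xi) <= l.
  apply: le_trans (ler_wpM2r x1 l2_le) _; have := l0; have := xi_gt0; nra.
have h2 : 1 <= l2 by exact: le_trans l2_ge.
have h3 := ler_wpM2r u0 h1.
have h4 : xi <= l2 * xi by apply: ler_peMl => //; exact: ltW.
by rewrite mulrBr mulrA; lra.
Qed.

(** Half of [xi] pays for the main term, small by the choice of [cc], and half for the error
    terms. *)
Let B4 : SS (fun n => (@bad D0 N H L cc n)%:R) <= Z * xi.
Proof.
have Ch := @small_prime_sum D0 N L cc C L0 (ltW cc_gt0) C_ge0 HC.
have cc0 := ltW cc_gt0.
have hS : SS (fun n => (@bad D0 N H L cc n)%:R) <=
  N%:R / W%:R * (k%:R * Lip ^+ 2 * @mass D0 N K L * (cc / L * (C * (cc * L + 1)))) +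
  exp (cc * L) * (k%:R * cm ^+ 2 * et) by apply: Ssum_bad; side.
apply: le_trans hS _.
have Ch2 : cc / L * (C * (cc * L + 1)) <= 2 * cc * C.
  have -> : cc / L * (C * (cc * L + 1)) = cc * C * (cc + L^-1).
    by move: L L0 => x x0; field; rewrite gt_eqF.
  have e1 : cc + L^-1 <= 2.
    have : L^-1 <= cc by rewrite -[leLHS]mul1r ler_pdivrMr.
    by have := cc_le; lra.
  have e2 : 0 <= cc * C by apply: mulr_ge0 => //; exact: ltW.
  rewrite (_ : 2 * cc * C = cc * C * 2); last by ring.
  exact: ler_wpM2l.
have A1 : N%:R / W%:R * (k%:R * Lip ^+ 2 * @mass D0 N K L * (cc / L * (C * (cc * L + 1)))) <= xi * Z / 2.
  apply: (@le_trans _ _ (N%:R / W%:R * (k%:R * Lip ^+ 2 * (Cm * l ^+ k) * (2 * cc * C)))).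
    rewrite ler_wpM2l ?divr_ge0 //; apply: ler_pM => //.
    - by apply: mulr_ge0; [apply: mulr_ge0 => //; exact: sqr_ge0 | apply: mass_ge0; side].
    - apply: mulr_ge0; first by apply: divr_ge0 => //; exact: ltW.
      by apply: mulr_ge0 => //; apply: addr_ge0 => //; apply: mulr_ge0 => //; exact: ltW.
    by apply: ler_wpM2l; [apply: mulr_ge0 => //; exact: sqr_ge0 | exact: mass_le].
  have q0 : 0 <= N%:R * l ^+ k by apply: mulr_ge0 => //; apply: exprn_ge0; exact: ltW.
  have := ler_wpM2r q0 cc_small; rewrite ZE; congr (_ <= _); ring.
have k0 : 0 < k%:R :> R by rewrite ltr0n.
have A2 : exp (cc * L) * (k%:R * cm ^+ 2 * et) <= xi * Z / 2.
  have gl : exp (cc * L) <= g.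
    by apply: ler_exp; rewrite mulrA; apply: ler_wpM2r => //; exact: ltW.
  have c20 : 0 <= k%:R * cm ^+ 2 * et by apply: mulr_ge0 => //; apply: mulr_ge0 => //; exact: sqr_ge0.
  apply: le_trans (ler_wpM2r c20 gl) _.
  apply: (@le_trans _ _ (k%:R * (cm ^+ 2 * (2 * l) * et * g))).
    have -> : k%:R * (cm ^+ 2 * (2 * l) * et * g) = g * (k%:R * cm ^+ 2 * et) * (2 * l) by ring.
    apply: ler_peMr; last by have := l_ge1; lra.
    by apply: mulr_ge0 => //; exact: ltW.
  apply: le_trans (ler_wpM2l (ltW k0) triv_err) _.
  have -> : k%:R * (xi * z * N%:R / (4 * k%:R)) = xi * z * N%:R / 4.
    by move: (xi * z * N%:R) (k%:R : R) k0 => u x x0; field; rewrite gt_eqF.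
  have zN := ler_wpM2l (ltW xi_gt0) zNZ; rewrite mulrA in zN.
  have zN0 : 0 <= xi * z * N%:R by apply: mulr_ge0 => //; apply: ltW; exact: mulr_gt0.
  lra.
by rewrite [Z * xi]mulrC; lra.
Qed.

Lemma sieve_conclusion : exists n h h', [/\ (0 < n <= N)%N, (n %% W == v %% W)%N,
  ~~ @bad D0 N H L cc n, h \in H /\ h' \in H & [/\ h != h', prime (n + h)%N & liouville (n + h') = -1]].
Proof.
apply: NNPP => no.
have pw n : (0 < n <= N)%N -> (n %% W == v %% W)%N ->
   ((2 * size H)%:R - 2) * (\sum_(h <- H) (prime (n + h)%N)%:R) <=
   \sum_(h <- H) liouville (n + h) + (size H)%:R + ((2 * size H)%:R - 2) * (size H)%:R * (@bad D0 N H L cc n)%:R :> R.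
  move=> n1 nW; apply: pointwise_bound => // nb h h' hH h'H hh hp lm.
  by apply: no; exists n, h, h'.
have k1 : 1 <= k%:R :> R by rewrite ler1n.
set q : R := (2 * size H)%:R - 2.
have qE : q = 2 * k%:R - 2 by rewrite /q H_size natrM.
have q0 : 0 <= q by rewrite qE; lra.
have SUM : q * \sum_(h <- H) SS (fun n => (prime (n + h)%N)%:R) <=
   \sum_(h <- H) SS (fun n => liouville (n + h)) + k%:R * SS (fun=> 1) + q * k%:R * SS (fun n => (@bad D0 N H L cc n)%:R).
  rewrite -(SS_sum (fun h n => (prime (n + h)%N)%:R)) -(SS_sum (fun h n => liouville (n + h))) -!SS_scale -!SS_add.
  by apply: SS_mono => n n1 nW; have := pw n n1 nW; rewrite -/q H_size mulr1.
have B1' := B1; have B2' := B2.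
set X1 := (1 + xi) ^+ (2 * k) * I in B1' *; set X2 := rho / m%:R * J * (1 - xi) ^+ k.+2 in B2' *.
have S2 : k%:R * (Z * (X2 - xi)) <= \sum_(h <- H) SS (fun n => (prime (n + h)%N)%:R).
  rewrite (_ : k%:R * (Z * (X2 - xi)) = \sum_(h <- H) Z * (X2 - xi)); last first.
    by rewrite big_const_seq count_predT iter_addr addr0 H_size mulr_natl.
  by rewrite big_seq [leRHS]big_seq; apply: ler_sum => h hH; exact: B2'.
have S3 : \sum_(h <- H) SS (fun n => liouville (n + h)) <= k%:R * (Z * xi).
  rewrite (_ : k%:R * (Z * xi) = \sum_(h <- H) Z * xi); last first.
    by rewrite big_const_seq count_predT iter_addr addr0 H_size mulr_natl.
  rewrite big_seq [leRHS]big_seq; apply: ler_sum => h hH; apply: le_trans (B3 hH); exact: ler_norm.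
have num : X1 + (4 * k)%:R * xi < q * X2.
  by have := numerics; rewrite -/X1 qE /X2 natrM !mulrA.
have kZ : 0 < k%:R * Z by rewrite mulr_gt0 // (lt_le_trans ltr01).
have F : k%:R * Z * (q * (X2 - xi)) <= k%:R * Z * (xi + (X1 + xi) + q * xi).
  have t1 := ler_wpM2l q0 S2; have k0 : 0 <= k%:R :> R by [].
  have t2 := ler_wpM2l k0 B1'; have qk0 : 0 <= q * k%:R by rewrite mulr_ge0.
  have t3 := ler_wpM2l qk0 B4.
  have -> : k%:R * Z * (q * (X2 - xi)) = q * (k%:R * (Z * (X2 - xi))) by ring.
  have -> : k%:R * Z * (xi + (X1 + xi) + q * xi) = k%:R * (Z * xi) + k%:R * (Z * (X1 + xi)) + q * k%:R * (Z * xi) by ring.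
  by apply: le_trans t1 _; apply: le_trans SUM _; rewrite !lerD.
(* The errors add up to [(2 + 2 q) * xi] with [q = 2 * k - 2], which is below the reserved
   [4 * k * xi]. *)
move: F; rewrite ler_pM2l // => F; have xk := xi_gt0.
move: F num; rewrite natrM qE; move: (k%:R : R) k1 (X1) (X2) => x x1 u w F num.
lra.
Qed.

End Core.

(** * Exact integer evaluation of the two sieve constants *)

Import Order.TTheory GRing.Theory Num.Theory.

Delimit Scope Z_scope with coqZ.

Section Numerics.
Variables (K m num : nat) (a b c : Z).
Local Notation k := (K.+2).

(** The value of the test function at [i / m], multiplied by [m ^ 2] to make it an integer. *)
Definition pz (mz i : Z) : Z :=
  if Z.ltb i mz then (a * mz * mz + b * mz * (mz - i) + c * (mz - i) * (mz - i))%coqZ else 0%coqZ.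

(** An initial piece of a row of Pascal's triangle; a [pairmap] of additions gives the next row, so
    binomials are never recomputed. *)
Definition zrow (r n : nat) : seq Z := [seq Z.of_nat 'C(n, i) | i <- iota 0 r.+1].

Arguments zrow : simpl never.

Fixpoint zsum (mz : Z) (n : nat) (i s : Z) : Z :=
  if n is n'.+1 then zsum mz n' (i + 1)%coqZ (s + pz mz i)%coqZ else s.

(** [S] carries the tail sum of [pz] from [i + 2] on, which makes the double sum of [lower_const] a
    single pass over the grid. *)
Fixpoint zloop (mz : Z) (n : nat) (i : Z) (rU rL : seq Z) (S aU aL : Z) : Z * Z :=
  if n is n'.+1 then
    let p := pz mz i in
    zloop mz n' (i + 1)%coqZ (pairmap Z.add 0%coqZ rU) (pairmap Z.add 0%coqZ rL) (S - pz mz (i + 2))%coqZ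
      (aU + last 0%coqZ rU * (p * p))%coqZ (aL + last 0%coqZ rL * (S * S))%coqZ
  else (aU, aL).

(** Both accumulators carry [m ^ 4], so the comparison is the wanted inequality multiplied by
    [1000 * m ^ 5]. *)
Definition zcheck : bool :=
  let mz := Z.of_nat m in
  let p0 := pz mz 0 in
  let S1 := (zsum mz m 0 0 - p0 - pz mz 1)%coqZ in
  let r := zloop mz m 0%coqZ (zrow K.+1 k.*2) (zrow K 0) S1 (Z.of_nat 'C(k.*2, k) * (p0 * p0))%coqZ 0%coqZ in
  Z.ltb (1000 * mz * r.1) (Z.of_nat K.+1 * Z.of_nat num * r.2).

Lemma zloopS mz n i rU rL S aU aL : zloop mz n.+1 i rU rL S aU aL =
  zloop mz n (i + 1)%coqZ (pairmap Z.add 0%coqZ rU) (pairmap Z.add 0%coqZ rL) (S - pz mz (i + 2))%coqZ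
      (aU + last 0%coqZ rU * (pz mz i * pz mz i))%coqZ (aL + last 0%coqZ rL * (S * S))%coqZ.
Proof. by []. Qed.

Lemma IZR_nat n : IZR (Z.of_nat n) = n%:R. Proof. by rewrite -INR_IZR_INZ INRE. Qed.

Lemma IZRD x y : IZR (x + y)%coqZ = IZR x + IZR y. Proof. exact: plus_IZR. Qed.
Lemma IZRB x y : IZR (x - y)%coqZ = IZR x - IZR y. Proof. exact: minus_IZR. Qed.
Lemma IZRM x y : IZR (x * y)%coqZ = IZR x * IZR y. Proof. exact: mult_IZR. Qed.

Lemma zrow_next r n : pairmap Z.add 0%coqZ (zrow r n) = zrow r n.+1.
Proof.
have aux q s : pairmap Z.add (Z.of_nat 'C(n, q)) [seq Z.of_nat 'C(n, i) | i <- iota q.+1 s] =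
    [seq Z.of_nat 'C(n.+1, i) | i <- iota q.+1 s].
  elim: s q => //= s IH q; rewrite IH binS Nat2Z.inj_add; congr cons.
  by rewrite Z.add_comm.
change (Z.add 0 (Z.of_nat 'C(n, 0)) ::
    pairmap Z.add (Z.of_nat 'C(n, 0)) [seq Z.of_nat 'C(n, i) | i <- iota 1 r] =
  Z.of_nat 'C(n.+1, 0) :: [seq Z.of_nat 'C(n.+1, i) | i <- iota 1 r]).
by rewrite aux !bin0.
Qed.

Lemma zrow_last r n : IZR (last 0%coqZ (zrow r n)) = 'C(n, r)%:R.
Proof.
rewrite /zrow -addn1 iotaD map_cat last_cat /= add0n IZR_nat //.
Qed.

Let mz := Z.of_nat m.
Let p (x : nat) : R := IZR (pz mz (Z.of_nat x)).
Let Sr (j : nat) : R := \sum_(j.+1 <= x < m) p x.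

Let p_out x : (m <= x)%N -> p x = 0.
Proof.
move=> mx; rewrite /p /pz (_ : Z.ltb _ _ = false) //; apply/Z.ltb_ge; rewrite /mz.
by apply/Nat2Z.inj_le; exact/ssrnat.leP.
Qed.

Let Sr_next j : Sr j - p j.+1 = Sr j.+1.
Proof.
rewrite /Sr; have [jm|mj] := ltnP j.+1 m; first by rewrite big_ltn // addrC addKr.
by rewrite p_out // subr0 !big_geq // (leq_trans mj).
Qed.

Lemma zsumE n (i : nat) s : IZR (zsum mz n (Z.of_nat i) s) = IZR s + \sum_(i <= x < i + n) p x.
Proof.
elim: n i s => [|n IH] i s; first by rewrite addn0 big_geq ?addr0.
rewrite /= (_ : (Z.of_nat i + 1)%coqZ = Z.of_nat i.+1); last by rewrite Nat2Z.inj_succ.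
by rewrite IH IZRD addnS [in RHS]big_ltn ?ltnS ?leq_addr // addSn addrA.
Qed.

Lemma zloopE n (i : nat) S aU aL : IZR S = Sr i.+1 ->
  let r := zloop mz n (Z.of_nat i) (zrow K.+1 (i + k.*2)) (zrow K i) S aU aL in
  IZR r.1 = IZR aU + \sum_(x < n) 'C(i + x + k.*2, K.+1)%:R * p (i + x) ^+ 2 /\
  IZR r.2 = IZR aL + \sum_(x < n) 'C(i + x, K)%:R * Sr (i + x).+1 ^+ 2.
Proof.
elim: n i S aU aL => [|n IH] i S aU aL HS; first by rewrite !big_ord0 !addr0.
cbv zeta; rewrite zloopS !zrow_next (_ : (Z.of_nat i + 1)%coqZ = Z.of_nat i.+1); last by rewrite Nat2Z.inj_succ.
rewrite (_ : (Z.of_nat i + 2)%coqZ = Z.of_nat i.+2); last by rewrite !Nat2Z.inj_succ; lia.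
have HS' : IZR (S - pz mz (Z.of_nat i.+2))%coqZ = Sr i.+2 by rewrite IZRB HS -(Sr_next i.+1).
have [-> ->] := IH i.+1 _ (aU + last 0%coqZ (zrow K.+1 (i + k.*2)) * (pz mz (Z.of_nat i) * pz mz (Z.of_nat i)))%coqZ
   (aL + last 0%coqZ (zrow K i) * (S * S))%coqZ HS'.
rewrite !IZRD !IZRM !zrow_last HS -!addrA !big_ord_recl /= addn0 -!expr2.
by split; congr (_ + (_ + _)); apply: eq_bigr => x _; rewrite /bump /= addnA addn1.
Qed.

Hypothesis m_gt1 : (1 < m)%N.
Hypotheses (a0 : Z.le 0 a) (b0 : Z.le 0 b) (c0 : Z.le 0 c).
Local Notation P := (test_fun (IZR a) (IZR b) (IZR c) m).

Lemma pzE (x : nat) : p x = m%:R ^+ 2 * P (x%:R / m%:R).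
Proof.
have m0 : 0 < m%:R :> R by rewrite ltr0n ltnW.
have [xm|mx] := ltnP x m; last first.
  by rewrite p_out // test_fun_vanish ?mulr0 // ler_pdivlMr // mul1r ler_nat.
rewrite test_fun_grid // ?(ltnW m_gt1) // /p /pz (_ : Z.ltb _ _ = true); last first.
  by apply/Z.ltb_lt; rewrite /mz; apply/Nat2Z.inj_lt; exact/ssrnat.ltP.
rewrite !IZRD !IZRM IZRB !IZR_nat -natrB 1?ltnW //.
move: ((m - x)%:R : R) (m%:R : R) m0 (IZR a) (IZR b) (IZR c) => d q q0 A B C.
by field; rewrite gt_eqF.
Qed.

Lemma numerics_check : zcheck ->
  @upper_const R K m P < (K.+1)%:R * (num%:R / 1000%:R) * @lower_const R K m P / m%:R.
Proof.
have m0 : 0 < m%:R :> R by rewrite ltr0n ltnW.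
have m20 : 0 < (m%:R ^+ 2) ^+ 2 :> R by rewrite !exprn_gt0.
rewrite /zcheck -/mz.
have HS1 : IZR (zsum mz m 0 0 - pz mz 0 - pz mz 1)%coqZ = Sr 1.
  rewrite !IZRB -[0%coqZ]/(Z.of_nat 0) zsumE add0r add0n /Sr -/(p 0) -[1%coqZ]/(Z.of_nat 1) -/(p 1).
  by rewrite big_ltn 1?ltnW // big_ltn //; ring.
have [Hu Hl] := @zloopE m 0 _ (Z.of_nat 'C(k.*2, k) * (pz mz 0 * pz mz 0))%coqZ 0%coqZ HS1.
cbv zeta; set r := zloop _ _ _ _ _ _ _ _.
have {}Hu : IZR r.1 = _ := Hu; have {}Hl : IZR r.2 = _ := Hl.
move=> /Z.ltb_lt/IZR_lt/RltP; rewrite !IZRM !IZR_nat Hu Hl.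
have U : (m%:R ^+ 2) ^+ 2 * @upper_const R K m P =
   IZR (Z.of_nat 'C(k.*2, k) * (pz mz 0 * pz mz 0))%coqZ + \sum_(x < m) 'C(0 + x + k.*2, K.+1)%:R * p (0 + x) ^+ 2.
  rewrite /upper_const big_ord_recl mulrDr mulr_sumr; congr (_ + _).
    by rewrite !IZRM IZR_nat -[0%coqZ]/(Z.of_nat 0) -/(p 0) pzE /=; ring.
  by apply: eq_bigr => x _; rewrite pzE /= !add0n /bump /=; ring.
have Lw : (m%:R ^+ 2) ^+ 2 * @lower_const R K m P = 0 + \sum_(x < m) 'C(0 + x, K)%:R * Sr (0 + x).+1 ^+ 2.
  rewrite /lower_const big_ord_recl mulrDr mulr_sumr mul0r mulr0 add0r add0r.
  apply: eq_bigr => x _; rewrite !add0n /= mulrCA -exprMn; congr (_ * _ ^+ 2).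
  rewrite mulr_sumr (eq_bigr (fun i : 'I_m => p (i + x.+2))) => [|i _]; last first.
    rewrite pzE -mulrDl -natrD; congr (_ * P (_%:R / _)).
    by rewrite /bump /=; lia.
  rewrite -(big_mkord xpredT (fun i => p (i + x.+2))) /Sr.
  have [xm|mx] := leqP x.+2 m; last first.
    rewrite [RHS]big_geq 1?ltnW // big1_seq // => i _; apply: p_out.
    by rewrite (leq_trans (ltnW mx)) // leq_addl.
  rewrite -{2}(subnK xm) -{1}(add0n x.+2) big_addn addnK || idtac.
  rewrite (@big_cat_nat _ _ _ (m - x.+2)%N) ?leq_subr //= [X in _ + X]big1_seq ?addr0; last first.
    move=> i /andP[_]; rewrite mem_index_iota => /andP[im _]; apply: p_out; lia.
  by rewrite -[in RHS](add0n x.+2) big_addn.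
rewrite -U -Lw => h; have := h.
rewrite (_ : IZR 1000 = 1000%:R); last by rewrite (_ : 1000%coqZ = Z.of_nat 1000) // IZR_nat.
have t0 : 0 < 1000%:R :> R by rewrite ltr0n.
move: (1000%:R : R) t0 (@upper_const R K m P) (@lower_const R K m P) => t t0 u' l' {}h.
rewrite ltr_pdivlMr // -(ltr_pM2l m20) -(ltr_pM2l t0).
have -> : t * ((m%:R ^+ 2) ^+ 2 * (K.+1%:R * (num%:R / t) * l')) = K.+1%:R * num%:R * ((m%:R ^+ 2) ^+ 2 * l').
  by move: ((m%:R ^+ 2) ^+ 2 : R) => q; field; rewrite gt_eqF.
by apply: le_lt_trans h; apply: le_of_eq; ring.
Qed.

End Numerics.

(** The arguments are [K = k - 2], the grid size, [1000 * theta0] and the coefficients of the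
    quadratic test polynomial in [u = 1 - t]. *)
Lemma check3 : zcheck 1 (Z.to_nat 4762) 924 1 2 1. Proof. by vm_compute. Qed.
Lemma check4 : zcheck 2 (Z.to_nat 6333) 739 1 3 4. Proof. by vm_compute. Qed.
Lemma check5 : zcheck 3 (Z.to_nat 7641) 643 1 3 8. Proof. by vm_compute. Qed.
Lemma check6 : zcheck 4 (Z.to_nat 8164) 584 1 4 13. Proof. by vm_compute. Qed.
Lemma check7 : zcheck 5 (Z.to_nat 8557) 544 1 4 20. Proof. by vm_compute. Qed.
Lemma check8 : zcheck 6 (Z.to_nat 8164) 516 1 4 29. Proof. by vm_compute. Qed.

(** * Choice of the parameters, and passage to infinitely many primes *)

Import Order.TTheory GRing.Theory Num.Theory.

Lemma sieve_core (H : seq nat) (K m : nat) (a b c theta0 theta : R) :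
  uniq H -> size H = K.+2 -> (K.+2 < 40)%N -> (forall h, h \in H -> (h <= 26)%N) ->
  all (fun p => has (fun r => ~~ hit H p r) (iota 0 p)) (iota 2 38) ->
  (0 < m)%N -> 0 <= a -> 0 <= b -> 0 <= c -> 0 < theta0 -> theta0 < 1 -> theta0 < theta ->
  condA theta -> condB theta ->
  @upper_const R K m (test_fun a b c m) <
    (K.+1)%:R * theta0 * @lower_const R K m (test_fun a b c m) / m%:R ->
  exists2 c0 : R, 0 < c0 & forall M, exists n h h',
    [/\ (M <= n + h)%N, (0 < n)%N, h \in H, h' \in H & [/\ h != h', prime (n + h)%N, liouville (n + h') = -1 &
      forall q, prime q -> (q %| n + h')%N -> exp (c0 * ln (n + h)%:R) < q%:R]].
Proof.
move=> uH sH K40 H26 adm m0 a0 b0 c0 t0 t01 t0t HA0 HB0 num.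
(* Capping the level below [1] gives [2 * rho < 1], so that [ka] is positive and the trivial errors
   save a power of [N]. *)
set th := Num.min theta ((1 + theta0) / 2).
have th1 : th <= (1 + theta0) / 2 by rewrite ge_min lexx orbT.
have th0 : theta0 < th by rewrite lt_min t0t /=; lra.
have tht : th <= theta by rewrite ge_min lexx.
have HA := condA_mono tht HA0; have HB := condB_mono tht HB0.
set k := K.+2; set P := test_fun a b c m.
(* [2 * rho] is the midpoint of [theta0] and [th]: above [theta0], so the numerical inequality
   survives, and [2 * eps] below [th], one [eps] for the conditions and one to absorb [W]. *)
set rho := (theta0 + th) / 4; set eps := (th - theta0) / 4; set ka := (1 - 2 * rho) / 4.
have rho0 : 0 < rho by rewrite /rho; lra.
have eps0 : 0 < eps by rewrite /eps; lra.
have rho1 : 2 * rho + eps <= 1 by rewrite /rho /eps; lra.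
have ka0 : 0 < ka by rewrite /ka /rho; lra.
have theq : th - eps = 2 * rho + eps by rewrite /rho /eps; lra.
set s := (Num.truncn (2 * ka)^-1).+1.
have s0 : (0 < s)%N by [].
have sr : 0 < s%:R :> R by rewrite ltr0n.
have si : s%:R^-1 <= 2 * ka.
  rewrite -[leRHS]invrK lef_pV2 ?posrE // ?invr_gt0; try lra.
  have i0 : 0 <= (2 * ka)^-1 by rewrite invr_ge0; lra.
  by have /andP[_ /ltW] := truncn_itv i0.
have si0 : 0 < s%:R^-1 :> R by rewrite invr_gt0.
have ks : 2 * rho * (1 + s%:R^-1) <= 1 - 2 * ka.
  have : 1 - 2 * rho = 4 * ka by rewrite /ka; lra.
  by move: (s%:R^-1 : R) si si0 => x x1 x0; nra.
have mr : 0 < m%:R :> R by rewrite ltr0n.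
have kr : 1 <= k%:R :> R by rewrite ler1n.
set I := @upper_const R K m P in num *; set J := @lower_const R K m P in num *.
have I0 : 0 <= I by apply: sumr_ge0 => i _; rewrite mulr_ge0 // sqr_ge0.
have J0 : 0 <= J by apply: sumr_ge0 => i _; rewrite mulr_ge0 // sqr_ge0.
have IA : I < (2 * k%:R - 2) * (rho / m%:R * J).
  apply: lt_le_trans num _.
  have -> : (2 * k%:R - 2) * (rho / m%:R * J) = K.+1%:R * (2 * rho) * (J / m%:R).
    by rewrite /k -[K.+2%:R]natr1; ring.
  rewrite -mulrA ler_wpM2r ?divr_ge0 // ler_wpM2l //; rewrite /rho; lra.
have [xi /andP[xi0 xi2] numerics] := choose_xi k I0 IA.
(* [26] bounds the shifts, [k ^ s] serves [pow_card_bound], and the last summand makes the excess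
   product at most [1 + xi]. *)
set D0 := (26 + (4 * k + (k ^ s + (Num.truncn (8 * k%:R / xi)).+1)))%N.
have D26 : (26 <= D0)%N by exact: leq_addr.
have kD : (4 * k <= D0)%N by exact: leq_trans (leq_addr _ _) (leq_addl _ _).
have tD : (k ^ s + (Num.truncn (8 * k%:R / xi)).+1 <= D0)%N by exact: leq_trans (leq_addl _ _) (leq_addl _ _).
have ksD : (k ^ s <= D0)%N by exact: leq_trans (leq_addr _ _) tD.
have q80 : 0 <= 8 * k%:R / xi :> R by rewrite divr_ge0 ?mulr_ge0 // ltW.
have D8 : 8 * k%:R / xi <= D0%:R.
  have /andP[_ /ltW h] := truncn_itv q80; apply: le_trans h _; rewrite ler_nat; exact: leq_trans (leq_addl _ _) tD.
have D0r : 0 < D0%:R :> R by rewrite ltr0n; exact: leq_trans D26.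
clearbody D0.
have E_le : (1 - (2 * k)%:R / D0%:R)^-1 <= 1 + xi :> R.
  have x4 : (2 * k)%:R / D0%:R <= xi / 4 :> R.
    by rewrite ler_pdivrMr // natrM; move: D8; rewrite ler_pdivrMr //; lra.
  move: ((2 * k)%:R / D0%:R : R) x4 => x x4.
  by rewrite -[leLHS]mul1r ler_pdivrMr; [nra | lra].
have H40 h : h \in H -> (h < 40)%N by move/H26 => h26; exact: leq_ltn_trans h26 _.
have [v vc] := admissible_residue D0 uH (leq_trans (eq_leq (congr1 S sH)) K40) H40 adm.
set W := primorial D0 in vc.
have Wr : 0 < W%:R :> R by rewrite ltr0n primorial_gt0.
have [C C0 HC] := mertens_upper (lt_trans t0 th0) HA.
set y0 := delta W * rho / m%:R.
have y00 : 0 < y0 by rewrite divr_gt0 // mulr_gt0 // divr_gt0 // ltr0n totient_gt0 primorial_gt0.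
set z := y0 ^+ k / W%:R; have z0 : 0 < z by rewrite divr_gt0 // exprn_gt0.
set Cm := (4 * y0) ^+ k * 'C(m + k.*2, k)%:R.
have Cm0 : 0 <= Cm by rewrite mulr_ge0 // exprn_ge0 // mulr_ge0 // ltW.
set Cc := P 0 * Cm; set Lip := b + 2 * c + (a + b + c) * m%:R.
set q := k%:R * Lip ^+ 2 * Cm * (2 * C) / W%:R.
have q0 : 0 <= q.
  apply: divr_ge0; last exact: ltW.
  apply: mulr_ge0; last by apply: mulr_ge0; [exact: ler0n | exact: C0].
  apply: mulr_ge0; last exact: Cm0.
  by apply: mulr_ge0; [exact: ler0n | exact: sqr_ge0].
(* The second bound keeps the number of small primes below [N ^ ka]; the third makes their main term
   at most half of [xi]. *)
set cc := Num.min 1 (Num.min (ka / rho) (xi * z / (2 * (q + 1)))).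
have xz : 0 < xi * z by rewrite mulr_gt0.
have q1 : 0 < 2 * (q + 1) by lra.
have cc0 : 0 < cc by rewrite !lt_min ltr01 /=; apply/andP; split; apply: divr_gt0.
have cc1 : cc <= 1 by rewrite ge_min lexx.
have ccka : cc * rho <= ka by rewrite -ler_pdivlMr // !ge_min lexx !orbT.
have cc_small : k%:R * Lip ^+ 2 * Cm * (2 * cc * C) / W%:R <= xi * z / 2.
  have -> : k%:R * Lip ^+ 2 * Cm * (2 * cc * C) / W%:R = cc * q by rewrite /q; ring.
  have : cc <= xi * z / (2 * (q + 1)) by rewrite !ge_min lexx !orbT.
  by rewrite ler_pdivlMr // => h; nra.
(* Introduced through an equation, so that this large exponent stays opaque. *)
have [j0 j0E] : exists j, j = (32 * k ^ 2)%N by exists (32 * k ^ 2)%N.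
set bb := (j0 + 2 * k).+2.
have bb0 : (0 < 2 * bb)%N by rewrite muln_gt0.
have [KA KA0 HKA] := @condA_nat th eps (2 * bb) HA eps0 bb0.
have [KB KB0 HKB] := @condB_nat th eps (2 * bb) HB eps0 bb0.
have [l1 Hl1] := growth (8 * k%:R * Cc ^+ 2 / (xi * z)) (2 * k).+1 ka0.
have ccr : 0 < cc * rho by rewrite mulr_gt0.
(* The exponent refers to [n + h] instead of [N]; halving it covers [n + h <= N ^ 2]. *)
exists (cc * rho / 2) => [|M]; first by rewrite divr_gt0.
(* Each of [x1] to [x6] is the size of [ln N] that one requirement asks for; [LL] adds them up. *)
set x1 := (W%:R + 1) / (xi * y0); set x2 := 27 / xi; set x3 := (cc * rho)^-1; set x4 := W%:R / eps.
set x5 := 8 * Cc ^+ 2 * (KA + KB + 3 ^+ j0.+1) / (xi * z); set x6 := ln M.+1%:R / (cc * rho).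
have x10 : 0 <= x1 by rewrite divr_ge0 ?addr_ge0 // mulr_ge0 // ltW.
have x20 : 0 <= x2 by rewrite divr_ge0 // ltW.
have x30 : 0 <= x3 by rewrite invr_ge0 ltW.
have x40 : 0 <= x4 by rewrite divr_ge0 // ltW.
have x50 : 0 <= x5.
  apply: divr_ge0; last exact: ltW.
  apply: mulr_ge0; first by apply: mulr_ge0; [exact: ler0n | exact: sqr_ge0].
  by apply: addr_ge0; [exact: addr_ge0 | exact: exprn_ge0].
have x60 : 0 <= x6 by rewrite divr_ge0 ?(ltW ccr) // ln_ge0 // ler1n.
have x70 := normr_ge0 l1; have x71 := ler_norm l1.
set LL := 26 + x1 + x2 + x3 + x4 + x5 + x6 + `|l1|.
set N := (Num.truncn (exp LL)).+1.
have NLL : exp LL <= N%:R by have /andP[_ /ltW] := truncn_itv (ltW (exp_gt0 LL)).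
have Nr : 0 < N%:R :> R by rewrite ltr0n.
set l := ln N%:R.
have lLL : LL <= l by rewrite -[leLHS]expK ler_ln ?exp_gt0.
have Nl : exp l = N%:R by rewrite lnK.
have N26 : (26 <= N)%N.
  rewrite -(ler_nat R); apply: le_trans NLL; apply: le_trans (exp_ge LL).
  by rewrite /LL; lra.
have y0n : y0 != 0 by rewrite gt_eqF.
have l1' : 1 <= l by move: lLL; rewrite /LL; lra.
have lW : W%:R + 1 <= xi * (y0 * l).
  have xy : 0 < xi * y0 by exact: mulr_gt0.
  have hx : x1 <= l by move: lLL; rewrite /LL; lra.
  have hx' : W%:R + 1 <= l * (xi * y0) by rewrite -ler_pdivrMr //; exact: hx.
  by rewrite mulrCA [l * y0]mulrC in hx'.
have l27 : 27 <= xi * l by rewrite [xi * l]mulrC -ler_pdivrMr // -/x2; move: lLL; rewrite /LL; lra.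
have lcc : 1 <= cc * (rho * l).
  by rewrite mulrA [_ * l]mulrC -ler_pdivrMr // mul1r -/x3; move: lLL; rewrite /LL; lra.
have lWe : W%:R <= exp (eps * l).
  apply: le_trans (exp_ge _); rewrite [eps * l]mulrC -ler_pdivrMr // -/x4; move: lLL; rewrite /LL; lra.
have lerr : 8 * Cc ^+ 2 * (KA + KB + 3 ^+ j0.+1) <= xi * z * l.
  by rewrite [_ * l]mulrC -ler_pdivrMr // -/x5; move: lLL; rewrite /LL; lra.
have lgrow : 8 * k%:R * Cc ^+ 2 * l ^+ (2 * k).+1 <= xi * z * exp (ka * l).
  have h : l1 <= l by move: lLL; rewrite /LL; lra.
  by have := Hl1 l h; rewrite mulrAC ler_pdivrMr // [_ * (xi * z)]mulrC.
have lM : ln M.+1%:R <= cc * (rho * l).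
  by rewrite mulrA [_ * l]mulrC -ler_pdivrMr // -/x6; move: lLL; rewrite /LL; lra.
have [n [h [h' [/andP[n0 nN] nW nb [hH h'H] [hh hp lm]]]]] :
  exists n h h', [/\ (0 < n <= N)%N, (n %% W == v %% W)%N,
    ~~ @bad D0 N H (rho * l) cc n, h \in H /\ h' \in H & [/\ h != h', prime (n + h)%N & liouville (n + h') = -1]].
  exact: (@sieve_conclusion H K m s D0 v N j0 a b c rho th xi eps ka cc C KA KB).
have L0 : 0 < rho * l by rewrite mulr_gt0 // (lt_le_trans ltr01).
have big h2 r : h2 \in H -> prime r -> (r %| n + h2)%N -> exp (cc * (rho * l)) < r%:R.
  move=> h2H rp rd.
  have rD : (D0 < r)%N.
    rewrite ltnNge; apply/negP => rD; have rW := primorial_dvd rp rD.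
    have rv : (r %| v + h2)%N.
      move: rd; rewrite /dvdn -[in X in X -> _](modn_dvdm _ rW) -[in X in _ -> X](modn_dvdm _ rW).
      by rewrite -[in X in X -> _]modnDml (eqP nW) modnDml.
    have := vc h2 h2H; rewrite coprime_sym => /(coprime_dvdl rW)/(coprime_dvdr rv).
    by rewrite /coprime gcdnn => /eqP r1; rewrite r1 in rp.
  have [rN|Nr'] := leqP r N; last first.
    apply: le_lt_trans (_ : N%:R < _); last by rewrite ltr_nat.
    rewrite -Nl ler_exp //; rewrite mulrA ler_piMl ?(le_trans ler01) //.
    by apply: le_trans ccka _; rewrite /ka; lra.
  have [p pE] : exists p : primeT D0 N, pv p = r by apply: pv_surj; rewrite ?rD.
  have : ~~ (ell (rho * l) p <= cc).
    apply: contra nb => pc; apply/existsP; exists p; rewrite pc /=; apply/hasP; exists h2 => //.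
    by rewrite pE.
  rewrite -ltNge /ell pE ltr_pdivlMr // => hl.
  have r0 : 0 < r%:R :> R by rewrite ltr0n prime_gt0.
  by rewrite ltNge; apply/negP => /(ler_ln r0); rewrite expK leNgt hl.
have nh2 : ln (n + h)%:R <= 2 * l.
  have -> : 2 * l = ln (N%:R * N%:R) by rewrite lnM // mulr_natl mulr2n.
  rewrite ler_ln ?ltr0n ?addn_gt0 ?n0 // -natrM ler_nat.
  apply: leq_trans (leq_add nN (leq_trans (H26 h hH) N26)) _.
  by rewrite addnn -mul2n leq_mul2r (leq_trans _ N26) ?orbT.
exists n, h, h'; split => //.
  (* [n + h] is its own prime factor, so the absence of small factors already makes it exceed
     [M]. *)
  rewrite -(ler_nat R); apply: ltW; apply: le_lt_trans (big h _ hH hp (dvdnn _)).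
  apply: le_trans (_ : M.+1%:R <= _); first by rewrite ler_nat.
  by rewrite -[leLHS]lnK ?ltr0n // ler_exp.
split=> // r rp rd; apply: le_lt_trans (big h' r h'H rp rd); rewrite ler_exp //.
have -> : cc * (rho * l) = cc * rho / 2 * (2 * l) by field.
by rewrite ler_wpM2l // divr_ge0 // ltW.
Qed.

(** * One shift and one number of prime factors for infinitely many primes *)

Lemma decreasing_pigeonhole (X : eqType) (r : seq X) (Q : X -> nat -> Prop) :
  (forall x M M', (M <= M')%N -> Q x M' -> Q x M) ->
  (forall M, exists2 x, x \in r & Q x M) -> exists2 x, x \in r & forall M, Q x M.
Proof.
move=> Qm HQ; apply: NNPP => no.
have [M HM] : exists M, forall x, x \in r -> ~ Q x M.
  have {no} : forall x, x \in r -> exists M, ~ Q x M.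
    by move=> x xr; apply: NNPP => nx; apply: no; exists x => // M; apply: NNPP => nq; apply: nx; exists M.
  elim: r {HQ} => [|x r IH] H; first by exists 0%N.
  have [M1 h1] := H x (mem_head _ _).
  have [M2 h2] := IH (fun y yr => H y (mem_behead (s := x :: r) yr)).
  exists (maxn M1 M2) => y; rewrite inE => /predU1P[->|yr] hq.
    by apply: h1; apply: Qm hq; exact: leq_maxl.
  by apply: (h2 y yr); apply: Qm hq; exact: leq_maxr.
by have [x xr] := HQ M; exact: HM.
Qed.

Lemma bigOmega_bound n (y : R) : (0 < n)%N ->
  (forall q, prime q -> (q %| n)%N -> y < ln q%:R) -> (bigOmega n)%:R * y <= ln n%:R.
Proof.
move=> n0 hq.
have -> : ln n%:R = \sum_(p <- primes n) (logn p n)%:R * ln p%:R.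
  rewrite [in LHS](prod_prime_decomp n0) prime_decompE big_map /= ln_prod.
    rewrite big_seq [RHS]big_seq; apply: eq_bigr => p; rewrite mem_primes => /and3P[pp _ _].
    by rewrite natrX lnX // ltr0n prime_gt0.
  by move=> p; rewrite expn_gt0 lognE; case: p => //=.
rewrite /bigOmega natr_sum mulr_suml big_seq [leRHS]big_seq; apply: ler_sum => p.
by rewrite mem_primes => /and3P[pp _ pn]; rewrite ler_wpM2l // ltW // hq.
Qed.

Definition almost_prime_gap (D : nat) : Prop :=
  exists (C c : R), (0 < c)%R /\
  exists (b : nat) (d : int),
    odd b /\ (INR b <= C)%R /\
    ~~ odd (absz d) /\ (0 < absz d)%N /\ (absz d <= D)%N /\
    forall M : nat, exists p : nat,
      (M <= p)%N /\ prime p /\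
      (INR (least_prime_factor (absz (Posz p + d)%R)) > Rpower (INR p) c)%R /\
      bigOmega (absz (Posz p + d)%R) = b.

Lemma odd_bigOmega n : liouville n = -1 -> odd (bigOmega n).
Proof.
have powE b : pow (Ropp (INR 1)) b = (-1) ^+ b :> R.
  by elim: b => [|b IH] //; rewrite exprS -IH.
rewrite /liouville powE -signr_odd; case: (odd _) => //.
by rewrite expr0 => h1; have : (1 : R) = -1 := h1; lra.
Qed.

Lemma odd_absz_sub (h h' : nat) : ~~ odd h -> ~~ odd h' -> ~~ odd (absz (Posz h' - Posz h)%R).
Proof. by lia. Qed.

Lemma absz_sub_gt0 (h h' : nat) : h != h' -> (0 < absz (Posz h' - Posz h)%R)%N.
Proof. by lia. Qed.

Lemma absz_sub_le (D h h' : nat) : (h <= D)%N -> (h' <= D)%N -> (absz (Posz h' - Posz h)%R <= D)%N.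
Proof. by lia. Qed.

Lemma absz_shift (n h h' : nat) : absz (Posz (n + h) + (Posz h' - Posz h))%R = (n + h')%N.
Proof. by lia. Qed.

Lemma sieve_to_theorem (H : seq nat) (D : nat) (c0 : R) : 0 < c0 ->
  (forall h, h \in H -> (h <= D)%N && ~~ odd h) -> (D <= 26)%N ->
  (forall M, exists n h h',
    [/\ (M <= n + h)%N, (0 < n)%N, h \in H, h' \in H & [/\ h != h', prime (n + h)%N, liouville (n + h') = -1 &
      forall q, prime q -> (q %| n + h')%N -> exp (c0 * ln (n + h)%:R) < q%:R]]) ->
  almost_prime_gap D.
Proof.
move=> c00 HD D26 HM.
(* From [n + h' <= 27 (n + h)], [ln 27 <= 26] and [ln (n + h) >= 1 / 2], the logarithm of [n + h']
   is at most [53] times that of [n + h], which bounds the number of prime factors by [53 / c0]. *)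
set B := Num.truncn (53 / c0).
pose Q (h h' b M : nat) := exists n, [/\ (M <= n + h)%N, (0 < n)%N, h != h' & [/\ prime (n + h)%N,
  liouville (n + h') = -1, bigOmega (n + h') = b &
      forall q, prime q -> (q %| n + h')%N -> exp (c0 * ln (n + h)%:R) < q%:R]].
have Qm h h' b M M' : (M <= M')%N -> Q h h' b M' -> Q h h' b M.
  by move=> MM [n [h1 h2 h3 h4]]; exists n; split=> //; exact: leq_trans h1.
have HQ M : exists h h' b, [/\ h \in H, h' \in H, b \in iota 0 B.+1 & Q h h' b M].
  have [n [h [h' [Mn n0 hH h'H [hh hp lm hq]]]]] := HM M.
  exists h, h', (bigOmega (n + h')); split=> //; last by exists n.
  have lp : 2^-1 <= ln (n + h)%:R.
    by apply: le_trans ln2_ge _; rewrite ler_ln // (ler_nat R 2) prime_gt1.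
  have x0 : (0 < n + h')%N by rewrite addn_gt0 n0.
  have Ob := @bigOmega_bound (n + h') (c0 * ln (n + h)%:R) x0.
  have {}Ob : (bigOmega (n + h'))%:R * (c0 * ln (n + h)%:R) <= ln (n + h')%:R.
    apply: Ob => r rp rd; rewrite -[ltLHS]expK ltr_ln ?exp_gt0 //; exact: hq.
  have l27 : ln (n + h')%:R <= 26 + ln (n + h)%:R.
    apply: le_trans (_ : ln (27 * (n + h)%:R) <= _).
      apply: ler_ln; first by rewrite ltr0n.
      have /andP[h'D _] := HD h' h'H.
      have e1 : h'%:R <= 26 :> R by rewrite ler_nat; exact: leq_trans h'D D26.
      have e2 : 1 <= n%:R :> R by rewrite ler1n.
      by have e3 := ler0n R h; rewrite !natrD; lra.
    have h27 : ln (27 : R) <= 27 - 1 by apply: ln_sub1; lra.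
    have n27 : 0 < 27 :> R by lra.
    have nh0 : 0 < (n + h)%:R :> R by rewrite ltr0n prime_gt0.
    rewrite lnM //.
    have e26 : 27 - 1 = 26 :> R by lra.
    by rewrite lerD2r -e26; exact: h27.
  rewrite mem_iota add0n ltnS leq0n /= leqNgt; apply/negP => Bb.
  have i0 : 0 <= 53 / c0 by rewrite divr_ge0 // ltW.
  have /andP[_ hB] := truncn_itv i0.
  have h53 : 53 / c0 < (bigOmega (n + h'))%:R by apply: lt_le_trans hB _; rewrite ler_nat.
  rewrite ltr_pdivrMr // in h53.
  have lp0 : 0 < ln (n + h)%:R by apply: lt_le_trans lp; rewrite invr_gt0.
  have h1 : 53 * ln (n + h)%:R < (bigOmega (n + h'))%:R * (c0 * ln (n + h)%:R) by rewrite mulrA ltr_pM2r.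
  have h2 := lt_le_trans h1 (le_trans Ob l27).
  by clear - h2 lp; lra.
have [h hH Hh] : exists2 h, h \in H & forall M, exists h' b, [/\ h' \in H, b \in iota 0 B.+1 & Q h h' b M].
  apply: (@decreasing_pigeonhole _ H (fun h M => exists h' b, [/\ h' \in H, b \in iota 0 B.+1 & Q h h' b M])).
    by move=> h M M' MM [h' [b [h1 h2 h3]]]; exists h', b; split=> //; exact: Qm h3.
  by move=> M; have [h [h' [b [h1 h2 h3 h4]]]] := HQ M; exists h => //; exists h', b.
have [h' h'H Hh'] : exists2 h', h' \in H & forall M, exists2 b, b \in iota 0 B.+1 & Q h h' b M.
  apply: (@decreasing_pigeonhole _ H (fun h' M => exists2 b, b \in iota 0 B.+1 & Q h h' b M)).
    by move=> x M M' MM [b h1 h2]; exists b => //; exact: Qm h2.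
  by move=> M; have [x [b [h1 h2 h3]]] := Hh M; exists x => //; exists b.
have [b bB Hb] := decreasing_pigeonhole (Qm h h') Hh'.
have /andP[hD ho] := HD h hH; have /andP[h'D h'o] := HD h' h'H.
have [n0 [_ _ hh [_ lm Ob _]]] := Hb 0%N.
rewrite /almost_prime_gap; exists B%:R, c0; split; first by [].
exists b, (Posz h' - Posz h)%R.
have ob : odd b by rewrite -Ob; exact: odd_bigOmega.
split=> //; split; first by move: bB; rewrite mem_iota add0n ltnS INRE ler_nat => /andP[_].
split; first exact: odd_absz_sub.
split; first exact: absz_sub_gt0.
split; first exact: absz_sub_le.
move=> M; have [n [Mn n1 _ [pp _ On hq]]] := Hb M.
exists (n + h)%N; split=> //; split=> //.
rewrite absz_shift.
split=> //; rewrite /least_prime_factor !INRE Rpower_exp.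
(* [pdiv] is a prime only above [1]; the value [1] would have no prime factors, against the oddness
   of [b]. *)
have x1 : (1 < n + h')%N.
  rewrite ltn_neqAle addn_gt0 n1 andbT eq_sym; apply/eqP => E1.
  have b0 : b = 0%N by rewrite -On E1 /bigOmega (_ : primes 1 = [::]) ?big_nil.
  by rewrite b0 in ob.
by apply: hq; [exact: pdiv_prime | exact: pdiv_dvd].
Qed.

Lemma almost_prime_gap_of_tuple (H : seq nat) (K m num D : nat) (a b c : Z) (theta0 : R) :
  uniq H -> size H = K.+2 -> (K.+2 < 40)%N -> all (fun h => (h <= D)%N && ~~ odd h) H -> (D <= 26)%N ->
  all (fun p => has (fun r => ~~ hit H p r) (iota 0 p)) (iota 2 38) ->
  (1 < m)%N -> Z.leb 0 a -> Z.leb 0 b -> Z.leb 0 c -> zcheck K m num a b c ->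
  theta0 = num%:R / 1000%:R -> 0 < theta0 -> theta0 < 1 ->
  (exists theta : R, theta0 < theta /\ condA theta /\ condB theta) -> almost_prime_gap D.
Proof.
move=> uH sH K40 HD D26 adm m1 /Z.leb_le a0 /Z.leb_le b0 /Z.leb_le c0 chk tE t0 t1 [theta [tt [HA HB]]].
have {}HD h : h \in H -> (h <= D)%N && ~~ odd h := allP HD h.
have H26 h : h \in H -> (h <= 26)%N by move=> /HD /andP[hD _]; exact: leq_trans hD D26.
have z x : Z.le 0 x -> 0 <= IZR x by move=> x0; apply/RleP; exact: (IZR_le 0 x x0).
have ineq : @upper_const R K m (test_fun (IZR a) (IZR b) (IZR c) m) <
    (K.+1)%:R * theta0 * @lower_const R K m (test_fun (IZR a) (IZR b) (IZR c) m) / m%:R.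
  by rewrite tE; first [exact: numerics_check m1 chk | exact: numerics_check a0 b0 c0 m1 chk | apply: numerics_check; eassumption].
have [e e0 He] := @sieve_core H K m (IZR a) (IZR b) (IZR c) theta0 theta uH sH K40 H26 adm
  (ltnW m1) (z a a0) (z b b0) (z c c0) t0 t1 tt HA HB ineq.
exact: (@sieve_to_theorem H D e e0 HD D26 He).
Qed.

Theorem theorem8 (theta0 : R) (D : nat) :
  ((theta0 = 924/1000 /\ D = 6%N) \/ (theta0 = 739/1000 /\ D = 8%N) \/
   (theta0 = 643/1000 /\ D = 12%N) \/ (theta0 = 584/1000 /\ D = 16%N) \/
   (theta0 = 544/1000 /\ D = 20%N) \/ (theta0 = 516/1000 /\ D = 26%N))%R ->
  (exists theta : R, (theta0 < theta)%R /\ condA theta /\ condB theta) ->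
  exists (C c : R), (0 < c)%R /\
  exists (b : nat) (d : int),
    odd b /\ (INR b <= C)%R /\
    ~~ odd (absz d) /\ (0 < absz d)%N /\ (absz d <= D)%N /\
    forall M : nat, exists p : nat,
      (M <= p)%N /\ prime p /\
      (INR (least_prime_factor (absz (Posz p + d)%R)) > Rpower (INR p) c)%R /\
      bigOmega (absz (Posz p + d)%R) = b.
Proof.
case=> [[-> ->]|[[-> ->]|[[-> ->]|[[-> ->]|[[-> ->]|[-> ->]]]]]] hth.
(* The tuples are narrowest admissible ones of sizes [3] to [8]; their diameters are the six values
   of [D]. *)
- by apply: (@almost_prime_gap_of_tuple [:: 0; 2; 6]%N 1 (Z.to_nat 4762) 924 6 1 2 1 _ isT erefl isT isT isT _ _ isT isT isT check3 erefl _ _ hth); [vm_compute | vm_compute | lra | lra].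
- by apply: (@almost_prime_gap_of_tuple [:: 0; 2; 6; 8]%N 2 (Z.to_nat 6333) 739 8 1 3 4 _ isT erefl isT isT isT _ _ isT isT isT check4 erefl _ _ hth); [vm_compute | vm_compute | lra | lra].
- by apply: (@almost_prime_gap_of_tuple [:: 0; 2; 6; 8; 12]%N 3 (Z.to_nat 7641) 643 12 1 3 8 _ isT erefl isT isT isT _ _ isT isT isT check5 erefl _ _ hth); [vm_compute | vm_compute | lra | lra].
- by apply: (@almost_prime_gap_of_tuple [:: 0; 4; 6; 10; 12; 16]%N 4 (Z.to_nat 8164) 584 16 1 4 13 _ isT erefl isT isT isT _ _ isT isT isT check6 erefl _ _ hth); [vm_compute | vm_compute | lra | lra].
- by apply: (@almost_prime_gap_of_tuple [:: 0; 2; 6; 8; 12; 18; 20]%N 5 (Z.to_nat 8557) 544 20 1 4 20 _ isT erefl isT isT isT _ _ isT isT isT check7 erefl _ _ hth); [vm_compute | vm_compute | lra | lra].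
- by apply: (@almost_prime_gap_of_tuple [:: 0; 2; 6; 8; 12; 18; 20; 26]%N 6 (Z.to_nat 8164) 516 26 1 4 29 _ isT erefl isT isT isT _ _ isT isT isT check8 erefl _ _ hth); [vm_compute | vm_compute | lra | lra].
Qed.
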